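(* Let $H=\{H_n\}_{n\ge1}\subset(0,1/2)$ with $H_n\searrow0$ as $n\to\infty$, and let $\{B^{H_n,n}\}_{n\ge1}$ be independent $d$-dimensional fractional Brownian motions with Hurst parameters $H_n$, given by $B^{H_n,n}_t=\int_0^tK_{H_n}(t,s)\,dW^n_s$ for independent $d$-dimensional standard Brownian motions $W^n$. Let $\lambda=\{\lambda_n\}_{n\ge1}\subset\mathbb{R}$ satisfy: $\lambda_n\neq0$ for infinitely many $n$ (i.e. there is a bijection $\{n:\lambda_n\ne0\}\to\mathbb{N}$); $\sum_{n\ge1}|\lambda_n|\in(0,\infty)$; and $\sum_{n\ge1}|\lambda_n|\,E[\sup_{0\le s\le1}|B^{H_n,n}_s|]<\infty$. Define $$\mathbb{B}^H_t:=\sum_{n=1}^\infty\lambda_nB^{H_n,n}_t,\qquad t\in[0,T].$$ Then: (1) for every $t\in[0,T]$ the series converges $P$-a.s. and $\mathbb{B}^H_t$ is a well-defined element of $L^2(\Omega)$; (2) $\mathbb{B}^H_t$ is normally distributed with zero mean and $E[\mathbb{B}^H_t(\mathbb{B}^H_s)^\ast]=\sum_{n=1}^\infty\lambda_n^2R_{H_n}(t,s)\,I_d$, where $R_{H_n}(t,s)=\frac12(s^{2H_n}+t^{2H_n}-|t-s|^{2H_n})$, $\ast$ is transposition and $I_d$ is the $d\times d$ identity matrix; (3) $\mathbb{B}^H$ has stationary increments; (4) $\mathbb{B}^H$ does not admit any version with Hölder continuous paths of any order; (5) $\mathbb{B}^H$ has no finite $p$-variation for any order $p>0$, hence is not a semimartingale;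 (6) $\mathbb{B}^H$ is not a Markov process, and hence does not possess independent increments; (7) (by virtue of the last summability condition) $\mathbb{B}^H$ has $P$-a.s. continuous sample paths.
   Context: $T>0$ and $d\ge1$ are fixed. For $H\in(0,1/2)$, $0<s<t$, $$K_H(t,s)=c_H\Big[\big(\tfrac ts\big)^{H-\frac12}(t-s)^{H-\frac12}+\big(\tfrac12-H\big)s^{\frac12-H}\int_s^tu^{H-\frac32}(u-s)^{H-\frac12}du\Big],\quad c_H=\sqrt{\tfrac{2H}{(1-2H)\beta(1-2H,H+1/2)}},$$ where $\beta(\cdot,\cdot)$ is the Beta function. Continuity of paths is understood up to passing to a version. *)

(* Defs.v *)
From HB Require Import structures.
From mathcomp Require Import all_boot all_order all_algebra.
From mathcomp Require Import all_classical all_reals all_analysis.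

Set Implicit Arguments.
Unset Strict Implicit.
Unset Printing Implicit Defensive.

Import Order.TTheory GRing.Theory Num.Theory.
Import numFieldNormedType.Exports.

Local Open Scope classical_set_scope.
Local Open Scope ring_scope.

(** An R^d-valued process indexed by real times is a function
    X : R -> Omega -> 'cV[R]_d; it is only ever looked at on the relevant set
    of times, [0, T] or [0, +oo[.  Sequences indexed by n >= 1 in the
    mathematical text are indexed by nat, starting at 0. *)

(** The norm that the library puts on 'cV[R]_d is the sup norm. *)
Definition enorm (R : realType) (d : nat) (x : 'cV[R]_d) : R :=
  Num.sqrt (\sum_(i < d) x i 0 ^+ 2).

Definition sigma_of (R : realType) (I U : Type) (D : set I)
    (f : I -> U -> R) : set (set U) :=
  <<s \bigcup_(i in D) preimage_set_system setT (f i) measurable >>.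

Definition sigma_vec (R : realType) (d : nat) (U : Type)
    (Y : U -> 'cV[R]_d) : set (set U) :=
  sigma_of setT (fun (i : 'I_d) w => Y w i 0).

Definition sigma_process (R : realType) (d : nat) (U : Type) (D : set R)
    (X : R -> U -> 'cV[R]_d) : set (set U) :=
  sigma_of (D `*` setT) (fun (j : R * 'I_d) w => X j.1 w j.2 0).

(** sigma_of setT (fun i f => f i) is the product sigma-algebra on I -> R. *)
Definition same_law dsp (Omega : measurableType dsp) (R : realType)
    (P : probability Omega R) (I : Type) (X Y : I -> Omega -> R) : Prop :=
  forall A : set (I -> R), sigma_of setT (fun i f => f i) A ->
    P [set w | A (X ^~ w)] = P [set w | A (Y ^~ w)].

Definition independent dsp (Omega : measurableType dsp) (R : realType)
    (P : probability Omega R) (D : set nat)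
    (G : nat -> set (set Omega)) : Prop :=
  forall (s : seq nat) (A : nat -> set Omega), uniq s ->
    (forall i, i \in s -> D i /\ G i (A i)) ->
    P (\bigcap_(i in [set` s]) A i) = (\prod_(i <- s) P (A i))%E.

Definition random_vector dsp (Omega : measurableType dsp) (R : realType)
    (d : nat) (X : Omega -> 'cV[R]_d) : Prop :=
  forall i, measurable_fun setT (fun w => X w i 0).

(** Entrywise expectation of a random matrix. *)
Definition mx_expectation dsp (Omega : measurableType dsp) (R : realType)
    (P : probability Omega R) (m n : nat) (X : Omega -> 'M[R]_(m, n)) :
    'M[R]_(m, n) :=
  \matrix_(i, j) fine ('E_P[fun w => X w i j])%E.

(** The case s = 0 is singled out because normal_prob m 0 is, by convention of
    the library, not the Dirac mass at m. *)
Definition normal_rv dsp (Omega : measurableType dsp) (R : realType)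
    (P : probability Omega R) (Y : Omega -> R) : Prop :=
  measurable_fun setT Y /\
  exists m s : R, 0 <= s /\
    forall A, measurable A ->
      P (Y @^-1` A) = if s == 0 then \d_m A else normal_prob m s A.

Definition normal_vector dsp (Omega : measurableType dsp) (R : realType)
    (P : probability Omega R) (d : nat) (X : Omega -> 'cV[R]_d) : Prop :=
  forall u : 'rV[R]_d, normal_rv P (fun w => (u *m X w) 0 0).

Definition gaussian_process dsp (Omega : measurableType dsp) (R : realType)
    (P : probability Omega R) (d : nat) (D : set R)
    (X : R -> Omega -> 'cV[R]_d) : Prop :=
  forall (k : nat) (t : 'I_k -> R) (u : 'I_k -> 'rV[R]_d),
    (forall j, D (t j)) ->
    normal_rv P (fun w => \sum_(j < k) (u j *m X (t j) w) 0 0).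

Definition independent_increments dsp (Omega : measurableType dsp)
    (R : realType) (P : probability Omega R) (d : nat) (D : set R)
    (X : R -> Omega -> 'cV[R]_d) : Prop :=
  forall (k : nat) (t : nat -> R),
    (forall j, (j <= k)%N -> D (t j)) ->
    (forall j, (j < k)%N -> t j <= t j.+1) ->
    independent P [set j | (j < k)%N]
      (fun j => sigma_vec (fun w => X (t j.+1) w - X (t j) w)).

Record brownian_motion dsp (Omega : measurableType dsp) (R : realType)
    (P : probability Omega R) (d : nat) (W : R -> Omega -> 'cV[R]_d) : Prop := {
  bm_random : forall t, 0 <= t -> random_vector (W t) ;
  bm_start : {ae P, forall w, W 0 w = 0} ;
  bm_indep : independent_increments P `[0, +oo[ W ;
  bm_normal : forall s t, 0 <= s -> s <= t ->
    normal_vector P (fun w => W t w - W s w) ;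
  bm_mean : forall s t, 0 <= s -> s <= t ->
    mx_expectation P (fun w => W t w - W s w) = 0 ;
  bm_cov : forall s t, 0 <= s -> s <= t ->
    mx_expectation P (fun w => (W t w - W s w) *m (W t w - W s w)^T)
      = (t - s)%:M ;
  bm_continuous : {ae P, forall w, {within `[0, +oo[, continuous (W ^~ w)}}
}.

Definition fbm_cov (R : realType) (H t s : R) : R :=
  2^-1 * (s `^ (2 * H) + t `^ (2 * H) - `|t - s| `^ (2 * H)).

Record fractional_brownian_motion dsp (Omega : measurableType dsp)
    (R : realType) (P : probability Omega R) (d : nat) (H : R)
    (B : R -> Omega -> 'cV[R]_d) : Prop := {
  fbm_gaussian : gaussian_process P `[0, +oo[ B ;
  fbm_mean : forall t, 0 <= t -> mx_expectation P (B t) = 0 ;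
  fbm_covE : forall t s, 0 <= t -> 0 <= s ->
    mx_expectation P (fun w => B t w *m (B s w)^T) = (fbm_cov H t s)%:M ;
  fbm_continuous : {ae P, forall w, {within `[0, +oo[, continuous (B ^~ w)}}
}.

(** The library's beta_fun only takes natural numbers as arguments. *)
Definition Beta (R : realType) (a b : R) : R :=
  \int[lebesgue_measure]_(x in `]0, 1[) (x `^ (a - 1) * (1 - x) `^ (b - 1)).

Definition cH (R : realType) (H : R) : R :=
  Num.sqrt (2 * H / ((1 - 2 * H) * Beta (1 - 2 * H) (H + 2^-1))).

Definition KH (R : realType) (H t s : R) : R :=
  cH H * ((t / s) `^ (H - 2^-1) * (t - s) `^ (H - 2^-1)
    + (2^-1 - H) * s `^ (2^-1 - H)
      * \int[lebesgue_measure]_(u in `[s, t])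
          (u `^ (H - 3 / 2) * (u - s) `^ (H - 2^-1))).

(** The list [:: (a_1, u_1, v_1); ...] encodes sum_i a_i 1_{]u_i, v_i]}. *)
Definition step_fun (R : realType) (phi : seq (R * R * R)) (x : R) : R :=
  \sum_(p <- phi) p.1.1 * \1_(`]p.1.2, p.2]) x.

Definition step_integral (R : realType) (Omega : Type) (d : nat)
    (W : R -> Omega -> 'cV[R]_d) (phi : seq (R * R * R)) (w : Omega) :
    'cV[R]_d :=
  \sum_(p <- phi) p.1.1 *: (W p.2 w - W p.1.2 w).

(** X = int_0^t f dW: the L^2(Omega)-limit of the integrals of step functions
    converging to f in L^2([0, t]); by the isometry it does not depend, up to
    a null set, on the approximating sequence. *)
Definition wiener_integral dsp (Omega : measurableType dsp) (R : realType)
    (P : probability Omega R) (d : nat) (W : R -> Omega -> 'cV[R]_d)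
    (t : R) (f : R -> R) (X : Omega -> 'cV[R]_d) : Prop :=
  random_vector X /\
  exists phi : nat -> seq (R * R * R),
    [/\ (forall k p, p \in phi k -> 0 <= p.1.2 /\ p.1.2 <= p.2 <= t),
        (\int[lebesgue_measure]_(x in `[0%R, t])
           ((f x - step_fun (phi k) x) ^+ 2)%:E)%E @[k --> \oo] --> 0%E &
        (\int[P]_w (enorm (X w - step_integral W (phi k) w) ^+ 2)%:E)%E
           @[k --> \oo] --> 0%E].

Definition series_process (R : realType) (Omega : Type) (d : nat)
    (lam : nat -> R) (B : nat -> R -> Omega -> 'cV[R]_d) (t : R) (w : Omega) :
    'cV[R]_d :=
  limn (series (fun n => lam n *: B n t w)).

Definition is_version dsp (Omega : measurableType dsp) (R : realType)
    (P : probability Omega R) (d : nat) (D : set R)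
    (X Y : R -> Omega -> 'cV[R]_d) : Prop :=
  forall t, D t -> {ae P, forall w, Y t w = X t w}.

Definition holder_path (R : realType) (d : nat) (alpha T : R)
    (f : R -> 'cV[R]_d) : Prop :=
  exists C : R, forall s t, 0 <= s <= T -> 0 <= t <= T ->
    enorm (f t - f s) <= C * `|t - s| `^ alpha.

Definition p_variation (R : realType) (d : nat) (p a b : R)
    (f : R -> 'cV[R]_d) : \bar R :=
  ereal_sup [set (\sum_(x <- zip s (a :: s)) enorm (f x.1 - f x.2) `^ p)%:E
            | s in itv_partition a b].

Definition stationary_increments dsp (Omega : measurableType dsp)
    (R : realType) (P : probability Omega R) (d : nat) (T : R)
    (X : R -> Omega -> 'cV[R]_d) : Prop :=
  forall (k : nat) (t : 'I_k -> R) (h : R), 0 <= h ->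
    (forall j, 0 <= t j /\ t j + h <= T) ->
    same_law P
      (fun (j : 'I_k * 'I_d) w => (X (t j.1 + h) w - X h w) j.2 0)
      (fun (j : 'I_k * 'I_d) w => (X (t j.1) w - X 0 w) j.2 0).

(** Y is a version of E[X | G]. *)
Definition cond_expectation dsp (Omega : measurableType dsp) (R : realType)
    (P : probability Omega R) (G : set (set Omega)) (X Y : Omega -> R) : Prop :=
  [/\ P.-integrable setT (EFin \o X),
      P.-integrable setT (EFin \o Y),
      forall C, measurable C -> G (Y @^-1` C) &
      forall A, G A ->
        (\int[P]_(w in A) (Y w)%:E = \int[P]_(w in A) (X w)%:E)%E].

(** P(E | F_s) = P(E | X_s) a.s. for every event E = {X_t \in A}, where (F_s)
    is the filtration generated by X. *)
Definition markov_process dsp (Omega : measurableType dsp) (R : realType)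
    (P : probability Omega R) (d : nat) (T : R)
    (X : R -> Omega -> 'cV[R]_d) : Prop :=
  forall s t, 0 <= s -> s <= t -> t <= T ->
  forall E, sigma_vec (X t) E ->
  exists Y Z : Omega -> R,
    [/\ cond_expectation P (sigma_process `[0, s] X) (\1_E) Y,
        cond_expectation P (sigma_vec (X s)) (\1_E) Z &
        {ae P, forall w, Y w = Z w}].

Definition filtration dsp (Omega : measurableType dsp) (R : realType) (T : R)
    (F : R -> set (set Omega)) : Prop :=
  (forall t, 0 <= t <= T -> sigma_algebra setT (F t) /\ F t `<=` measurable) /\
  (forall s t, 0 <= s -> s <= t -> t <= T -> F s `<=` F t).

Definition adapted (Omega : Type) (R : realType) (T : R)
    (F : R -> set (set Omega)) (X : R -> Omega -> R) : Prop :=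
  forall t, 0 <= t <= T -> forall C, measurable C -> F t (X t @^-1` C).

Definition cadlag (R : realType) (T : R) (f : R -> R) : Prop :=
  (forall t, 0 <= t < T -> f x @[x --> t^'+] --> f t) /\
  (forall t, 0 < t <= T -> cvg (f x @[x --> t^'-])).

Definition martingale dsp (Omega : measurableType dsp) (R : realType)
    (P : probability Omega R) (T : R) (F : R -> set (set Omega))
    (M : R -> Omega -> R) : Prop :=
  adapted T F M /\
  forall s t, 0 <= s -> s <= t -> t <= T -> cond_expectation P (F s) (M t) (M s).

Definition stopping_time (Omega : Type) (R : realType) (T : R)
    (F : R -> set (set Omega)) (tau : Omega -> R) : Prop :=
  (forall w, 0 <= tau w) /\
  (forall t, 0 <= t <= T -> F t [set w | tau w <= t]).

(** Real-valued stopping times suffice on [0, T], where a localizing sequence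
    is one that eventually reaches T. *)
Definition local_martingale dsp (Omega : measurableType dsp) (R : realType)
    (P : probability Omega R) (T : R) (F : R -> set (set Omega))
    (M : R -> Omega -> R) : Prop :=
  [/\ adapted T F M, {ae P, forall w, cadlag T (M ^~ w)} &
      exists tau : nat -> Omega -> R,
        [/\ forall k, stopping_time T F (tau k),
            {ae P, forall w, nondecreasing_seq (tau ^~ w)},
            {ae P, forall w, exists k, T <= tau k w} &
            forall k, martingale P T F (fun t w => M (Num.min t (tau k w)) w)]].

(** No filtration is fixed beforehand, and the decomposition X = M + A is only
    required up to a version, so that a negligible set of irregular paths does
    not by itself keep X from being a semimartingale. *)
Definition semimartingale dsp (Omega : measurableType dsp) (R : realType)
    (P : probability Omega R) (d : nat) (T : R)
    (X : R -> Omega -> 'cV[R]_d) : Prop :=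
  exists F : R -> set (set Omega), filtration T F /\
  forall i : 'I_d, exists M A : R -> Omega -> R,
    [/\ local_martingale P T F M /\ (forall w, M 0 w = 0),
        adapted T F A,
        {ae P, forall w, cadlag T (A ^~ w)},
        {ae P, forall w, bounded_variation 0 T (A ^~ w)} &
        forall t, 0 <= t <= T -> {ae P, forall w, X t w i 0 = M t w + A t w}].

(* Main.v *)
(** A law is determined by the means of the cosines of the linear combinations
    of its coordinates, and all laws are handled through these means.  The
    series of independent Gaussian processes is a centered Gaussian process
    whose increments have variance v(|t - s|), v(t) = sum_n lam_n^2 t^(2 H_n).

    - Self-similarity turns the bound on E sup_[0, 1] |B^n| into one on [0, T],
      so that the series almost surely converges uniformly on [0, T].
    - Since H_n tends to 0, v vanishes at 0 more slowly than any power; a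
      normalized increment of a Hoelder path would tend to 0 and the mean of
      its cosine to 1, but this mean is e^(-1/2).
    - The average of the cosines of the m normalized increments along a uniform
      grid has mean e^(-1/2) and, v being concave, variance at most 2 / m; along
      a path of finite p-variation it would tend to 1.
    - The same averages force the quadratic variation to blow up along uniform
      grids.  For the sum of a local martingale and of a process of bounded
      variation it remains bounded in probability, by localization and a
      weak-type inequality for the square functions of martingales.
    - If the process were Markov, the residual of the regression of x_r on x_s
      would be orthogonal to the positive part of x_t, so that
      R(r, t) R(s, s) = R(r, s) R(s, t) for r < s < t, which fails as r tends
      to 0.  Independent increments would make v additive, while it is strictly
      subadditive. *)

Require Import Defs.
From HB Require Import structures.
From mathcomp Require Import all_boot all_order all_algebra.
From mathcomp Require Import all_classical all_reals all_analysis.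
From mathcomp Require Import measurable_realfun.
From mathcomp Require Import ring lra.
Import Order.TTheory GRing.Theory Num.Theory.
Import numFieldNormedType.Exports.
Set Implicit Arguments.
Unset Strict Implicit.
Unset Printing Implicit Defensive.
Local Open Scope classical_set_scope.
Local Open Scope ring_scope.

(** * Expectations of bounded functions *)

(** Cosines keep everything real and bounded: with a free phase their means carry the whole
    characteristic function, and every indicator of a Borel set is reached from them by linear
    combinations and bounded limits. Once the series is built, the process enters only through its
    covariance (v(s) + v(t) - v(|t - s|)) / 2 and through a few inequalities on v inherited from the
    powers t^(2 H_n). The value e^(-1/2) is the mean cosine of a standard normal variable. In the
    averages over a grid, concavity makes distinct increments negatively correlated, with total
    correlation at most 1 in absolute value for each increment; with the diagonal this gives the 2
    in 2 / m. For semimartingales the obstacle is that the filtration is arbitrary and the stopped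
    martingale part merely integrable, so its square function is controlled in terms of its L^1
    norm, by a pathwise inequality whose stochastic sum has a bounded integrand. For the Markov
    property, changing the sign of the regression residual preserves its joint law with X_s, which
    gives the orthogonality relations. The resulting identity would force v(r) = O(r) as r tends to
    0, whereas v(r) >= C r^a for some a < 1. *)

Section bounded_expectation.
Context dsp (Omega : measurableType dsp) (R : realType) (P : probability Omega R).
Implicit Types f g : Omega -> R.

Lemma bounded_integrable (M : R) f : measurable_fun setT f ->
  (forall w, `|f w| <= M) -> P.-integrable setT (EFin \o f).
Proof.
move=> mf fM; apply: measurable_bounded_integrable => //.
  by rewrite -ge0_fin_numE// fin_num_measure.
exists M; split; first by rewrite num_real.
by move=> x Mx w _; exact: le_trans (fM w) (ltW Mx).
Qed.

Lemma Rintegral_cst_prob (r : R) : \int[P]_w r = r.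
Proof. by rewrite Rintegral_cst// [X in fine X]probability_setT mulr1. Qed.

Lemma dominated_cvg_Rintegral (f_ : nat -> Omega -> R) f g :
  (forall n, measurable_fun setT (f_ n)) -> measurable_fun setT f ->
  {ae P, forall w, f_ n w @[n --> \oo] --> f w} ->
  P.-integrable setT (EFin \o g) ->
  {ae P, forall w, forall n, `|f_ n w| <= g w} ->
  \int[P]_w f_ n w @[n --> \oo] --> \int[P]_w f w.
Proof.
move=> mf_ mf cf ig fg.
have [||||iF _ cI] := @dominated_convergence _ Omega R P setT measurableT
  (fun n => EFin \o f_ n) (EFin \o f) (EFin \o g) _ _ _ ig.
- by move=> n; exact/measurable_EFinP.
- exact/measurable_EFinP.
- by apply: filterS cf => w h _; apply: cvg_EFin => //; exact: nearW.
- by apply: filterS fg => w h n _ /=; rewrite lee_fin.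
by apply: fine_cvg; rewrite fineK//; exact: integrable_fin_num.
Qed.

Lemma bounded_cvg_Rintegral (M : R) (f_ : nat -> Omega -> R) f :
  (forall n, measurable_fun setT (f_ n)) -> (forall n w, `|f_ n w| <= M) ->
  measurable_fun setT f ->
  {ae P, forall w, f_ n w @[n --> \oo] --> f w} ->
  \int[P]_w f_ n w @[n --> \oo] --> \int[P]_w f w.
Proof.
move=> mf_ fM mf cf.
apply: (@dominated_cvg_Rintegral _ _ (cst M)) => //.
  exact: finite_measure_integrable_cst.
by apply: aeW => w n; exact: fM.
Qed.

Lemma ae_eq_Rintegral f g : measurable_fun setT f -> measurable_fun setT g ->
  {ae P, forall w, f w = g w} -> \int[P]_w f w = \int[P]_w g w.
Proof.
move=> mf mg fg; congr fine; apply: ae_eq_integral => //.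
- exact/measurable_EFinP.
- exact/measurable_EFinP.
- by apply: filterS fg => w /= -> _.
Qed.

End bounded_expectation.

(** * Orthogonality to all functions of a random variable *)

Section orthogonality.
Context dsp (Omega : measurableType dsp) (R : realType) (P : probability Omega R).
Implicit Types f g : Omega -> R.

Import HBNNSimple.
Let Rintegral_nnsfun_orth (h : {nnsfun measurableTypeR R >-> R}) f g :
  P.-integrable setT (EFin \o f) -> measurable_fun setT g ->
  (forall C, measurable C -> \int[P]_(w in g @^-1` C) f w = 0) ->
  \int[P]_w (h (g w) * f w) = 0.
Proof.
move=> fi mg fC.
have ih (C : set R) (c : R) : measurable C ->
    P.-integrable setT (EFin \o (fun w => c * \1_C (g w) * f w)).
  move=> mC.
  have mgC : measurable (g @^-1` C) by rewrite -[X in measurable X]setTI; exact: mg.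
  rewrite (_ : _ \o _ = fun w => (c%:E * ((EFin \o f) \_ (g @^-1` C)) w)%E); last first.
    apply/funext => w /=; rewrite patchE /= indicE.
    have -> : (w \in g @^-1` C) = (g w \in C) by apply/idP/idP; rewrite !inE.
    by case: ifPn => _; [rewrite mulr1 EFinM|rewrite mulr0 mul0r; exact/esym/mule0].
  apply: integrableZl => //; apply/(integrable_mkcond (EFin \o f) mgC).
  exact: integrableS fi.
rewrite /Rintegral.
under eq_integral => w _.
  rewrite fimfunEord mulr_suml -sumEFin.
  over.
rewrite integral_sum//=; last first.
  move=> i; set c := _`_i.
  have mC : measurable (h @^-1` [set c]) by apply: measurable_funPTI; exact: measurable_set1.
  exact: (ih _ c mC).
rewrite big1// => i _.
set c := _`_i; set C := _ @^-1` _.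
have mC : measurable C by apply: measurable_funPTI; exact: measurable_set1.
have mgC : measurable (g @^-1` C) by rewrite -[X in measurable X]setTI; exact: mg.
rewrite (_ : (fun w => _) = fun w => (c%:E * ((EFin \o f) \_ (g @^-1` C)) w)%E); last first.
  apply/funext => w /=; rewrite patchE /= indicE.
  have -> : (w \in g @^-1` C) = (g w \in C) by apply/idP/idP; rewrite !inE.
  by case: ifPn => _; [rewrite mulr1 EFinM|rewrite mulr0 mul0r; exact/esym/mule0].
rewrite integralZl//; last by apply/(integrable_mkcond (EFin \o f) mgC); exact: integrableS fi.
rewrite -integral_mkcond/=.
have /= := fC C mC; rewrite /Rintegral /= => h0.
rewrite -[X in (_ * X)%E]fineK; last by apply: integrable_fin_num => //; exact: integrableS fi.
by rewrite h0 mule0.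
Qed.

(** Simple functions of [g] increasing to its positive and negative parts reduce the claim to
    indicators; [g * f] dominates. This is how statements about events (independence, conditional
    expectations) are turned into statements about functions. *)
Lemma Rintegral_orth f g :
  P.-integrable setT (EFin \o f) -> measurable_fun setT g ->
  P.-integrable setT (EFin \o (fun w => g w * f w)) ->
  (forall C, measurable C -> \int[P]_(w in g @^-1` C) f w = 0) ->
  \int[P]_w (g w * f w) = 0.
Proof.
move=> fi mg gfi fC.
have mf : measurable_fun setT f by apply/measurable_EFinP; exact: measurable_int fi.
(* For [s = 1] and [s = -1] this is the positive part and the negative part of [x]. *)
pose p (s : R) (x : R) : \bar R := (Num.max (s * x) 0)%:E.
have mp s : measurable_fun [set: measurableTypeR R] (p s).
  apply/measurable_EFinP; apply: measurable_maxr => //; exact: mulrl_measurable.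
pose a s n := nnsfun_approx measurableT (mp s) n.
have p0 s x : setT x -> (0 <= p s x)%E by rewrite lee_fin le_max lexx orbT.
have ca s x : a s n x @[n --> \oo] --> Num.max (s * x) 0.
  have := cvg_nnsfun_approx measurableT (mp s) (p0 s) (I : setT x).
  by move=> /fine_cvgP[].
have la s n x : `|a s n x| <= `|s * x|.
  rewrite ger0_norm ?fun_ge0//.
  have nda : nondecreasing_seq (fun n => a s n x).
    by move=> m k mk; have /lefP := nd_nnsfun_approx measurableT (mp s) mk.
  have := nondecreasing_cvgn_le nda (cvgP _ (ca s x)) n.
  rewrite (cvg_lim _ (ca s x))// => /le_trans; apply.
  by rewrite ge_max ler_norm normr_ge0.
have ig : P.-integrable setT (EFin \o (fun w => `|g w * f w|)).
  exact: integrable_norm gfi.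
have main s : `|s| = 1 -> \int[P]_w (Num.max (s * g w) 0 * f w) = 0.
  move=> s1.
  have mas n : measurable_fun setT (fun w => a s n (g w) * f w).
    apply: measurable_funM => //.
    by apply: (measurableT_comp (f := a s n)) => //; exact: measurable_funPT.
  have : \int[P]_w (a s n (g w) * f w) @[n --> \oo] -->
         \int[P]_w (Num.max (s * g w) 0 * f w).
    apply: (dominated_cvg_Rintegral mas _ _ ig).
    - apply: measurable_funM => //; apply: measurable_maxr => //.
      exact: measurable_funM.
    - apply: aeW => w; apply: cvgM; [exact: ca|exact: cvg_cst].
    - apply: aeW => w n; rewrite !normrM ler_wpM2r//.
      by rewrite (le_trans (la _ _ _))// normrM s1 mul1r.
  under eq_cvg => n do rewrite Rintegral_nnsfun_orth//.
  by move=> h; apply: (cvg_unique (@Rhausdorff R) h); exact: cvg_cst.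
have gE w : g w * f w = Num.max (1 * g w) 0 * f w - Num.max ((-1) * g w) 0 * f w.
  rewrite -mulrBl mul1r mulN1r; congr (_ * _).
  have [h|/ltW h] := leP 0 (g w).
    by rewrite max_r ?oppr_le0// subr0.
  by rewrite max_l ?oppr_ge0// sub0r opprK.
have mi s : `|s| = 1 -> P.-integrable setT (EFin \o (fun w => Num.max (s * g w) 0 * f w)).
  move=> s1; apply: le_integrable ig => //.
    apply/measurable_EFinP; apply: measurable_funM => //.
    by apply: measurable_maxr => //; exact: measurable_funM.
  move=> w _; rewrite /= lee_fin normr_id !normrM ler_wpM2r//.
  rewrite ger0_norm ?le_max ?lexx ?orbT// ge_max normr_ge0 andbT.
  by rewrite (le_trans (ler_norm _))// normrM s1 mul1r.
under eq_Rintegral do rewrite gE.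
by rewrite RintegralB ?main ?subr0 ?normrN ?normr1//; apply: mi; rewrite ?normrN normr1.
Qed.

End orthogonality.

(** * The characteristic function of the normal law *)

Section integral_normal_prob.
Variables (R : realType) (m s : R).
Hypothesis s0 : s != 0.
Notation mu := lebesgue_measure.

(** The Radon-Nikodym derivative of the law and its explicit density have the same integral over
    every measurable set, so they agree almost everywhere. *)
Lemma integral_normal_prob (f : R -> R) :
  (normal_prob m s).-integrable setT (EFin \o f) ->
  (\int[normal_prob m s]_x (f x)%:E = \int[mu]_x (f x * normal_pdf m s x)%:E)%E.
Proof.
move=> fi.
have mf : measurable_fun [set: measurableTypeR R] f.
  by apply/measurable_EFinP; exact: measurable_int fi.
have dom := normal_prob_dominates m s.
rewrite -(Radon_Nikodym_change_of_variables dom)//=.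
under [RHS]eq_integral do rewrite EFinM.
apply: ae_eq_integral => //.
- apply: emeasurable_funM; first exact/measurable_EFinP.
  by apply: (measurable_int mu); exact: Radon_Nikodym_integrable.
- apply: emeasurable_funM; apply/measurable_EFinP => //.
  exact: measurable_normal_pdf.
- apply: ae_eqe_mul2l => /=.
  rewrite Radon_NikodymE/=.
  case: cid => /= h [h1 h2 h3].
  apply: integral_ae_eq => //=.
  + by apply/measurable_EFinP; exact: measurable_normal_pdf.
  + by move=> E _ mE; rewrite -h3.
Qed.

Let g (c x : R) : R := expR (- (x - m) ^+ 2 / c).

Let n := normal_pdf m s.

Let p := normal_peak s.

Let nE : n = fun x => p * g (s ^+ 2 *+ 2) x.
Proof. by rewrite /n normal_pdfE. Qed.

Let dn (x : R) : is_derive x 1 n (- (x - m) / s ^+ 2 * n x).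
Proof.
rewrite nE /g; apply: is_derive_eq.
by rewrite /GRing.scale/= -[s ^+ 2 *+ 2]mulr_natr; field.
Qed.

Let K : R := p * (1 + 4 * s ^+ 2) / normal_peak (Num.sqrt 2 * s).

(** A multiple of a normal density with twice the variance: an integrable majorant for all the
    integrands of this section. The constant [K] trades the peak of that density for
    [p * (1 + 4 * s ^+ 2)]. *)
Let envelope (x : R) : R := K * normal_pdf m (Num.sqrt 2 * s) x.

Let s20 : Num.sqrt 2 * s != 0.
Proof. by rewrite mulf_neq0// gt_eqF// sqrtr_gt0. Qed.

Let ms2 : 0 < s ^+ 2. Proof. by rewrite exprn_even_gt0. Qed.

Let envelopeE x : envelope x = p * (1 + 4 * s ^+ 2) * g (4 * s ^+ 2) x.
Proof.
rewrite /envelope normal_pdfE// /normal_fun exprMn sqr_sqrtr// mulrA divfK.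
  by congr (_ * expR (_ / _)); lra.
by rewrite gt_eqF// normal_peak_gt0.
Qed.

(** The exponential of [n] is the square of the wider one, [e]; one factor [e] is kept and the other
    absorbs [|x - m|], because [y ^+ 2 * e] is bounded. *)
Let envelope_ge x : n x + `|x - m| * n x <= 2 * envelope x.
Proof.
rewrite envelopeE nE /g; set y := x - m.
have -> : - y ^+ 2 / (s ^+ 2 *+ 2) = - y ^+ 2 / (4 * s ^+ 2) + - y ^+ 2 / (4 * s ^+ 2).
  by rewrite -[s ^+ 2 *+ 2]mulr_natr; field.
rewrite expRD; set e := expR _.
have p0 : 0 < p by exact: normal_peak_gt0.
have e0 : 0 < e by exact: expR_gt0.
have e1 : e <= 1 by rewrite -expR0 ler_expR mulr_le0_ge0// ?oppr_le0 ?sqr_ge0// invr_ge0 mulr_ge0// ltW.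
have h : y ^+ 2 * e <= 4 * s ^+ 2.
  have := expR_ge1Dx (y ^+ 2 / (4 * s ^+ 2)).
  have -> : expR (y ^+ 2 / (4 * s ^+ 2)) = e^-1 by rewrite -expRN mulNr opprK.
  move=> h; have : y ^+ 2 / (4 * s ^+ 2) <= e^-1 by lra.
  have c0 : 0 < 4 * s ^+ 2 by rewrite mulr_gt0.
  by rewrite ler_pdivrMr// => h2; rewrite -ler_pdivlMr// mulrC.
have hy : `|y| <= 1 + y ^+ 2.
  by rewrite -[y ^+ 2]real_normK ?num_real//; have := sqr_ge0 (`|y| - 1); nra.
have hh : e + `|y| * e <= 2 * (1 + 4 * s ^+ 2).
  have : `|y| * e <= (1 + y ^+ 2) * e by rewrite ler_wpM2r// ltW.
  by have := ltW ms2; lra.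
have := ler_wpM2l (mulr_ge0 (ltW p0) (ltW e0)) hh.
by lra.
Qed.

Let envelope_ge0 x : 0 <= envelope x.
Proof.
have := envelope_ge x; have := normal_pdf_ge0 m s x; rewrite -/n => n0.
have : 0 <= `|x - m| * n x by rewrite mulr_ge0.
by lra.
Qed.

Let integrable_envelope : mu.-integrable setT (EFin \o (fun x => 2 * envelope x)).
Proof.
rewrite (_ : _ \o _ = fun x => ((2 * K)%:E * (normal_pdf m (Num.sqrt 2 * s) x)%:E)%E); last first.
  by apply/funext => x /=; rewrite /envelope mulrA EFinM.
apply: integrableZl => //; exact: integrable_normal_pdf.
Qed.

(** From [1 + q <= expR q]. The modest rate 1 / (k + 1) is enough for the boundary terms of the
    integration by parts to vanish. *)
Let normal_pdf_decay (k : nat) (e : R) : `|e| = 1 ->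
  n (m + e * k.+1%:R) <= p * (2 * s ^+ 2) * k.+1%:R^-1.
Proof.
move=> e1; rewrite nE /g addrAC subrr add0r -mulrA ler_wpM2l//; first exact: normal_peak_ge0.
have e2 : e ^+ 2 = 1 by rewrite -real_normK ?num_real// e1 expr1n.
rewrite exprMn e2 mul1r mulNr expRN -[leRHS]invrK lef_pV2 ?posrE ?expR_gt0//; last first.
  by rewrite invr_gt0 divr_gt0// mulr_gt0.
rewrite invfM invrK; apply: le_trans (expR_ge1Dx _).
rewrite -[s ^+ 2 *+ 2]mulr_natl -mulrA.
set q := k.+1%:R / (2 * s ^+ 2).
have q0 : 0 <= q by rewrite divr_ge0// mulr_ge0// ltW.
have k1 : 1 <= k.+1%:R :> R by rewrite ler1n.
rewrite -/q mulrC -/q. have := ler_wpM2r q0 k1. lra.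
Qed.

Section stein.
Variables (a b : R).

Let h x := sin (a * (x - m) + b) * n x.

Let h' x := a * (cos (a * (x - m) + b) * n x) - (x - m) / s ^+ 2 * (sin (a * (x - m) + b) * n x).

Let dh (x : R) : is_derive x 1 h (h' x).
Proof.
have da : is_derive x 1 (fun x => a * (x - m) + b) a.
  by apply: is_derive_eq; rewrite /GRing.scale/=; lra.
have ds := @is_derive1_comp _ sin (fun x => a * (x - m) + b) x _ _ (is_derive_sin _) da.
apply: (is_derive_eq (is_deriveM ds (dn x))).
rewrite /GRing.scale/= /h'; field.
by [].
Qed.

Let derivable_h (x : R) : derivable h x 1.
Proof. by case: (dh x). Qed.

Let h'_le x : `|h' x| <= (`|a| + (s ^+ 2)^-1) * (2 * envelope x).
Proof.
have n0 : 0 <= n x by exact: normal_pdf_ge0.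
have c1 : `|cos (a * (x - m) + b)| <= 1 by rewrite ler_norml cos_geN1 cos_le1.
have s1 : `|sin (a * (x - m) + b)| <= 1 by rewrite ler_norml sin_geN1 sin_le1.
rewrite /h' (le_trans (ler_normB _ _))// !normrM (ger0_norm n0).
rewrite (ger0_norm (ltW _ : 0 <= (s ^+ 2)^-1)) ?invr_gt0// mulrDl lerD//.
  rewrite ler_wpM2l//; apply: le_trans (envelope_ge x).
  rewrite (le_trans (ler_wpM2r n0 c1))// mul1r lerDl.
  by rewrite mulr_ge0.
rewrite [`|x - m| * _]mulrC -mulrA ler_wpM2l ?invr_ge0 ?(ltW ms2)//.
apply: le_trans (envelope_ge x).
rewrite mulrCA (le_trans (ler_wpM2r _ s1)) ?mulr_ge0// mul1r.
by rewrite lerDr.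
Qed.

Let cn : continuous n.
Proof. exact: continuous_normal_pdf. Qed.

Let ccos : continuous (fun x => cos (a * (x - m) + b)).
Proof.
move=> x; apply: (continuous_comp (f := fun x => a * (x - m) + b)); last exact: continuous_cos.
by apply: cvgD; [apply: cvgM; [exact: cvg_cst|apply: cvgB; [exact: cvg_id|exact: cvg_cst]]|exact: cvg_cst].
Qed.

Let csin : continuous (fun x => sin (a * (x - m) + b)).
Proof.
move=> x; apply: (continuous_comp (f := fun x => a * (x - m) + b)); last exact: continuous_sin.
by apply: cvgD; [apply: cvgM; [exact: cvg_cst|apply: cvgB; [exact: cvg_id|exact: cvg_cst]]|exact: cvg_cst].
Qed.

Let ch' : continuous h'.
Proof.
move=> x; apply: cvgB; apply: cvgM.
- exact: cvg_cst.
- by apply: cvgM; [exact: ccos|exact: cn].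
- by apply: cvgM; [apply: cvgB; [exact: cvg_id|exact: cvg_cst]|exact: cvg_cst].
- by apply: cvgM; [exact: csin|exact: cn].
Qed.

Let I k := `[m - k.+1%:R, m + k.+1%:R]%classic : set R.

Let integral_h'_I k : (\int[mu]_(x in I k) (h' x)%:E = (h (m + k.+1%:R) - h (m - k.+1%:R))%:E)%E.
Proof.
rewrite /I EFinB; apply: continuous_FTC2.
- by rewrite ltrD2l gtrN.
- exact/continuous_subspaceT.
- split.
  + by move=> x _; exact: derivable_h.
  + by apply: cvg_at_right_filter; apply: differentiable_continuous; exact/derivable1_diffP.
  + by apply: cvg_at_left_filter; apply: differentiable_continuous; exact/derivable1_diffP.
- by move=> x _; rewrite derive1E; case: (dh x).
Qed.

Let integrable_h' : mu.-integrable setT (EFin \o h').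
Proof.
have := integrableZl measurableT (`|a| + (s ^+ 2)^-1) integrable_envelope.
apply: le_integrable => //.
  by apply/measurable_EFinP; exact: continuous_measurable_fun.
move=> x _; rewrite /= lee_fin (le_trans (h'_le x))// ler_norm//.
Qed.

Let h_bound (k : nat) (e : R) : `|e| = 1 ->
  `|h (m + e * k.+1%:R)| <= p * (2 * s ^+ 2) / k.+1%:R.
Proof.
move=> e1; apply: le_trans (normal_pdf_decay k e1).
rewrite /h normrM (ger0_norm (normal_pdf_ge0 _ _ _)) ler_piMl ?normal_pdf_ge0//.
by rewrite ler_norml sin_geN1 sin_le1.
Qed.

Let cvg_h_I : h (m + k.+1%:R) - h (m - k.+1%:R) @[k --> \oo] --> 0.
Proof.
apply/norm_cvg0P.
have hk k : `|h (m + k.+1%:R) - h (m - k.+1%:R)| <= 2 * (p * (2 * s ^+ 2)) * harmonic k.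
  rewrite (le_trans (ler_normB _ _))//.
  have := @h_bound k 1 (normr1 _); rewrite mul1r => h1.
  have := @h_bound k (-1); rewrite normrN normr1 mulN1r => /(_ erefl) h2.
  have -> : harmonic k = k.+1%:R^-1 :> R by [].
  by rewrite -mulrA mulr_natl mulr2n lerD.
apply: (squeeze_cvgr (f := cst 0) (h := fun k => 2 * (p * (2 * s ^+ 2)) * harmonic k)).
- by apply: nearW => k; rewrite /cst normr_ge0 hk.
- exact: cvg_cst.
- by rewrite -[X in _ --> X](mulr0 (2 * (p * (2 * s ^+ 2)))); apply: cvgM; [exact: cvg_cst|exact: cvg_harmonic].
Qed.

(** The fundamental theorem of calculus on the intervals [I k] leaves boundary values of [h], which
    tend to 0; dominated convergence identifies the limit of the integrals. *)
Let Rintegral_h' : \int[mu]_x h' x = 0.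
Proof.
have mI k : measurable (I k) by exact: measurable_itv.
have [||||_ _] := @dominated_convergence _ _ R mu setT measurableT
  (fun k => (EFin \o h') \_ (I k)) (EFin \o h') (fun x => `|(h' x)%:E|%E) _ _ _ (integrable_abse integrable_h').
- move=> k; apply/(measurable_restrictT _ (mI k)).
  by apply/measurable_EFinP; apply: measurable_funTS; exact: continuous_measurable_fun.
- by apply/measurable_EFinP; exact: continuous_measurable_fun.
- apply: aeW => x _; apply: cvg_near_cst.
  have Nx := archi_boundP (normr_ge0 ((x : R) - m)).
  exists (Num.bound `|(x : R) - m|) => // k /= Nk; rewrite patchE mem_set// /I/= in_itv/=.
  have : `|x - m| <= k.+1%:R.
    by rewrite (le_trans (ltW Nx))// ler_nat; apply: leq_trans Nk _.
  by rewrite ler_norml; lra.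
- apply: aeW => x k _; rewrite patchE; case: ifPn => // _.
  by rewrite (abse0 : `|point|%E = 0%E).
move=> c1.
have c2 : (\int[mu]_x ((EFin \o h') \_ (I k)) x)%E @[k --> \oo] --> (0%R)%:E.
  under eq_cvg => k do rewrite -integral_mkcond integral_h'_I.
  by apply: cvg_EFin; [exact: nearW|exact: cvg_h_I].
by rewrite /Rintegral (cvg_unique _ c1 c2).
Qed.

Lemma integrable_cos_normal_pdf : mu.-integrable setT (EFin \o (fun x => cos (a * (x - m) + b) * n x)).
Proof.
apply: le_integrable integrable_envelope => //.
  apply/measurable_EFinP; apply: continuous_measurable_fun => x.
  by apply: cvgM; [exact: ccos|exact: cn].
move=> x _; rewrite /= lee_fin [leRHS]ger0_norm; last by apply: mulr_ge0 => //; exact: envelope_ge0.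
apply: le_trans (envelope_ge x).
have n0 : 0 <= n x by exact: normal_pdf_ge0.
rewrite normrM (ger0_norm n0) (le_trans (ler_wpM2r n0 (_ : _ <= 1)))//.
  by rewrite ler_norml cos_geN1 cos_le1.
by rewrite mul1r lerDl mulr_ge0.
Qed.

Lemma integrable_sin_normal_pdf : mu.-integrable setT (EFin \o (fun x => (x - m) * (sin (a * (x - m) + b) * n x))).
Proof.
apply: le_integrable integrable_envelope => //.
  apply/measurable_EFinP; apply: continuous_measurable_fun => x.
  apply: cvgM; first by apply: cvgB; [exact: cvg_id|exact: cvg_cst].
  by apply: cvgM; [exact: csin|exact: cn].
move=> x _; rewrite /= lee_fin [leRHS]ger0_norm; last by apply: mulr_ge0 => //; exact: envelope_ge0.
apply: le_trans (envelope_ge x).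
have n0 : 0 <= n x by exact: normal_pdf_ge0.
rewrite !normrM (ger0_norm n0) mulrCA (le_trans (ler_wpM2r _ (_ : _ <= 1))) ?mulr_ge0//.
  by rewrite ler_norml sin_geN1 sin_le1.
by rewrite mul1r lerDr.
Qed.

(** Stein's identity: integration by parts against a density that satisfies n' = - (x - m) / s^2
    n. *)
Lemma normal_pdf_stein : \int[mu]_x ((x - m) * (sin (a * (x - m) + b) * n x)) =
  a * s ^+ 2 * \int[mu]_x (cos (a * (x - m) + b) * n x).
Proof.
have := Rintegral_h'.
rewrite (_ : h' = fun x => a * (cos (a * (x - m) + b) * n x) -
    (s ^+ 2)^-1 * ((x - m) * (sin (a * (x - m) + b) * n x))); last first.
  by apply/funext => x; rewrite /h' [(x - m) / _]mulrC -mulrA.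
rewrite RintegralB//; last 2 first.
- have := integrableZl measurableT a integrable_cos_normal_pdf.
  by apply: eq_integrable => // x _ /=; rewrite EFinM.
- have := integrableZl measurableT (s ^+ 2)^-1 integrable_sin_normal_pdf.
  by apply: eq_integrable => // x _ /=; rewrite EFinM.
rewrite RintegralZl//; last exact: integrable_cos_normal_pdf.
rewrite RintegralZl//; last exact: integrable_sin_normal_pdf.
move/eqP; rewrite subr_eq0 => /eqP e.
by rewrite mulrAC e mulrC mulVKf// expf_neq0.
Qed.

End stein.

Let F (b a : R) := \int[mu]_x (cos (a * (x - m) + b) * n x).

Let d_cos (b x a : R) :
  is_derive a 1 (fun a => cos (a * (x - m) + b) * n x)
    (- ((x - m) * (sin (a * (x - m) + b) * n x))).
Proof.
have da : is_derive a 1 (fun a => a * (x - m) + b) (x - m).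
  by apply: is_derive_eq; rewrite /GRing.scale/=; lra.
have dc := @is_derive1_comp _ cos (fun a => a * (x - m) + b) a _ _ (is_derive_cos _) da.
apply: (is_derive_eq (is_deriveM dc (is_derive_cst (n x) a 1))).
by rewrite /GRing.scale/=; lra.
Qed.

(** Differentiation under the integral sign produces the left-hand side of Stein's identity, which
    closes the linear equation F' = - a s^2 F. *)
Let dF (b a : R) : is_derive a 1 (F b) (- (a * s ^+ 2 * F b a)).
Proof.
have Ia : `]a - 1, a + 1[%classic a by rewrite /= in_itv/=; lra.
have i1 (a' : R) : `]a - 1, a + 1[%classic a' ->
    mu.-integrable setT (EFin \o (fun x => cos (a' * (x - m) + b) * n x)).
  by move=> _; exact: integrable_cos_normal_pdf.
have p1 (a' x : R) : partial1of2 (fun a x => cos (a * (x - m) + b) * n x) a' x =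
   - ((x - m) * (sin (a' * (x - m) + b) * n x)).
  by rewrite partial1of2E; case: (d_cos b x a').
have i2 (a' x : R) : `]a - 1, a + 1[%classic a' -> setT x ->
    derivable ((fun a0 => cos (a0 * (x - m) + b) * n x) : R -> R) a' 1.
  by move=> _ _; case: (d_cos b x a').
have i3 (a' x : R) : `]a - 1, a + 1[%classic a' -> setT x ->
    `|partial1of2 (fun a x => cos (a * (x - m) + b) * n x) a' x| <= 2 * envelope x.
  move=> _ _; rewrite p1 normrN; apply: le_trans (envelope_ge x).
  have n0 : 0 <= n x by exact: normal_pdf_ge0.
  rewrite !normrM (ger0_norm n0) mulrCA (le_trans (ler_wpM2r _ (_ : _ <= 1))) ?mulr_ge0//.
    by rewrite ler_norml sin_geN1 sin_le1.
  by rewrite mul1r lerDr.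
have G0 x : 0 <= 2 * envelope x by apply: mulr_ge0 => //; exact: envelope_ge0.
apply: DeriveDef.
  exact: (derivable_under_integral measurableT Ia i1 i2 G0 integrable_envelope i3).
rewrite -derive1E.
rewrite (differentiation_under_integral measurableT Ia i1 i2 G0 integrable_envelope i3).
under eq_Rintegral do rewrite p1.
rewrite -normal_pdf_stein.
rewrite -[RHS]mulN1r -RintegralZl//; last exact: integrable_sin_normal_pdf.
by apply: eq_Rintegral => x _; rewrite mulN1r.
Qed.

Lemma Rintegral_cos_normal_prob (a b : R) :
  \int[normal_prob m s]_x cos (a * x + b) = cos (a * m + b) * expR (- (a ^+ 2 * s ^+ 2) / 2).
Proof.
have -> : \int[normal_prob m s]_x cos (a * x + b) = F (a * m + b) a.
  rewrite /F /Rintegral; congr fine; rewrite integral_normal_prob.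
    by apply: eq_integral => x _; congr (cos _ * _)%:E; lra.
  apply: (@bounded_integrable _ _ _ _ 1).
    apply: (measurableT_comp (f := cos)) => //.
      by apply: continuous_measurable_fun; exact: continuous_cos.
    by apply: measurable_funD => //; exact: mulrl_measurable.
  by move=> x; rewrite ler_norml cos_geN1 cos_le1.
set b' := a * m + b.
(* The integrating factor of the equation for [F]: [u] is constant, and its value at 0 is
   [cos b']. *)
pose u a := F b' a * expR (a ^+ 2 * s ^+ 2 / 2).
have du (x : R) : is_derive x 1 u 0.
  have de : is_derive x 1 (fun a => expR (a ^+ 2 * s ^+ 2 / 2)) (x * s ^+ 2 * expR (x ^+ 2 * s ^+ 2 / 2)).
    by apply: is_derive_eq; rewrite /GRing.scale/=; field.
  apply: (is_derive_eq (is_deriveM (dF b' x) de)).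
  by rewrite /GRing.scale/=; lra.
have F0 : F b' 0 = cos b'.
  rewrite /F; under eq_Rintegral do rewrite mul0r add0r.
  rewrite RintegralZl//; last exact: integrable_normal_pdf.
  by rewrite /Rintegral integral_normal_pdf mulr1.
have : u a = u 0 by exact: is_derive_0_is_cst.
rewrite /u F0 expr0n/= !mul0r expR0 mulr1 => <-.
by rewrite -[RHS]mulrA -expRD mulNr subrr expR0 mulr1.
Qed.

End integral_normal_prob.

(** * Laws determined by means of cosines *)

Section trig_limit.
Context {R : realType}.
Implicit Types (f g : R -> R) (a b c : R) (A : set R).

(** The bounded functions whose integrals are determined by the integrals of
    cosines. *)
Inductive trig_limit : (R -> R) -> Prop :=
| trig_limit_cos a b : trig_limit (fun x => cos (a * x + b))
| trig_limit_lin c f g :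
    trig_limit f -> trig_limit g -> trig_limit (fun x => c * f x + g x)
| trig_limit_cvg (M : R) (f_ : nat -> R -> R) f :
    (forall n, trig_limit (f_ n)) -> (forall n x, `|f_ n x| <= M) ->
    (forall x, f_ n x @[n --> \oo] --> f x) -> trig_limit f.

Lemma eq_trig_limit f g : f =1 g -> trig_limit f -> trig_limit g.
Proof. by move=> /funext ->. Qed.

Lemma measurable_cos_affine a b :
  measurable_fun [set: R] (fun x : R => cos (a * x + b)).
Proof.
apply: (measurableT_comp (f := cos)).
  by apply: continuous_measurable_fun; exact: continuous_cos.
by apply: measurable_funD => //; exact: mulrl_measurable.
Qed.

Lemma measurable_fun_cos d (O : measurableType d) (f : O -> R) :
  measurable_fun setT f -> measurable_fun setT (fun w => cos (f w)).
Proof.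
by apply: measurableT_comp; apply: continuous_measurable_fun; exact: continuous_cos.
Qed.

Lemma trig_limit_measurable f : trig_limit f -> measurable_fun setT f.
Proof.
elim=> [a b|c {}f g _ mf _ mg|M f_ {}f _ mf_ _ cf].
- exact: measurable_cos_affine.
- by apply: measurable_funD => //; exact: measurable_funM.
- by apply: (@measurable_fun_cvg _ _ R setT f_) => // x _; exact: cf.
Qed.

Lemma norm_cos_le1 (x : R) : `|cos x| <= 1.
Proof. by rewrite ler_norml cos_geN1 cos_le1. Qed.

Lemma trig_limit_bounded f : trig_limit f -> exists M, forall x, `|f x| <= M.
Proof.
elim=> [a b|c {}f g _ [M fM] _ [N gN]|M f_ {}f _ _ fM cf].
- by exists 1 => x; exact: norm_cos_le1.
- exists (`|c| * M + N) => x.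
  by rewrite (le_trans (ler_normD _ _))// normrM lerD// ler_wpM2l.
- exists M => x; have cn : `|f_ n x| @[n --> \oo] --> `|f x| by exact: cvg_norm.
  by rewrite -(cvg_lim _ cn)//; apply: limr_le; [exact: cvgP cn|exact: nearW].
Qed.

Lemma trig_limit_cst c : trig_limit (cst c).
Proof.
apply: (@eq_trig_limit (fun x => (c - 1) * cos (0 * x + 0) + cos (0 * x + 0))).
  by move=> x; rewrite mul0r add0r cos0 /=; lra.
by apply: trig_limit_lin; exact: trig_limit_cos.
Qed.

Lemma trig_limitZ c f : trig_limit f -> trig_limit (fun x => c * f x).
Proof.
move=> hf; apply: (@eq_trig_limit (fun x => c * f x + cst 0 x)).
  by move=> x /=; rewrite addr0.
by apply: trig_limit_lin => //; exact: trig_limit_cst.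
Qed.

(** The product-to-sum formula settles two cosines. Linear combinations and bounded limits are then
    followed through in one factor with a cosine as the other, and finally in the remaining
    factor. *)
Lemma trig_limitM f g : trig_limit f -> trig_limit g -> trig_limit (fun x => f x * g x).
Proof.
have cosM a b h : trig_limit h -> trig_limit (fun x => cos (a * x + b) * h x).
  elim=> [a' b'|c {}f {}g _ hf _ hg|M f_ {}f _ hf_ fM cf].
  - apply: (@eq_trig_limit (fun x => 2^-1 * cos ((a + a') * x + (b + b')) +
        2^-1 * cos ((a - a') * x + (b - b')))).
      move=> x.
      have -> : (a + a') * x + (b + b') = (a * x + b) + (a' * x + b') by lra.
      have -> : (a - a') * x + (b - b') = (a * x + b) - (a' * x + b') by lra.
      by rewrite cosB cosD; lra.
    by apply: trig_limit_lin; [exact: trig_limit_cos|apply: trig_limitZ; exact: trig_limit_cos].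
  - apply: (eq_trig_limit _ (trig_limit_lin c hf hg)) => x /=; lra.
  - apply: (trig_limit_cvg (M := M) hf_).
      move=> n x; rewrite normrM; apply: le_trans (fM n x).
      by rewrite ler_piMl// norm_cos_le1.
    by move=> x; apply: cvgM; [exact: cvg_cst|exact: cf].
move=> + hg; elim=> [a b|c {}f f' _ hf _ hf'|M f_ {}f _ hf_ fM cf].
- exact: cosM.
- apply: (eq_trig_limit _ (trig_limit_lin c hf hf')) => x /=; lra.
- have [N gN] := trig_limit_bounded hg.
  apply: (trig_limit_cvg (M := M * N) hf_).
    by move=> n x; rewrite normrM ler_pM.
  by move=> x; apply: cvgM; [exact: cf|exact: cvg_cst].
Qed.

Lemma trig_limitX f n : trig_limit f -> trig_limit (fun x => f x ^+ n).
Proof.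
move=> hf; elim: n => [|n ih].
  by apply: (eq_trig_limit _ (trig_limit_cst 1)) => x /=.
by apply: (eq_trig_limit _ (trig_limitM hf ih)) => x /=; rewrite exprS.
Qed.

Lemma trig_limitC f : trig_limit f -> trig_limit (fun x => 1 - f x).
Proof.
move=> hf; apply: (eq_trig_limit _ (trig_limit_lin (-1) hf (trig_limit_cst 1))).
by move=> x /=; lra.
Qed.

Lemma Bernoulli_ge (x : R) (N : nat) : 0 <= x <= 1 -> 1 - N%:R * x <= (1 - x) ^+ N.
Proof.
move=> /andP[x0 x1]; elim: N => [|N ih]; first by rewrite expr0 mul0r subr0.
rewrite exprS; apply: le_trans (ler_wpM2l _ ih); last by rewrite subr_ge0.
rewrite -natr1; have : 0 <= N%:R * x * x by rewrite !mulr_ge0.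
by lra.
Qed.

Lemma Bernoulli_le (x : R) (N : nat) : 0 <= x <= 1 -> (1 - x) ^+ N * (1 + N%:R * x) <= 1.
Proof.
move=> /andP[x0 x1]; elim: N => [|N ih]; first by rewrite expr0 mul0r mul1r addr0.
apply: le_trans ih; rewrite exprSr -mulrA ler_wpM2l ?exprn_ge0 ?subr_ge0//.
rewrite -natr1; have : 0 <= N%:R * x * x by rewrite !mulr_ge0.
have : 0 <= x * x by rewrite mulr_ge0.
by lra.
Qed.

(** With r = q^2, Bernoulli's inequality bounds q^n by a multiple of 1 / (n + 1), so that n r^n is
    O(1 / (n + 1)). *)
Lemma cvg_natM_expr (r : R) : 0 <= r < 1 -> n%:R * r ^+ n @[n --> \oo] --> 0.
Proof.
move=> /andP[r0 r1]; pose q := Num.sqrt r.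
have q0 : 0 <= q by rewrite sqrtr_ge0.
have rE : r = q ^+ 2 by rewrite sqr_sqrtr.
have q1 : q < 1 by rewrite -(@ltr_pXn2r _ 2)// ?nnegrE// -rE expr1n.
have d0 : 0 < 1 - q by rewrite subr_gt0.
apply: (squeeze_cvgr (f := cst 0) (h := fun n => (1 - q) ^- 2 * harmonic n)).
- apply: nearW => n; rewrite /cst mulr_ge0 ?exprn_ge0//=.
  have := @Bernoulli_le (1 - q) n; rewrite subKr ltW//= gerBl => /(_ q0) h.
  have h1 : q ^+ n * ((1 - q) * n.+1%:R) <= 1.
    apply: le_trans h; rewrite ler_wpM2l ?exprn_ge0//.
    by rewrite -natr1 mulrDr mulr1 addrC mulrC lerD2r; lra.
  have h2 : (q ^+ n * ((1 - q) * n.+1%:R)) ^+ 2 <= 1.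
    by rewrite exprn_ile1// !mulr_ge0 ?exprn_ge0// ltW.
  rewrite -invfM -[leRHS]div1r ler_pdivlMr ?mulr_gt0 ?exprn_gt0//.
  rewrite rE exprAC; apply: le_trans h2.
  set Q := q ^+ n; set D := 1 - q.
  have -> : (Q * (D * n.+1%:R)) ^+ 2 = Q ^+ 2 * (D ^+ 2 * n.+1%:R) * n.+1%:R by lra.
  rewrite -[leLHS]mulrA [leLHS]mulrC ler_wpM2l ?ler_nat//.
  by rewrite mulr_ge0 ?sqr_ge0// mulr_ge0 ?sqr_ge0.
- exact: cvg_cst.
- by rewrite -[X in _ --> X](mulr0 ((1 - q) ^- 2)); apply: cvgM; [exact: cvg_cst|exact: cvg_harmonic].
Qed.

(* 1 - (1 - h^n)^(n 2^n) is a polynomial in h; on [0, 1] it converges to the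
   indicator function of [1/2, 1]. *)
Lemma trig_limit_ge_half f : trig_limit f -> (forall x, 0 <= f x <= 1) ->
  trig_limit (\1_[set x | 2^-1 <= f x]).
Proof.
move=> hf f01.
apply: (@trig_limit_cvg 1 (fun n x => 1 - (1 - f x ^+ n) ^+ (n * 2 ^ n))).
- by move=> n; do 2!(apply: trig_limitC; apply: trig_limitX).
- move=> n x; have /andP[f0 f1] := f01 x.
  have : 0 <= (1 - f x ^+ n) ^+ (n * 2 ^ n) <= 1.
    by rewrite exprn_ge0 ?subr_ge0 ?exprn_ile1//= ?lerBlDr ?lerDl ?exprn_ge0// subr_ge0 exprn_ile1.
  by rewrite ler_norml => /andP[]; lra.
move=> x; have /andP[f0 f1] := f01 x.
have fn n : 0 <= f x ^+ n <= 1 by rewrite exprn_ge0 ?exprn_ile1.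
have [h|h] := leP 2^-1 (f x).
- rewrite indicE mem_set//= -[X in _ --> X]subr0; apply: cvgB; first exact: cvg_cst.
  apply: (squeeze_cvgr (f := cst 0) (h := harmonic)).
  + apply: nearW => n; have /andP[? ?] := fn n.
    rewrite exprn_ge0 ?subr_ge0//=.
    have := @Bernoulli_le (f x ^+ n) (n * 2 ^ n) (fn n).
    rewrite -ler_pdivlMr ?div1r; last by rewrite ltr_wpDr// mulr_ge0.
    move/le_trans; apply; rewrite lef_pV2 ?posrE//; last by rewrite ltr_wpDr// mulr_ge0.
    rewrite -natr1 addrC lerD2l natrM -mulrA ler_peMr// natrX -exprMn.
    by rewrite exprn_ege1// mulrC -ler_pdivrMr// div1r.
  + exact: cvg_cst.
  + exact: cvg_harmonic.
- rewrite indicE memNset/=; last by rewrite leNgt h.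
  apply: (squeeze_cvgr (f := cst 0) (h := fun n => n%:R * (2 * f x) ^+ n)).
  + apply: nearW => n; have /andP[? ?] := fn n.
    rewrite /cst subr_ge0 exprn_ile1 ?subr_ge0//= ?lerBlDr ?lerDl//.
    have := @Bernoulli_ge (f x ^+ n) (n * 2 ^ n) (fn n).
    by rewrite exprMn natrM natrX mulrA; lra.
  + exact: cvg_cst.
  + by apply: cvg_natM_expr; lra.
Qed.

(** The function (1 + sin) / 2 takes its values in [0, 1] and reaches 1/2 exactly where the sine is
    nonnegative. *)
Lemma trig_limit_sin_ge0 a b : trig_limit (\1_[set x | 0 <= sin (a * x + b)]).
Proof.
have := @trig_limit_ge_half (fun x => 2^-1 * cos (a * x + (b - pi / 2)) + cst 2^-1 x).
have -> : [set x | 2^-1 <= 2^-1 * cos (a * x + (b - pi / 2)) + cst 2^-1 x] =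
    [set x | 0 <= sin (a * x + b)].
  by apply/seteqP; split => x /=; rewrite addrA cosBpihalf; lra.
apply.
  by apply: trig_limit_lin; [exact: trig_limit_cos|exact: trig_limit_cst].
move=> x /=.
have := cos_geN1 (a * x + (b - pi / 2)); have := cos_le1 (a * x + (b - pi / 2)).
by lra.
Qed.

(** For n large compared with |x - a|, the sine of (x - a) / n has the sign of x - a. *)
Lemma trig_limit_itvcy a : trig_limit (\1_`[a, +oo[).
Proof.
apply: (@trig_limit_cvg 1 (fun n => \1_[set x | 0 <= sin (n.+1%:R^-1 * x + (- a / n.+1%:R))])).
- by move=> n; exact: trig_limit_sin_ge0.
- by move=> n x; rewrite indicE ger0_norm// lern1 leq_b1.
move=> x; apply: cvg_near_cst.
pose K := Num.bound `|x - a|.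
have hK := archi_boundP (normr_ge0 (x - a)).
exists K => // n /= Kn.
have n0 : 0 < n.+1%:R :> R by rewrite ltr0n.
have xn : `|(x - a) / n.+1%:R| < 1.
  rewrite normrM normfV [X in _ / X]ger0_norm// ltr_pdivrMr// mul1r.
  by apply: lt_le_trans hK _; rewrite ler_nat ltnW.
have e : n.+1%:R^-1 * x + - a / n.+1%:R = (x - a) / n.+1%:R by rewrite mulrC -mulrDl.
have pi1 : 1 < pi :> R by have := pi_ge2 R; lra.
rewrite !indicE; congr (nat_of_bool _)%:R.
have [ax|ax] := leP a x.
- rewrite !mem_set//= ?in_itv/= ?ax// e.
  have y0 : 0 <= (x - a) / n.+1%:R by rewrite divr_ge0 ?subr_ge0.
  move: xn; rewrite ger0_norm// => y1; apply: sin_ge0_pi; rewrite y0/=.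
  exact: le_trans (ltW y1) (ltW pi1).
- rewrite !memNset//= ?in_itv/= ?andbT ?e; first by apply/negP; rewrite -ltNge.
  apply/negP; rewrite -ltNge -oppr_gt0 -sinN -mulNr opprB.
  have y0 : 0 < (a - x) / n.+1%:R by rewrite divr_gt0 ?subr_gt0.
  move: xn; rewrite -normrN -mulNr opprB gtr0_norm// => y1.
  by apply: sin_gt0_pi; rewrite y0/=; exact: lt_trans y1 pi1.
Qed.

(** Stability under products makes the sets with indicator in the class a sigma-algebra: a countable
    union is the limit of 1 - prod (1 - 1_F). It contains the half-lines that generate the Borel
    sets. *)
Lemma trig_limit_indic A : measurable A -> trig_limit (\1_A).
Proof.
move=> mA; pose C := [set A : set R | trig_limit (\1_A)].
suff : <<s @RGenCInfty.G R >> `<=` C by apply; move: mA; rewrite [X in X A](RGenCInfty.measurableE R).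
apply: smallest_sub.
  split.
  - by apply: (eq_trig_limit _ (trig_limit_cst 0)) => x; rewrite indic0.
  - move=> B hB; apply: (eq_trig_limit _ (trig_limitC hB)) => x.
    by rewrite setTD !indicE in_setC; case: (_ \in _) => /=; lra.
  - move=> F hF; apply: (@trig_limit_cvg 1 (fun n x => 1 - \prod_(k < n) (1 - \1_(F k) x))).
    + move=> n; apply: trig_limitC.
      elim: n => [|n ih].
        by apply: (eq_trig_limit _ (trig_limit_cst 1)) => x; rewrite big_ord0.
      apply: (eq_trig_limit _ (trig_limitM ih (trig_limitC (hF n)))) => x /=.
      by rewrite big_ord_recr.
    + move=> n x; have : 0 <= \prod_(k < n) (1 - \1_(F k) x : R) <= 1.
        rewrite prodr_ge0 ?prodr_ile1//= => i _; rewrite indicE; case: (_ \in _) => /=; lra.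
      by rewrite ler_norml; lra.
    + move=> x; apply: cvg_near_cst; rewrite indicE.
      have [[k _ Fkx]|nF] := pselect ((\bigcup_k F k) x).
        exists k.+1 => // n /= kn; rewrite mem_set; last by exists k.
        by rewrite (bigD1 (Ordinal kn))//= indicE mem_set// subrr mul0r subr0.
      apply: nearW => n; rewrite memNset// big1 ?subrr// => k _.
      by rewrite indicE memNset ?subr0// => Fkx; apply: nF; exists k.
move=> _ [a ->]; exact: trig_limit_itvcy.
Qed.

End trig_limit.

(** * Joint laws of finite families from the means of cosines *)

Section same_law_of_cf.
Context d1 d2 (O1 : measurableType d1) (O2 : measurableType d2) (R : realType).
Variables (P1 : probability O1 R) (P2 : probability O2 R) (I : finType).
Variables (X : I -> O1 -> R) (Y : I -> O2 -> R).
Hypothesis mX : forall i, measurable_fun setT (X i).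
Hypothesis mY : forall i, measurable_fun setT (Y i).
Hypothesis cfXY : forall (u : I -> R) (b : R),
  \int[P1]_w cos (\sum_i u i * X i w + b) = \int[P2]_w cos (\sum_i u i * Y i w + b).

Let cosS (O : Type) (Z : I -> O -> R) (u : I -> R) (b : R) (w : O) : R :=
  cos (\sum_i u i * Z i w + b).

Let prodS (O : Type) (Z : I -> O -> R) (s : seq I) (f : I -> R -> R) (w : O) : R :=
  \prod_(i <- s) f i (Z i w).

Let m_cosS d (O : measurableType d) (Z : I -> O -> R) u b :
  (forall i, measurable_fun setT (Z i)) -> measurable_fun setT (cosS Z u b).
Proof.
move=> mZ; apply: measurable_fun_cos; apply: measurable_funD => //.
by apply: measurable_sum => i; exact: measurable_funM.
Qed.

Let m_prodS d (O : measurableType d) (Z : I -> O -> R) s f :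
  (forall i, measurable_fun setT (Z i)) -> (forall i, trig_limit (f i)) ->
  measurable_fun setT (prodS Z s f).
Proof.
move=> mZ hf; apply: measurable_prod => i _.
by apply: (measurableT_comp (f := f i)) => //; exact: trig_limit_measurable.
Qed.

Let b_prodS (s : seq I) f : (forall i, trig_limit (f i)) ->
  exists M : R, forall (O : Type) (Z : I -> O -> R) w, `|prodS Z s f w| <= M.
Proof.
move=> hf; elim: s => [|i s [M ih]].
  by exists 1 => O Z w; rewrite /prodS big_nil normr1.
have [N fN] := trig_limit_bounded (hf i).
exists (N * M) => O Z w; rewrite /prodS big_cons normrM ler_pM//.
exact: ih.
Qed.

Let cosS_shift (O : Type) (Z : I -> O -> R) (u : I -> R) (b a c : R) (i : I) (w : O) :
  cosS Z (fun j => u j + (j == i)%:R * a) (b + c) w =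
  cos ((\sum_j u j * Z j w + b) + (a * Z i w + c)).
Proof.
rewrite /cosS; congr cos; under eq_bigr do rewrite mulrDl.
have e : \sum_j (j == i)%:R * a * Z j w = a * Z i w.
  rewrite (bigD1 i)//= eqxx mul1r big1 ?addr0// => j /negbTE ->.
  by rewrite !mul0r.
by rewrite big_split/= e addrACA.
Qed.

Let Rintegral_bounded_lin d (O : measurableType d) (P : probability O R) (c M : R) (f g h : O -> R) :
  measurable_fun setT f -> measurable_fun setT g -> measurable_fun setT h ->
  (forall w, `|f w| <= M) -> (forall w, `|g w| <= M) -> (forall w, `|h w| <= M) ->
  \int[P]_w ((c * f w + g w) * h w) = c * \int[P]_w (f w * h w) + \int[P]_w (g w * h w).
Proof.
move=> mf mg mh fM gM hM.
have fh : P.-integrable setT (EFin \o (fun w => f w * h w)).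
  apply: (@bounded_integrable _ _ _ _ (M * M)) => [|w]; first exact: measurable_funM.
  by rewrite normrM ler_pM.
have gh : P.-integrable setT (EFin \o (fun w => g w * h w)).
  apply: (@bounded_integrable _ _ _ _ (M * M)) => [|w]; first exact: measurable_funM.
  by rewrite normrM ler_pM.
under eq_Rintegral do rewrite mulrDl -mulrA.
by rewrite RintegralD ?RintegralZl//; exact: (integrableZl measurableT c fh).
Qed.

(** The spare factor [cosS] makes the induction on [s] possible: when the function of one coordinate
    is a cosine, the product formula absorbs it into [cosS] by shifting the coefficient [u i] and
    the phase. The general function then follows by induction on its construction from cosines. *)
Let cf_prod (s : seq I) f (u : I -> R) (b : R) : (forall i, trig_limit (f i)) ->
  \int[P1]_w (prodS X s f w * cosS X u b w) = \int[P2]_w (prodS Y s f w * cosS Y u b w).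
Proof.
move=> hf; elim: s u b => [|i s ih] u b.
  under eq_Rintegral do rewrite /prodS big_nil mul1r.
  under [RHS]eq_Rintegral do rewrite /prodS big_nil mul1r.
  exact: cfXY.
have [M prodM] := b_prodS s hf.
have gM (O : Type) (Z : I -> O -> R) w : `|prodS Z s f w * cosS Z u b w| <= M :> R.
  by rewrite normrM (le_trans (ler_piMr _ (norm_cos_le1 _))).
have mg d (O : measurableType d) Z : (forall i, measurable_fun setT (Z i)) ->
    measurable_fun setT (fun w : O => prodS Z s f w * cosS Z u b w).
  by move=> mZ; apply: measurable_funM; [exact: m_prodS|exact: m_cosS].
suff key (h : R -> R) : trig_limit h ->
    \int[P1]_w (h (X i w) * (prodS X s f w * cosS X u b w)) =
    \int[P2]_w (h (Y i w) * (prodS Y s f w * cosS Y u b w)).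
  under eq_Rintegral do rewrite /prodS big_cons -mulrA.
  under [RHS]eq_Rintegral do rewrite /prodS big_cons -mulrA.
  exact: key.
elim=> [a c|c {}h h' th ihh th' ihh'|N h_ {}h th_ ihh hN ch].
- have e O (Z : I -> O -> R) w : cos (a * Z i w + c) * (prodS Z s f w * cosS Z u b w) =
    2^-1 * (prodS Z s f w * cosS Z (fun j => u j + (j == i)%:R * a) (b + c) w) +
    2^-1 * (prodS Z s f w * cosS Z (fun j => u j + (j == i)%:R * (- a)) (b - c) w).
    rewrite !cosS_shift.
    have -> : - a * Z i w - c = - (a * Z i w + c) by lra.
    rewrite [cos (_ - (_ + _))]cosB [cos (_ + (_ + _))]cosD /cosS.
    by field.
  have it d (O : measurableType d) (P : probability O R) Z u' b' :
      (forall i, measurable_fun setT (Z i)) ->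
      P.-integrable setT (EFin \o (fun w => prodS Z s f w * cosS Z u' b' w)).
    move=> mZ; apply: (@bounded_integrable _ _ _ _ M) => [|w].
      by apply: measurable_funM; [exact: m_prodS|exact: m_cosS].
    by rewrite normrM (le_trans (ler_piMr _ (norm_cos_le1 _))).
  under eq_Rintegral do rewrite e.
  under [RHS]eq_Rintegral do rewrite e.
  rewrite !RintegralD//; try by apply: (integrableZl measurableT 2^-1 (it _ _ _ _ _ _ _)).
  by rewrite !RintegralZl ?ih//; exact: it.
- have [N hN] := trig_limit_bounded th; have [N' hN'] := trig_limit_bounded th'.
  pose K := Num.max M (Num.max N N').
  have mh d (O : measurableType d) (Z : O -> R) k : measurable_fun setT Z ->
      trig_limit k -> measurable_fun setT (k \o Z).
    by move=> mZ hk; apply: measurableT_comp => //; exact: trig_limit_measurable.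
  have hK x : `|h x| <= K by rewrite /K !le_max hN orbT.
  have hK' x : `|h' x| <= K by rewrite /K !le_max hN' !orbT.
  have gK (O : Type) (Z : I -> O -> R) w : `|prodS Z s f w * cosS Z u b w| <= K.
    by rewrite /K le_max gM.
  have lin d (O : measurableType d) (P : probability O R) Z : (forall i, measurable_fun setT (Z i)) ->
      \int[P]_w ((c * h (Z i w) + h' (Z i w)) * (prodS Z s f w * cosS Z u b w)) =
      c * \int[P]_w (h (Z i w) * (prodS Z s f w * cosS Z u b w)) +
      \int[P]_w (h' (Z i w) * (prodS Z s f w * cosS Z u b w)).
    by move=> mZ; apply: (@Rintegral_bounded_lin _ _ _ c K) => //; [exact: mh|exact: mh|exact: mg].
  by rewrite !lin// ihh ihh'.
- have lim d (O : measurableType d) (P : probability O R) Z : (forall i, measurable_fun setT (Z i)) ->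
     \int[P]_w (h_ n (Z i w) * (prodS Z s f w * cosS Z u b w)) @[n --> \oo] -->
     \int[P]_w (h (Z i w) * (prodS Z s f w * cosS Z u b w)).
    move=> mZ; apply: (@bounded_cvg_Rintegral _ _ _ _ (N * M)).
    + move=> n; apply: measurable_funM; last exact: mg.
      by apply: (measurableT_comp (f := h_ n)) => //; exact: trig_limit_measurable.
    + by move=> n w; rewrite normrM ler_pM.
    + apply: measurable_funM; last exact: mg.
      apply: (measurableT_comp (f := h)) => //; apply: trig_limit_measurable.
      exact: trig_limit_cvg hN ch.
    + by apply: aeW => w; apply: cvgM; [exact: ch|exact: cvg_cst].
  have l1 := lim _ _ P1 _ mX; have l2 := lim _ _ P2 _ mY.
  by apply: (cvg_unique (@Rhausdorff R) _ l2); move: l1; rewrite (funext ihh).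
Qed.

Lemma Rintegral_prod_of_cf (f : I -> R -> R) : (forall i, trig_limit (f i)) ->
  \int[P1]_w \prod_i f i (X i w) = \int[P2]_w \prod_i f i (Y i w).
Proof.
move=> hf; have := @cf_prod (index_enum I) f (fun=> 0) 0 hf.
have e O (Z : I -> O -> R) w : cosS Z (fun=> 0) 0 w = 1.
  by rewrite /cosS big1 ?addr0 ?cos0// => i _; rewrite mul0r.
under eq_Rintegral do rewrite e mulr1.
by under [RHS]eq_Rintegral do rewrite e mulr1.
Qed.

Let cyl : set (set (I -> R)) := \bigcup_(i in setT) preimage_set_system setT (fun f : I -> R => f i) measurable.

(** The measurable rectangles: stable under intersection and, [I] being finite, generating the
    product sigma-algebra. *)
Let rect : set (set (I -> R)) := [set B | exists A : I -> set R,
  (forall i, measurable (A i)) /\ B = [set f | forall i, A i (f i)]].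

Let rectE : <<s rect >> = <<s cyl >>.
Proof.
apply/seteqP; split; apply: smallest_sub; try exact: smallest_sigma_algebra.
- move=> _ [A [mA ->]].
  have -> : [set f | forall i, A i (f i)] = \bigcap_(i in [set: I]) ((fun f : I -> R => f i) @^-1` A i).
    by apply/seteqP; split => f /= h i; [move=> _; exact: h|exact: h].
  have : forall i, measurable (((fun f : I -> R => f i) @^-1` A i) : set (g_sigma_algebraType cyl)).
    move=> i; apply: sub_sigma_algebra; exists i => //; exists (A i) => //.
    by rewrite setTI.
  move=> h; apply: (@fin_bigcap_measurable _ (g_sigma_algebraType cyl)) => //.
- move=> _ [i _ [A mA <-]]; apply: sub_sigma_algebra.
  exists (fun j => if j == i then A else setT); split.
    by move=> j; case: ifP.
  rewrite setTI; apply/seteqP; split => f /=.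
    by move=> Af j; case: eqP => [->|].
  by move=> /(_ i); rewrite eqxx.
Qed.

Let mcyl d (O : measurableType d) (Z : I -> O -> R) : (forall i, measurable_fun setT (Z i)) ->
  measurable_fun setT ((fun w i => Z i w) : O -> g_sigma_algebraType cyl).
Proof.
move=> mZ; apply: (@measurability _ _ O (g_sigma_algebraType cyl) setT _ cyl) => // _ [_ [i _ [A mA <-]] <-].
by have := mZ i measurableT A mA; rewrite !setTI.
Qed.

(** The probability of a rectangle is the mean of a product of indicators, to which
    [Rintegral_prod_of_cf] applies; two probabilities that agree on the rectangles are equal. *)
Lemma same_law_of_cf (A : set (I -> R)) : sigma_of setT (fun i (f : I -> R) => f i) A ->
  P1 [set w | A (X ^~ w)] = P2 [set w | A (Y ^~ w)].
Proof.
move=> mA.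
pose X' : O1 -> g_sigma_algebraType cyl := fun w i => X i w.
pose Y' : O2 -> g_sigma_algebraType cyl := fun w i => Y i w.
have mX' : measurable_fun setT X' by exact: mcyl.
have mY' : measurable_fun setT Y' by exact: mcyl.
have rectT : rect setT by exists (fun=> setT); split => //; apply/seteqP; split.
suff : pushforward P1 X' A = pushforward P2 Y' A by [].
have mr : rect `<=` @measurable _ (g_sigma_algebraType cyl).
  by move=> B hB; change (<<s cyl >> B); rewrite -rectE; exact: sub_sigma_algebra.
apply: (@g_sigma_algebra_measure_unique _ R (g_sigma_algebraType cyl) rect mr (fun=> setT) (fun=> rectT)
  _ (pushforward P1 X') (pushforward P2 Y')) => //.
- by apply/seteqP; split => // x _; exists 0%N.
- move=> B C [S [mS ->]] [S' [mS' ->]]; exists (fun i => S i `&` S' i); split.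
    by move=> i; exact: measurableI.
  apply/seteqP; split => f /=; first by move=> [? ?] i; split.
  by move=> h; split => i; case: (h i).
- move=> _ [S [mS ->]]; rewrite /pushforward.
  have e d (O : measurableType d) (P : probability O R) (Z : I -> O -> R) :
      (forall i, measurable_fun setT (Z i)) ->
      P [set w | forall i, S i (Z i w)] = (\int[P]_w \prod_i \1_(S i) (Z i w))%:E.
    move=> mZ.
    have mE : measurable [set w | forall i, S i (Z i w)].
      have -> : [set w | forall i, S i (Z i w)] = \bigcap_(i in [set: I]) (Z i @^-1` S i).
        by apply/seteqP; split => w /= h i; [move=> _; exact: h|exact: h].
      by apply: fin_bigcap_measurable => // i _; rewrite -[X in measurable X]setTI; exact: mZ.
    have -> : (fun w => \prod_i \1_(S i) (Z i w) : R) = \1_[set w | forall i, S i (Z i w)].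
      apply/funext => w; rewrite [RHS]indicE.
      have [h|h] := pselect (forall i, S i (Z i w)).
        by rewrite mem_set// big1// => i _; rewrite indicE mem_set.
      rewrite memNset//; move/existsNP: h => [i h].
      by rewrite (bigD1 i)//= indicE memNset// mul0r.
    rewrite /Rintegral integral_indic// setIT fineK//.
    exact: fin_num_measure.
  change (P1 [set w | forall i, S i (X i w)] = P2 [set w | forall i, S i (Y i w)]).
  rewrite !e//; congr EFin; apply: (@Rintegral_prod_of_cf (fun i => \1_(S i))) => i.
  exact: trig_limit_indic.
- by move=> _; change (P1 setT < +oo)%E; rewrite -ge0_fin_numE// fin_num_measure.
- by rewrite rectE.
Qed.

End same_law_of_cf.

(** * Gaussian random variables *)

Section sine_estimates.
Context {R : realType}.
Implicit Types x y : R.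

Lemma cosE_sin_half x : cos x = 1 - 2 * sin (x / 2) ^+ 2.
Proof.
have {1}-> : x = x / 2 + x / 2 by lra.
by rewrite cosD -!expr2 cos2sin2; lra.
Qed.

Lemma sin_MVT x : 0 <= x -> exists2 c, 0 <= c <= x & sin x = cos c * x.
Proof.
rewrite le_eqVlt => /predU1P[<-|x0]; first by exists 0; rewrite ?lexx// sin0 mulr0.
have [|c] := @MVT R sin cos 0 x x0 (fun y _ => is_derive_sin y).
  by apply: continuous_subspaceT => z; exact: continuous_sin.
rewrite in_itv/= sin0 !subr0 => /andP[c0 cx] e.
by exists c; rewrite ?(ltW c0) ?(ltW cx).
Qed.

Lemma norm_sin_le x : `|sin x| <= `|x|.
Proof.
wlog x0 : x / 0 <= x => [h|].
  have [/h//|/ltW x0] := leP 0 x.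
  by have := h (- x); rewrite sinN !normrN oppr_ge0; apply.
have [c _ ->] := sin_MVT x0.
by rewrite normrM ler_piMl// norm_cos_le1.
Qed.

Lemma one_sub_cos_le x : 1 - cos x <= x ^+ 2 / 2.
Proof.
rewrite cosE_sin_half.
have : sin (x / 2) ^+ 2 <= (x / 2) ^+ 2.
  rewrite -[leLHS]real_normK ?num_real// -[leRHS]real_normK ?num_real//.
  by rewrite ler_pXn2r// ?nnegrE// norm_sin_le.
by rewrite expr_div_n; lra.
Qed.

Lemma norm_sin_sub_le x : `|sin x - x| <= `|x| ^+ 3 / 2.
Proof.
wlog x0 : x / 0 <= x => [h|].
  have [/h//|/ltW x0] := leP 0 x.
  have := h (- x); rewrite oppr_ge0 => /(_ x0).
  by rewrite sinN opprK normrN addrC distrC.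
have [c /andP[c0 cx] ->] := sin_MVT x0.
rewrite -{2}[x]mul1r -mulrBl normrM distrC.
rewrite (ger0_norm (_ : 0 <= 1 - cos c)) ?subr_ge0 ?cos_le1//.
rewrite exprSr mulrAC ler_wpM2r// (le_trans (one_sub_cos_le _))// ler_wpM2r//.
by rewrite (ger0_norm x0) ler_pXn2r// nnegrE.
Qed.

Lemma cvg_natM_sin x : n.+1%:R * sin (x / n.+1%:R) @[n --> \oo] --> x.
Proof.
apply/subr_cvg0; apply/norm_cvg0P.
apply: (squeeze_cvgr (f := cst 0) (h := fun n => (`|x| ^+ 3 / 2) * harmonic n)).
- apply: nearW => n; rewrite /cst normr_ge0/=.
  have n0 : 0 < n.+1%:R :> R by [].
  have -> : n.+1%:R * sin (x / n.+1%:R) - x = n.+1%:R * (sin (x / n.+1%:R) - x / n.+1%:R).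
    by rewrite mulrBr [_ * (x / _)]mulrC divfK// gt_eqF.
  rewrite normrM ger0_norm// -ler_pdivlMl//.
  apply: le_trans (norm_sin_sub_le _) _.
  rewrite normrM normfV [`|_.+1%:R|]ger0_norm// expr_div_n.
  have -> : n.+1%:R^-1 * (`|x| ^+ 3 / 2 / n.+1%:R) = `|x| ^+ 3 / 2 / (n.+1%:R ^+ 2).
    by rewrite mulrCA -invfM.
  rewrite mulrAC ler_wpM2l ?divr_ge0 ?exprn_ge0//.
  rewrite lef_pV2 ?posrE ?exprn_gt0//.
  by rewrite [leRHS]exprS ler_peMl ?sqr_ge0// ler1n.
- exact: cvg_cst.
- by rewrite -[X in _ --> X](mulr0 (`|x| ^+ 3 / 2)); apply: cvgM; [exact: cvg_cst|exact: cvg_harmonic].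
Qed.

(** With [cvg_natM_sin], the device that recovers moments from the characteristic function: x^2 and
    x are limits of bounded trigonometric functions that they dominate. *)
Lemma cvg_one_sub_cos x : 2 * n.+1%:R ^+ 2 * (1 - cos (x / n.+1%:R)) @[n --> \oo] --> x ^+ 2.
Proof.
have -> : (fun n => 2 * n.+1%:R ^+ 2 * (1 - cos (x / n.+1%:R))) =
    (fun n => (2 * (n.+1%:R * sin ((x / 2) / n.+1%:R))) ^+ 2).
  apply/funext => n; rewrite cosE_sin_half [x / n.+1%:R / 2]mulrAC.
  by rewrite !exprMn; lra.
have {2}-> : x = 2 * (x / 2) by lra.
rewrite expr2; under eq_fun do rewrite expr2.
have c : 2 * (n.+1%:R * sin ((x / 2) / n.+1%:R)) @[n --> \oo] --> 2 * (x / 2).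
  by apply: cvgM; [exact: cvg_cst|exact: cvg_natM_sin].
exact: cvgM.
Qed.

End sine_estimates.

Section gaussian_cf.
Context dsp (Omega : measurableType dsp) (R : realType) (P : probability Omega R).
Implicit Types (Y : Omega -> R) (m v : R).

(** With a and b ranging over the reals, the cosines encode the complex
    characteristic function, here that of N(m, v) with v the variance. *)
Definition gaussian_cf Y m v := measurable_fun setT Y /\
  forall a b, \int[P]_w cos (a * Y w + b) = cos (a * m + b) * expR (- (a ^+ 2 * v) / 2).

Let law_Rintegral Y (nu : probability (measurableTypeR R) R) (f : R -> R) : measurable_fun setT Y ->
  (forall A, measurable A -> P (Y @^-1` A) = nu A) -> measurable_fun setT f ->
  (forall x, `|f x| <= 1) -> \int[P]_w f (Y w) = \int[nu]_x f x.
Proof.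
move=> mY h mf f1; congr fine.
pose Y' : Omega -> measurableTypeR R := Y.
rewrite -(@eq_measure_integral _ _ R setT nu (pushforward P Y')); last first.
  by move=> A mA _; exact: h.
rewrite (integral_pushforward (phi := Y')) ?preimage_setT//=.
- exact/measurable_EFinP.
- apply: (@bounded_integrable _ _ _ _ 1) => [|w]; last exact: f1.
  exact: measurableT_comp.
Qed.

Lemma normal_rv_cf Y : normal_rv P Y -> exists m v, 0 <= v /\ gaussian_cf Y m v.
Proof.
move=> [mY [m [s [s0 h]]]]; exists m, (s ^+ 2); split; first exact: sqr_ge0.
split => // a b; case: eqP h => [->|/eqP sn0] h.
  rewrite expr0n mulr0 oppr0 mul0r expR0 mulr1.
  rewrite (law_Rintegral (nu := dirac (m : measurableTypeR R)) (f := fun x => cos (a * x + b)))//.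
  - rewrite /Rintegral integral_dirac// ?diracT ?mul1e//.
    by apply/measurable_EFinP; exact: measurable_cos_affine.
  - exact: measurable_cos_affine.
  - by move=> x; exact: norm_cos_le1.
rewrite (law_Rintegral (nu := normal_prob m s) (f := fun x => cos (a * x + b)))//.
- exact: Rintegral_cos_normal_prob.
- exact: measurable_cos_affine.
- by move=> x; exact: norm_cos_le1.
Qed.

End gaussian_cf.

Section same_law1.
Context d1 d2 (O1 : measurableType d1) (O2 : measurableType d2) (R : realType).
Variables (P1 : probability O1 R) (P2 : probability O2 R).

Lemma same_law1_of_cf (X : O1 -> R) (Y : O2 -> R) :
  measurable_fun setT X -> measurable_fun setT Y ->
  (forall a b, \int[P1]_w cos (a * X w + b) = \int[P2]_w cos (a * Y w + b)) ->
  forall A, measurable A -> P1 (X @^-1` A) = P2 (Y @^-1` A).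
Proof.
move=> mX mY cf A mA.
apply: (@same_law_of_cf _ _ O1 O2 R P1 P2 'I_1 (fun=> X) (fun=> Y) _ _ _ [set f | A (f ord0)]) => //.
  move=> u b; under eq_Rintegral do rewrite big_ord1.
  by under [RHS]eq_Rintegral do rewrite big_ord1.
apply: sub_sigma_algebra; exists ord0 => //; exists A => //.
by rewrite setTI.
Qed.

End same_law1.

Section gaussian_cf_theory.
Context dsp (Omega : measurableType dsp) (R : realType) (P : probability Omega R).
Implicit Types (Y : Omega -> R) (m v : R).
Local Notation gaussian_cf := (gaussian_cf P).

Lemma cf_normal_rv Y m v : 0 <= v -> gaussian_cf Y m v -> normal_rv P Y.
Proof.
move=> v0 [mY cf]; split => //; exists m, (Num.sqrt v); split => // A mA.
have mid : measurable_fun [set: measurableTypeR R] (id : R -> R) by exact: measurable_id.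
case: eqP => [sv0|/eqP sv0].
  have v00 : v = 0 by apply/eqP; rewrite eq_le v0 andbT -sqrtr_eq0 sv0.
  apply: (same_law1_of_cf (P2 := dirac (m : measurableTypeR R)) mY mid) => // a b.
  rewrite cf v00 mulr0 oppr0 mul0r expR0 mulr1 /Rintegral integral_dirac//.
    by rewrite diracT mul1e.
  by apply/measurable_EFinP; exact: measurable_cos_affine.
apply: (same_law1_of_cf (P2 := normal_prob m (Num.sqrt v)) mY mid) => // a b.
by rewrite cf Rintegral_cos_normal_prob// sqr_sqrtr.
Qed.

Lemma gaussian_cfZ Y m v c : gaussian_cf Y m v ->
  gaussian_cf (fun w => c * Y w) (c * m) (c ^+ 2 * v).
Proof.
move=> [mY cf]; split; first exact: measurable_funM.
move=> a b; under eq_Rintegral do rewrite mulrA.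
by rewrite cf exprMn !mulrA.
Qed.

Lemma gaussian_cf_cvg (Y_ : nat -> Omega -> R) Y (v_ : nat -> R) v :
  (forall n, gaussian_cf (Y_ n) 0 (v_ n)) -> measurable_fun setT Y ->
  {ae P, forall w, Y_ n w @[n --> \oo] --> Y w} -> v_ n @[n --> \oo] --> v ->
  gaussian_cf Y 0 v.
Proof.
move=> cf mY cY cv; split => // a b.
have l1 : \int[P]_w cos (a * Y_ n w + b) @[n --> \oo] --> \int[P]_w cos (a * Y w + b).
  apply: (@bounded_cvg_Rintegral _ _ _ _ 1).
  - move=> n; apply: measurable_fun_cos; apply: measurable_funD => //.
    by apply: measurable_funM => //; case: (cf n).
  - by move=> n w; exact: norm_cos_le1.
  - by apply: measurable_fun_cos; apply: measurable_funD => //; exact: measurable_funM.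
  - apply: filterS cY => w cw; apply: (cvg_comp _ cos); last exact: continuous_cos.
    by apply: cvgD; [apply: cvgM; [exact: cvg_cst|exact: cw]|exact: cvg_cst].
have l2 : cos (a * 0 + b) * expR (- (a ^+ 2 * v_ n) / 2) @[n --> \oo] -->
    cos (a * 0 + b) * expR (- (a ^+ 2 * v) / 2).
  apply: cvgM; first exact: cvg_cst.
  apply: (cvg_comp _ expR); last exact: continuous_expR.
  by apply: cvgM; [apply: cvgN; apply: cvgM; [exact: cvg_cst|exact: cv]|exact: cvg_cst].
apply: (cvg_unique (@Rhausdorff R) l1).
rewrite (_ : (fun n => _) = fun n => cos (a * 0 + b) * expR (- (a ^+ 2 * v_ n) / 2))//.
by apply/funext => n; case: (cf n).
Qed.

Section moments.
Variables (Y : Omega -> R) (m v : R).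
Hypotheses (v0 : 0 <= v) (cf : gaussian_cf Y m v).

Let mY : measurable_fun setT Y. Proof. by case: cf. Qed.

Let N (n : nat) : R := n.+1%:R.

Let N0 n : 0 < N n. Proof. by rewrite ltr0n. Qed.

(** Bounded approximations of Y^2 from below with a known mean. Fatou's lemma makes Y^2 integrable,
    after which dominated convergence computes its mean. *)
Let g n w := 2 * N n ^+ 2 * (1 - cos (Y w / N n)).

Let mg n : measurable_fun setT (g n).
Proof.
apply: measurable_funM => //; apply: measurable_funB => //.
by apply: measurable_fun_cos; exact: measurable_funM.
Qed.

Let g_ge0 n w : 0 <= g n w.
Proof.
by apply: mulr_ge0; [rewrite mulr_ge0// sqr_ge0|rewrite subr_ge0 cos_le1].
Qed.

Let g_le n w : g n w <= Y w ^+ 2.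
Proof.
rewrite /g (le_trans (ler_wpM2l _ (one_sub_cos_le _))) ?mulr_ge0 ?sqr_ge0//.
by rewrite expr_div_n [leLHS](_ : _ = Y w ^+ 2)//; field; rewrite gt_eqF.
Qed.

Let cvg_g w : g n w @[n --> \oo] --> Y w ^+ 2.
Proof. exact: cvg_one_sub_cos. Qed.

Let integrable_g n : P.-integrable setT (EFin \o g n).
Proof.
apply: (@bounded_integrable _ _ _ _ (2 * N n ^+ 2 * 2)) => // w.
rewrite ger0_norm// ler_wpM2l//; first by rewrite mulr_ge0 ?sqr_ge0.
by have := cos_geN1 (Y w / N n); lra.
Qed.

Let Rintegral_g n : \int[P]_w g n w = 2 * N n ^+ 2 * (1 - cos (m / N n) * expR (- (v / N n ^+ 2) / 2)).
Proof.
have ic : P.-integrable setT (EFin \o (fun w => cos ((N n)^-1 * Y w + 0))).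
  apply: (@bounded_integrable _ _ _ _ 1) => [|w]; last exact: norm_cos_le1.
  by apply: measurable_fun_cos; apply: measurable_funD => //; exact: measurable_funM.
have i1 : P.-integrable setT (EFin \o cst (1 : R)).
  exact: finite_measure_integrable_cst.
transitivity (\int[P]_w (2 * N n ^+ 2 * (cst 1 w - cos ((N n)^-1 * Y w + 0)))).
  by apply: eq_Rintegral => w _; rewrite /g /= addr0 [_^-1 * _]mulrC.
rewrite RintegralZl//; last exact: (integrableB measurableT i1 ic).
rewrite RintegralB// Rintegral_cst_prob; case: cf => _ ->.
by rewrite addr0 exprVn [_^-1 * m]mulrC [_ ^-1 * v]mulrC.
Qed.

Lemma gaussian_sqr_integrable : P.-integrable setT (EFin \o (fun w => Y w ^+ 2)).
Proof.
apply/integrableP; split; first by apply/measurable_EFinP; exact: measurable_funX.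
apply: (@le_lt_trans _ _ (m ^+ 2 + v)%:E); last by rewrite ltry.
have e : (\int[P]_w `|(EFin \o (fun w => (Y w ^+ 2)%R)) w| = \int[P]_w limn_einf (fun n => (g n w)%:E))%E.
  apply: eq_integral => w _ /=; rewrite ger0_norm ?sqr_ge0//.
  have cE : (g n w)%:E @[n --> \oo] --> (Y w ^+ 2)%:E by apply: cvg_EFin; [exact: nearW|exact: cvg_g].
  by rewrite (cvg_limn_einf_sup cE).1.
rewrite e; apply: le_trans (fatou P measurableT _ _) _.
- by move=> n; apply/measurable_EFinP.
- by move=> n w _; rewrite lee_fin.
rewrite limn_einf_lim; apply: lime_le; first exact: is_cvg_einfs.
apply: nearW => n; apply: (@le_trans _ _ (\int[P]_w (g n w)%:E)%E).
  by apply: ereal_inf_lbound; exists n => //=.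
rewrite -[leLHS]fineK; last exact: (integrable_fin_num measurableT (integrable_g n)).
rewrite lee_fin -/(Rintegral P setT (g n)) Rintegral_g.
set c := cos _; set e2 := expR _.
have c1 : 2 * N n ^+ 2 * (1 - c) <= m ^+ 2.
  rewrite (le_trans (ler_wpM2l _ (one_sub_cos_le _))) ?mulr_ge0 ?sqr_ge0//.
  by rewrite expr_div_n [leLHS](_ : _ = m ^+ 2)//; field; rewrite gt_eqF.
have c2 : 2 * N n ^+ 2 * (1 - e2) <= v.
  have h := expR_ge1Dx (- (v / N n ^+ 2) / 2).
  apply: (@le_trans _ _ (2 * N n ^+ 2 * ((v / N n ^+ 2) / 2))).
    rewrite ler_wpM2l ?mulr_ge0 ?sqr_ge0// lerBlDr.
    by move: h; rewrite -/e2 mulNr lerBlDr addrC.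
  by rewrite [leLHS](_ : _ = v)//; field; rewrite gt_eqF.
have e21 : 0 <= 1 - e2.
  by rewrite subr_ge0 -expR0 ler_expR mulNr oppr_le0 !divr_ge0// sqr_ge0.
(* This separates the contribution of the mean, at most [m ^+ 2] after scaling, from that of the
   variance, at most [v]. *)
have : 1 - c * e2 <= (1 - c) + (1 - e2).
  have : c * (1 - e2) <= 1 * (1 - e2) by rewrite ler_wpM2r// cos_le1.
  by lra.
move/(ler_wpM2l (mulr_ge0 (ler0n R 2) (sqr_ge0 (N n)))) => /le_trans; apply.
by rewrite mulrDr lerD.
Qed.

Lemma gaussian_integrable : P.-integrable setT (EFin \o Y).
Proof.
have i1 : P.-integrable setT (EFin \o cst (1 : R)).
  exact: finite_measure_integrable_cst.
apply: le_integrable (integrableD measurableT i1 gaussian_sqr_integrable) => //.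
  exact/measurable_EFinP.
move=> w _; rewrite /= lee_fin [leRHS]ger0_norm ?addr_ge0 ?sqr_ge0//.
by rewrite -[Y w ^+ 2]real_normK ?num_real//; have := sqr_ge0 (`|Y w| - 1); nra.
Qed.

(** The phase - pi / 2 turns the cosines of [gaussian_cf] into sines, and N sin (Y / N) tends to Y
    under the bound |Y|. *)
Lemma gaussian_mean : \int[P]_w Y w = m.
Proof.
pose f n w := N n * sin (Y w / N n).
have c1 : \int[P]_w f n w @[n --> \oo] --> \int[P]_w Y w.
  apply: (dominated_cvg_Rintegral _ mY _ (integrable_norm gaussian_integrable)).
  - move=> n; apply: measurable_funM => //.
    apply: (measurableT_comp (f := sin)).
      by apply: continuous_measurable_fun; exact: continuous_sin.
    exact: measurable_funM.
  - by apply: aeW => w; exact: cvg_natM_sin.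
  - apply: aeW => w n; rewrite /f /= normrM (ger0_norm (ltW (N0 n))).
    rewrite -ler_pdivlMl// (le_trans (norm_sin_le _))//.
    by rewrite normrM normfV (ger0_norm (ltW (N0 n))) mulrC.
have c2 : N n * (sin (m / N n) * expR (- (v / N n ^+ 2) / 2)) @[n --> \oo] --> m.
  rewrite -[X in _ --> X]mulr1; under eq_cvg => n do rewrite mulrA.
  apply: cvgM; first exact: cvg_natM_sin.
  rewrite -[X in _ --> X]expR0.
  have c : - (v / N n ^+ 2) / 2 @[n --> \oo] --> 0.
    have -> : (fun n => - (v / N n ^+ 2) / 2) = (fun n => - v / 2 * (harmonic n * harmonic n)).
      by apply/funext => n; rewrite -mulNr mulrAC expr2 invfM.
    rewrite -[X in _ --> X](mulr0 (- v / 2)); apply: cvgM; first exact: cvg_cst.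
    by rewrite -[X in _ --> X](mul0r 0); apply: cvgM; exact: cvg_harmonic.
  by apply: (cvg_comp _ expR c); exact: continuous_expR.
apply: (cvg_unique (@Rhausdorff R) c1).
rewrite (_ : (fun n => _) = fun n => N n * (sin (m / N n) * expR (- (v / N n ^+ 2) / 2)))//.
apply/funext => n; rewrite /f.
rewrite RintegralZl//; last first.
  apply: (@bounded_integrable _ _ _ _ 1) => [|w]; last by rewrite ler_norml sin_geN1 sin_le1.
  apply: (measurableT_comp (f := sin)).
    by apply: continuous_measurable_fun; exact: continuous_sin.
  exact: measurable_funM.
congr (_ * _); have [_ /(_ (N n)^-1 (- (pi / 2)))] := cf.
rewrite cosBpihalf exprVn ![_ ^-1 * _]mulrC => <-.
by apply: eq_Rintegral => w _; rewrite cosBpihalf mulrC.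
Qed.

Lemma gaussian_variance : m = 0 -> \int[P]_w Y w ^+ 2 = v.
Proof.
move=> m0.
have c1 : \int[P]_w g n w @[n --> \oo] --> \int[P]_w (Y w ^+ 2).
  apply: (dominated_cvg_Rintegral mg _ _ gaussian_sqr_integrable).
  - exact: measurable_funX.
  - by apply: aeW => w; exact: cvg_g.
  - by apply: aeW => w n; rewrite ger0_norm.
have c2 : \int[P]_w g n w @[n --> \oo] --> v.
  (* With u = v / (2 N^2), the bounds 1 - u <= e^(-u) <= 1 / (1 + u) squeeze the mean of [g n]
     between v / (1 + u) and v. *)
  have ch : v / (1 + v / 2 * (harmonic n * harmonic n)) @[n --> \oo] --> v.
    rewrite -[X in _ --> X]divr1; apply: cvgM; first exact: cvg_cst.
    apply: cvgV => //; rewrite -[X in _ --> X]addr0; apply: cvgD; first exact: cvg_cst.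
    rewrite -[X in _ --> X](mulr0 (v / 2)); apply: cvgM; first exact: cvg_cst.
    by rewrite -[X in _ --> X](mul0r 0); apply: cvgM; exact: cvg_harmonic.
  apply: (squeeze_cvgr _ ch (cvg_cst v)); apply: nearW => n.
  rewrite Rintegral_g m0 mul0r cos0 mul1r.
  have -> : harmonic n * harmonic n = (N n ^+ 2)^-1 :> R by rewrite expr2 invfM.
  set u := v / N n ^+ 2 / 2.
  have u0 : 0 <= u by rewrite !divr_ge0// sqr_ge0.
  have vE : v = 2 * N n ^+ 2 * u by rewrite /u; field; rewrite gt_eqF.
  have -> : - (v / N n ^+ 2) / 2 = - u by rewrite mulNr.
  have -> : v / 2 / N n ^+ 2 = u by rewrite mulrAC.
  have c0 : 0 <= 2 * N n ^+ 2 by rewrite mulr_ge0 ?sqr_ge0.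
  rewrite {1 2}vE -mulrA !ler_wpM2l//.
    by have := expR_ge1Dx (- u); lra.
  have h := expR_ge1Dx u.
  have p1 : 0 < 1 + u by lra.
  rewrite expRN ler_pdivrMr//.
  have : (expR u)^-1 <= (1 + u)^-1 by rewrite lef_pV2 ?posrE ?expR_gt0.
  move/(ler_wpM2r (ltW p1)); rewrite mulVf ?gt_eqF//; lra.
exact: (cvg_unique (@Rhausdorff R) c1 c2).
Qed.

End moments.

End gaussian_cf_theory.

(** * Independent Gaussian sums *)

Section sigma_of_theory.
Context (R : realType) (I U : Type) (D : set I) (f : I -> U -> R).

(** Naming the generating family gives a measurable type, [g_sigma_algebraType (sigma_gen D f)],
    whose measurable sets are by definition those of [sigma_of D f]; measurability with respect to
    [sigma_of D f] can then be proved with the usual lemmas. *)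
Definition sigma_gen : set (set U) :=
  \bigcup_(i in D) preimage_set_system setT (f i) measurable.

End sigma_of_theory.

Section sigma_of_measurable.
Context (R : realType) (I : Type) (D : set I).

Section pointed.
Context (U : pointedType).
Variable f : I -> U -> R.

Lemma sigma_of_measurable i : D i ->
  measurable_fun setT (f i : g_sigma_algebraType (sigma_gen D f) -> R).
Proof.
move=> Di _ A mA; rewrite setTI; apply: sub_sigma_algebra.
by exists i => //; exists A => //; rewrite setTI.
Qed.

Lemma sigma_of_preimage (g : U -> R) :
  measurable_fun setT (g : g_sigma_algebraType (sigma_gen D f) -> R) ->
  forall C, measurable C -> sigma_of D f (g @^-1` C).
Proof. by move=> mg C mC; have := mg measurableT C mC; rewrite setTI. Qed.

End pointed.

Lemma sigma_of_sub dsp (Omega : measurableType dsp) (f : I -> Omega -> R) :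
  (forall i, D i -> measurable_fun setT (f i)) ->
  sigma_of D f `<=` measurable.
Proof.
move=> mf; apply: smallest_sub; first exact: sigma_algebra_measurable.
by move=> _ [i Di [A mA <-]]; exact: mf.
Qed.

End sigma_of_measurable.

Section independent_products.
Context dsp (Omega : measurableType dsp) (R : realType) (P : probability Omega R).
Variables (D : set nat) (G : nat -> set (set Omega)).
Hypotheses (indG : independent P D G) (Gm : forall n, D n -> G n `<=` measurable).

Let adm (z : Omega -> R) n := [/\ measurable_fun setT z, exists M : R, forall w, `|z w| <= M &
  forall C, measurable C -> G n (z @^-1` C)].

Let bounded_prod (s : seq nat) (z : nat -> Omega -> R) : (forall n, n \in s -> adm (z n) n) ->
  measurable_fun setT (fun w => \prod_(n <- s) z n w) /\
  exists M : R, forall w, `|\prod_(n <- s) z n w| <= M.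
Proof.
elim: s => [|n s ih] h.
  split; first by under eq_fun do rewrite big_nil; exact: measurable_cst.
  by exists 1 => w; rewrite big_nil normr1.
have [mz [M zM] _] := h n (mem_head _ _).
have [|ms [N sN]] := ih; first by move=> k ks; apply: h; rewrite in_cons ks orbT.
split; first by under eq_fun do rewrite big_cons; exact: measurable_funM.
by exists (M * N) => w; rewrite big_cons normrM ler_pM.
Qed.

(** Independence passes from events to bounded functions one function at a time: the product of the
    remaining factors, minus its mean, is orthogonal to every event of the current factor, hence to
    that factor itself. *)
Lemma independent_Rintegral_prod (s : seq nat) (z : nat -> Omega -> R) : uniq s ->
  (forall n, n \in s -> D n) ->
  (forall n, n \in s -> [/\ measurable_fun setT (z n), exists M : R, forall w, `|z n w| <= M &
    forall C, measurable C -> G n (z n @^-1` C)]) ->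
  \int[P]_w \prod_(n <- s) z n w = \prod_(n <- s) \int[P]_w z n w.
Proof.
move=> us sD hz.
(* The list [t] carries indices whose function has already been replaced by an indicator. *)
suff key (t : seq nat) (A : nat -> set Omega) : uniq (s ++ t) ->
    (forall n, n \in t -> D n /\ G n (A n)) ->
    \int[P]_w (\prod_(n <- s) z n w * \prod_(n <- t) \1_(A n) w) =
    \prod_(n <- s) \int[P]_w z n w * \prod_(n <- t) fine (P (A n)).
  have := key [::] (fun=> set0); rewrite cats0 big_nil mulr1 => <- //.
  by apply: eq_Rintegral => w _; rewrite big_nil mulr1.
elim: s us sD hz t A => [_ _ _|n s ih /= /andP[ns us] sD hz] t A.
  move=> ut tD; rewrite big_nil mul1r.
  have mA n : n \in t -> measurable (A n) by move=> /tD[Dn]; exact: Gm.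
  transitivity (\int[P]_w \1_(\bigcap_(i in [set` t]) A i) w).
    apply: eq_Rintegral => w _; rewrite big_nil mul1r indicE.
    have [h|h] := pselect ((\bigcap_(i in [set` t]) A i) w).
      by rewrite mem_set// big_seq big1// => i it; rewrite indicE mem_set//; exact: h.
    rewrite memNset//; move/existsNP : h => [i /not_implyP[/= it Aw]].
    by rewrite (big_rem i it)/= indicE memNset// mul0r.
  rewrite /Rintegral integral_indic//; last first.
    by apply: fin_bigcap_measurable => //; exact: finite_seq.
  rewrite setIT [X in fine X](indG ut tD).
  have -> : (\prod_(i <- t) P (A i) = (\prod_(i <- t) fine (P (A i)))%:E)%E.
    elim: t mA {ut tD} => [|n t ih] mA; first by rewrite !big_nil.
    rewrite !big_cons EFinM fineK ?ih//.
      by move=> k kt; apply: mA; rewrite in_cons kt orbT.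
    by apply: fin_num_measure; apply: mA; exact: mem_head.
  by [].
move=> ut tD.
have [mz [M zM] Gz] := hz n (mem_head _ _).
have Dn : D n by apply: sD; exact: mem_head.
have mA k : k \in t -> measurable (A k) by move=> /tD[Dk]; exact: Gm.
have sD' k : k \in s -> D k by move=> ks; apply: sD; rewrite in_cons ks orbT.
have hz' k : k \in s -> adm (z k) k by move=> ks; apply: hz; rewrite in_cons ks orbT.
have nt : n \notin t by move: ut => /= /andP[]; rewrite mem_cat negb_or => /andP[].
have ust : uniq (s ++ t) by move: ut => /= /andP[].
have usnt : uniq (s ++ n :: t).
  by rewrite -(perm_uniq (_ : perm_eq (n :: s ++ t) _))//= -cat1s perm_catCA.
have [mp [N pN]] := bounded_prod hz'.
pose q w : R := \prod_(k <- t) \1_(A k) w.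
have mq : measurable_fun setT q.
  by apply: measurable_prod => k kt; apply: measurable_indic; exact: mA.
have q01 w : 0 <= q w <= 1.
  by rewrite /q prodr_ge0 ?prodr_ile1// => k _; rewrite indicE ?ler0n// lern1 leq_b1.
pose V w := \prod_(k <- s) z k w * q w.
have mV : measurable_fun setT V by exact: measurable_funM.
have VN w : `|V w| <= N.
  by rewrite normrM -[leRHS]mulr1 ler_pM//; have /andP[? ?] := q01 w; rewrite ger0_norm.
pose c := \prod_(k <- s) \int[P]_w z k w * \prod_(k <- t) fine (P (A k)).
have iV : P.-integrable setT (EFin \o V) by exact: bounded_integrable VN.
have ic : P.-integrable setT (EFin \o (cst c : Omega -> R)).
  exact: finite_measure_integrable_cst.
have izc : P.-integrable setT (EFin \o (fun w => z n w * c)).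
  apply: (@bounded_integrable _ _ _ _ (M * `|c|)) => [|w]; first exact: measurable_funM.
  by rewrite normrM ler_wpM2r.
have izV : P.-integrable setT (EFin \o (fun w => z n w * V w)).
  apply: (@bounded_integrable _ _ _ _ (M * N)) => [|w]; first exact: measurable_funM.
  by rewrite normrM ler_pM.
(* On an event [B] of [z n], this is the induction hypothesis with [n] moved to [t] and [B] as its
   event. *)
have /eqP : \int[P]_w (z n w * (V w - c)) = 0.
  apply: Rintegral_orth => //.
  - have := integrableB measurableT iV ic.
    by apply: eq_integrable => // w _.
  - have := integrableB measurableT izV izc.
    by apply: eq_integrable => // w _ /=; rewrite mulrBr EFinB.
  move=> C mC; set B := z n @^-1` C.
  have mB : measurable B by rewrite -[B]setTI; exact: mz.
  rewrite RintegralB//; last 2 first.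
  - exact: integrableS iV.
  - exact: integrableS ic.
  rewrite Rintegral_cst//.
  pose A' k := if k == n then B else A k.
  have A'E w : \prod_(k <- n :: t) \1_(A' k) w = \1_B w * q w :> R.
    rewrite big_cons /A' eqxx; congr (_ * _); apply: eq_big_seq => k kt.
    by case: eqP => // kn; rewrite -kn kt in nt.
  have PA' : \prod_(k <- n :: t) fine (P (A' k)) = fine (P B) * \prod_(k <- t) fine (P (A k)).
    rewrite big_cons /A' eqxx; congr (_ * _); apply: eq_big_seq => k kt.
    by case: eqP => // kn; rewrite -kn kt in nt.
  have := ih us sD' hz' (n :: t) A' usnt; rewrite PA'.
  have -> : \int[P]_(w in B) V w = \int[P]_w (\prod_(k <- s) z k w * \prod_(k <- n :: t) \1_(A' k) w).
    rewrite Rintegral_mkcond; apply: eq_Rintegral => w _.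
    rewrite A'E patchE indicE /V; case: (w \in B); first by rewrite mul1r.
    by rewrite mul0r mulr0.
  move=> ->; first by rewrite /c; apply/eqP; rewrite subr_eq0; apply/eqP; ring.
  move=> k; rewrite in_cons /A' => /orP[/eqP ->|kt]; first by rewrite eqxx; split => //; exact: Gz.
  by case: eqP => [kn|_]; [rewrite -kn kt in nt|exact: tD].
under eq_Rintegral do rewrite mulrBr.
rewrite RintegralB// subr_eq0 => /eqP e.
under eq_Rintegral do rewrite big_cons -mulrA.
rewrite e big_cons -mulrA RintegralZr//.
exact: bounded_integrable zM.
Qed.

Lemma independent_gaussian_cf_sum (N : nat) (X : nat -> Omega -> R) (v : nat -> R) :
  (forall n, (n < N)%N -> D n) -> (forall n, (n < N)%N -> gaussian_cf P (X n) 0 (v n)) ->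
  (forall n, (n < N)%N -> forall C, measurable C -> G n (X n @^-1` C)) ->
  gaussian_cf P (fun w => \sum_(n < N) X n w) 0 (\sum_(n < N) v n).
Proof.
move=> ND cf GX.
have mX (n : 'I_N) : measurable_fun setT (X n) by case: (cf n (ltn_ord n)).
have mS k : (k <= N)%N -> measurable_fun setT (fun w => \sum_(n < k) X n w).
  move=> kN; apply: measurable_sum => n.
  exact: (mX (Ordinal (leq_trans (ltn_ord n) kN))).
split=> [|a b]; first exact: mS.
have admc n c d : (n < N)%N -> adm (fun w => cos (c * X n w + d)) n.
  move=> nN; split.
  - apply: measurable_fun_cos; apply: measurable_funD => //; apply: measurable_funM => //.
    exact: (mX (Ordinal nN)).
  - by exists 1 => w; exact: norm_cos_le1.
  - move=> C mC.
    rewrite (_ : _ @^-1` C = X n @^-1` ((fun x => cos (c * x + d)) @^-1` C))//.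
    apply: GX => //; rewrite -[X in measurable X]setTI; exact: measurable_cos_affine.
(* The factors indexed by s make the induction on k go through: the addition
   formula for cos moves X k from the sum to the product. *)
suff key (k : nat) (s : seq nat) (z : nat -> Omega -> R) (b' : R) : (k <= N)%N -> uniq s ->
    (forall n, n \in s -> (k <= n < N)%N /\ adm (z n) n) ->
    \int[P]_w (cos (a * \sum_(n < k) X n w + b') * \prod_(n <- s) z n w) =
    cos b' * expR (- (a ^+ 2 * \sum_(n < k) v n) / 2) * \prod_(n <- s) \int[P]_w z n w.
  have := key N [::] (fun _ _ => 0) b (leqnn _) erefl.
  rewrite !big_nil mulr1 mulr0 add0r => <- //.
  by apply: eq_Rintegral => w _; rewrite mulr1.
elim: k s z b' => [|k ih] s z b' kN us hs.
  rewrite big_ord0 mulr0 oppr0 mul0r expR0 mulr1.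
  under eq_Rintegral do rewrite big_ord0 mulr0 add0r.
  have [mp [M pM]] := bounded_prod (fun n ns => (hs n ns).2).
  rewrite RintegralZl//; last exact: bounded_integrable pM.
  rewrite independent_Rintegral_prod// => n ns; last by have [_ []] := hs n ns.
  by apply: ND; have [/andP[_ ->]] := hs n ns.
have ks : k \notin s by apply/negP => /hs[]; rewrite ltnn.
have uks : uniq (k :: s) by rewrite /= ks us.
pose z' d n w := if n == k then cos (a * X k w + d) else z n w.
have z's d n : n \in s -> z' d n = z n.
  by move=> ns; apply/funext => w; rewrite /z'; case: eqP => // nk; rewrite -nk ns in ks.
have hz' d n : n \in k :: s -> (k <= n < N)%N /\ adm (z' d n) n.
  rewrite in_cons => /orP[/eqP->|ns].
    rewrite leqnn kN; split => //; rewrite /z' eqxx; exact: admc.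
  by rewrite z's//; have [/andP[/ltnW -> ->]] := hs n ns.
have prodE d w : \prod_(n <- k :: s) z' d n w = cos (a * X k w + d) * \prod_(n <- s) z n w.
  rewrite big_cons {1}/z' eqxx; congr (_ * _); apply: eq_big_seq => n ns.
  by rewrite z's.
have IE d : \prod_(n <- k :: s) \int[P]_w z' d n w =
    cos d * expR (- (a ^+ 2 * v k) / 2) * \prod_(n <- s) \int[P]_w z n w.
  rewrite big_cons; congr (_ * _).
    under eq_Rintegral do rewrite /z' eqxx.
    by case: (cf k kN) => _ ->; rewrite mulr0 add0r.
  by apply: eq_big_seq => n ns; rewrite z's.
have e w : cos (a * \sum_(n < k.+1) X n w + b') * \prod_(n <- s) z n w =
    cos (a * \sum_(n < k) X n w + b') * \prod_(n <- k :: s) z' 0 n w -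
    cos (a * \sum_(n < k) X n w + (b' - pi / 2)) * \prod_(n <- k :: s) z' (- (pi / 2)) n w.
  rewrite !prodE big_ord_recr/= addrA !cosBpihalf addr0 mulrDr addrAC cosD.
  by ring.
have it d d' : P.-integrable setT (EFin \o (fun w => cos (a * \sum_(n < k) X n w + d) * \prod_(n <- k :: s) z' d' n w)).
  have [mp [M pM]] := bounded_prod (fun n ns => (hz' d' n ns).2).
  apply: (@bounded_integrable _ _ _ _ M) => [|w].
    apply: measurable_funM => //; apply: measurable_fun_cos; apply: measurable_funD => //.
    by apply: measurable_funM => //; apply: mS; exact: ltnW.
  by rewrite normrM (le_trans _ (pM w))// ler_piMl// norm_cos_le1.
under eq_Rintegral do rewrite e.
rewrite RintegralB// !ih ?(ltnW kN)//; try exact: hz'.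
(* The sine of the centered variable [a * X k] has mean zero, since its phase is - pi / 2; only the
   product of cosines remains. *)
rewrite !IE cos0 [cos (- (pi / 2))]cosN cos_pihalf mul0r mul0r mulr0 subr0 mul1r.
rewrite big_ord_recr/= mulrDr opprD mulrDl expRD; ring.
Qed.

End independent_products.

(** * Centered Gaussian processes *)

Section square_integrable.
Context dsp (Omega : measurableType dsp) (R : realType) (P : probability Omega R).
Implicit Types f g : Omega -> R.

Lemma Rintegral_sum (I : eqType) (s : seq I) (F : I -> Omega -> R) :
  (forall i, i \in s -> P.-integrable setT (EFin \o F i)) ->
  P.-integrable setT (EFin \o (fun w => \sum_(i <- s) F i w)) /\
  \int[P]_w (\sum_(i <- s) F i w) = \sum_(i <- s) \int[P]_w F i w.
Proof.
elim: s => [_|i s ih h].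
  split.
    have : P.-integrable setT (EFin \o (cst 0 : Omega -> R)) by exact: finite_measure_integrable_cst.
    by apply: eq_integrable => // w _ /=; rewrite big_nil.
  by rewrite big_nil; under eq_Rintegral do rewrite big_nil; rewrite Rintegral_cst_prob.
have [|ihi ihE] := ih; first by move=> j js; apply: h; rewrite in_cons js orbT.
have hi := h i (mem_head _ _).
split.
  have := integrableD measurableT hi ihi.
  by apply: eq_integrable => // w _ /=; rewrite big_cons EFinD.
by under eq_Rintegral do rewrite big_cons; rewrite RintegralD// ihE big_cons.
Qed.

Lemma integrableM_sqr f g : measurable_fun setT f -> measurable_fun setT g ->
  P.-integrable setT (EFin \o (fun w => f w ^+ 2)) ->
  P.-integrable setT (EFin \o (fun w => g w ^+ 2)) ->
  P.-integrable setT (EFin \o (fun w => f w * g w)).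
Proof.
move=> mf mg f2 g2; apply: le_integrable (integrableD measurableT f2 g2) => //.
  by apply/measurable_EFinP; exact: measurable_funM.
move=> w _ /=; rewrite lee_fin [leRHS]ger0_norm ?addr_ge0 ?sqr_ge0// ler_norml.
by have := sqr_ge0 (f w - g w); have := sqr_ge0 (f w + g w); nra.
Qed.

Lemma Lfun2_sqr_integrable f : measurable_fun setT f ->
  P.-integrable setT (EFin \o (fun w => f w ^+ 2)) -> f \in Lfun P 2%:E.
Proof.
move=> mf f2; rewrite inE; apply/andP; split; rewrite inE//.
rewrite /finite_norm unlock /Lnorm/=.
rewrite poweR_lty//.
have /integrableP[_] := f2; apply: le_lt_trans.
rewrite le_eqVlt; apply/orP; left; apply/eqP; apply: eq_integral => w _ /=.
by rewrite powR_mulrn// real_normK ?num_real// ger0_norm ?sqr_ge0.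
Qed.

End square_integrable.

Section gaussian_family.
Context dsp (Omega : measurableType dsp) (R : realType) (P : probability Omega R).
Context (d : nat).
Implicit Types (X : R -> Omega -> 'cV[R]_d) (K : R -> R -> R).

(** A list of pairs (t, u) stands for the linear functional sum u X_t of the process. Lists allow
    repeated times, and adding functionals is concatenation. *)
Definition lincomb X (s : seq (R * 'rV[R]_d)) (w : Omega) : R := \sum_(p <- s) (p.2 *m X p.1 w) 0 0.

(** The variance of [lincomb] when E[X_t X_s^T] = K t s I_d. *)
Definition qform K (s : seq (R * 'rV[R]_d)) : R :=
  \sum_(p <- s) \sum_(q <- s) K p.1 q.1 * (p.2 *m q.2^T) 0 0.

(** A centered Gaussian process with independent coordinates of covariance K. *)
Definition centered_gaussian (D : set R) X K := forall s, (forall p, p \in s -> D p.1) ->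
  gaussian_cf P (lincomb X s) 0 (qform K s).

Lemma mulmxE00 (u : 'rV[R]_d) (x : 'cV[R]_d) : (u *m x) 0 0 = \sum_i u 0 i * x i 0.
Proof. by rewrite mxE. Qed.

Lemma mulmx_deltaE (i : 'I_d) (x : 'cV[R]_d) : ((delta_mx 0 i : 'rV[R]_d) *m x) 0 0 = x i 0.
Proof.
rewrite mulmxE00 (bigD1 i)//= mxE !eqxx mul1r big1 ?addr0// => j ji.
by rewrite mxE (negbTE ji) mul0r.
Qed.

Section moments_to_cf.
Variables (D : set R) (X : R -> Omega -> 'cV[R]_d) (K : R -> R -> R).
Hypothesis gX : gaussian_process P D X.
Hypothesis meanX : forall t, D t -> mx_expectation P (X t) = 0.
Hypothesis covX : forall t s, D t -> D s ->
  mx_expectation P (fun w => X t w *m (X s w)^T) = (K t s)%:M.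

Let lincomb_normal s : (forall p, p \in s -> D p.1) -> normal_rv P (lincomb X s).
Proof.
move=> sD.
pose p0 : R * 'rV[R]_d := (0, 0).
have := @gX (size s) (fun j => (nth p0 s j).1) (fun j => (nth p0 s j).2).
have -> : (fun w => \sum_(j < size s) ((nth p0 s j).2 *m X (nth p0 s j).1 w) 0 0) = lincomb X s.
  by apply/funext => w; rewrite /lincomb (big_nth p0) big_mkord.
by apply => j; apply: sD; exact: mem_nth.
Qed.

Let coord_normal t i : D t -> normal_rv P (fun w => X t w i 0).
Proof.
move=> Dt; have := @lincomb_normal [:: (t, delta_mx 0 i)].
have -> : lincomb X [:: (t, delta_mx 0 i)] = fun w => X t w i 0.
  by apply/funext => w; rewrite /lincomb big_seq1 mulmx_deltaE.
by apply => p; rewrite inE => /eqP ->.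
Qed.

Let coord_meas t i : D t -> measurable_fun setT (fun w => X t w i 0).
Proof. by move=> Dt; have [] := coord_normal i Dt. Qed.

Let coord_sqr t i : D t -> P.-integrable setT (EFin \o (fun w => X t w i 0 ^+ 2)).
Proof.
move=> /(coord_normal i)/normal_rv_cf[m [v [v0 cf]]].
exact: gaussian_sqr_integrable v0 cf.
Qed.

Let coord_int t i : D t -> P.-integrable setT (EFin \o (fun w => X t w i 0)).
Proof.
move=> /(coord_normal i)/normal_rv_cf[m [v [v0 cf]]].
exact: gaussian_integrable v0 cf.
Qed.

Let coord_mean t i : D t -> \int[P]_w X t w i 0 = 0.
Proof.
move=> /meanX /matrixP /(_ i 0); rewrite !mxE => <-.
by rewrite /Rintegral unlock.
Qed.

Let coord_cov t s i j : D t -> D s -> \int[P]_w (X t w i 0 * X s w j 0) = K t s * (i == j)%:R.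
Proof.
move=> Dt Ds; have /matrixP /(_ i j) := covX Dt Ds; rewrite !mxE mulr_natr => <-.
rewrite /Rintegral unlock; congr fine; apply: eq_integral => w _.
by rewrite mxE big_ord1 mxE.
Qed.

Let coord_prod t s i j : D t -> D s -> P.-integrable setT (EFin \o (fun w => X t w i 0 * X s w j 0)).
Proof. by move=> Dt Ds; apply: integrableM_sqr; [exact: coord_meas|exact: coord_meas|exact: coord_sqr|exact: coord_sqr]. Qed.

Let lincomb_mean s : (forall p, p \in s -> D p.1) -> \int[P]_w lincomb X s w = 0.
Proof.
move=> sD; have h p : p \in s -> P.-integrable setT (EFin \o (fun w => (p.2 *m X p.1 w) 0 0)) /\
    \int[P]_w (p.2 *m X p.1 w) 0 0 = 0.
  move=> ps; have Dp := sD p ps.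
  have hi i : P.-integrable setT (EFin \o (fun w => p.2 0 i * X p.1 w i 0)).
    have := integrableZl measurableT (p.2 0 i) (coord_int i Dp).
    by apply: eq_integrable => // w _ /=; rewrite EFinM.
  have -> : (fun w => (p.2 *m X p.1 w) 0 0) = (fun w => \sum_i p.2 0 i * X p.1 w i 0).
    by apply/funext => w; rewrite mulmxE00.
  have [it ->] := Rintegral_sum (s := index_enum 'I_d) (fun i _ => hi i); split => //.
  by rewrite big1// => i _; rewrite RintegralZl ?coord_mean ?mulr0//; exact: coord_int.
rewrite /lincomb; have [_ ->] := Rintegral_sum (fun p ps => (h p ps).1).
by rewrite big_seq big1// => p ps; exact: (h p ps).2.
Qed.

Let lincomb_sqr s : (forall p, p \in s -> D p.1) -> \int[P]_w (lincomb X s w ^+ 2) = qform K s.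
Proof.
move=> sD.
have h p q : p \in s -> q \in s ->
    P.-integrable setT (EFin \o (fun w => (p.2 *m X p.1 w) 0 0 * (q.2 *m X q.1 w) 0 0)) /\
    \int[P]_w ((p.2 *m X p.1 w) 0 0 * (q.2 *m X q.1 w) 0 0) = K p.1 q.1 * (p.2 *m q.2^T) 0 0.
  move=> ps qs; have Dp := sD p ps; have Dq := sD q qs.
  have hij i j : P.-integrable setT (EFin \o (fun w => (p.2 0 i * q.2 0 j) * (X p.1 w i 0 * X q.1 w j 0))).
    have := integrableZl measurableT (p.2 0 i * q.2 0 j) (coord_prod i j Dp Dq).
    by apply: eq_integrable => // w _ /=; rewrite !EFinM.
  have -> : (fun w => (p.2 *m X p.1 w) 0 0 * (q.2 *m X q.1 w) 0 0) =
      (fun w => \sum_i \sum_j (p.2 0 i * q.2 0 j) * (X p.1 w i 0 * X q.1 w j 0)).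
    apply/funext => w; rewrite !mulmxE00 mulr_suml; apply: eq_bigr => i _.
    by rewrite mulr_sumr; apply: eq_bigr => j _; rewrite mulrACA.
  have hi i := Rintegral_sum (s := index_enum 'I_d) (fun j _ => hij i j).
  have [it ->] := Rintegral_sum (s := index_enum 'I_d) (fun i _ => (hi i).1); split => //.
  rewrite mulmxE00 mulr_sumr; apply: eq_bigr => i _; rewrite (hi i).2 (bigD1 i)//= big1 ?addr0.
    by rewrite RintegralZl ?coord_cov ?eqxx ?mulr1 ?mxE 1?mulrC//; exact: coord_prod.
  move=> j ji; rewrite RintegralZl ?coord_cov//; last exact: coord_prod.
  by rewrite eq_sym (negbTE ji) !mulr0.
have -> : (fun w => lincomb X s w ^+ 2) = (fun w => \sum_(p <- s) \sum_(q <- s)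
    ((p.2 *m X p.1 w) 0 0 * (q.2 *m X q.1 w) 0 0)).
  by apply/funext => w; rewrite expr2 /lincomb big_distrlr.
have hp p : p \in s -> _ := fun ps => Rintegral_sum (fun q qs => (h p q ps qs).1).
have [_ ->] := Rintegral_sum (fun p ps => (hp p ps).1).
rewrite /qform; apply: eq_big_seq => p ps; rewrite (hp p ps).2.
by apply: eq_big_seq => q qs; rewrite (h p q ps qs).2.
Qed.

(** A normal law is determined by its mean and its variance, and for a linear functional both are
    computed from the given moments of the coordinates. *)
Lemma gaussian_process_centered : centered_gaussian D X K.
Proof.
move=> s sD; have [m [v [v0 cf]]] := normal_rv_cf (lincomb_normal sD).
have m0 : m = 0 by rewrite -(gaussian_mean v0 cf) lincomb_mean.
have vE : v = qform K s by rewrite -(gaussian_variance v0 cf m0) lincomb_sqr.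
by rewrite -m0 -vE.
Qed.

End moments_to_cf.

Section cf_to_moments.
Variables (D : set R) (X : R -> Omega -> 'cV[R]_d) (K : R -> R -> R).
Hypothesis cgX : centered_gaussian D X K.
Hypothesis Ksym : forall t s, K t s = K s t.
Hypothesis K0 : forall s, (forall p, p \in s -> D p.1) -> 0 <= qform K s.

Lemma qform1 t u : qform K [:: (t, u)] = K t t * (u *m u^T) 0 0.
Proof. by rewrite /qform !big_seq1. Qed.

Lemma qform2 t u s v : qform K [:: (t, u); (s, v)] =
  K t t * (u *m u^T) 0 0 + 2 * K t s * (u *m v^T) 0 0 + K s s * (v *m v^T) 0 0.
Proof.
rewrite /qform !big_cons !big_nil/= !addr0 (Ksym s t).
have -> : (v *m u^T) 0 0 = (u *m v^T) 0 0 by rewrite -[in LHS](trmxK v) -trmx_mul mxE.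
by ring.
Qed.

Lemma lincomb1 t i : lincomb X [:: (t, delta_mx 0 i)] = fun w => X t w i 0.
Proof. by apply/funext => w; rewrite /lincomb big_seq1 mulmx_deltaE. Qed.

Lemma lincomb2 t i s j : lincomb X [:: (t, delta_mx 0 i); (s, delta_mx 0 j)] =
  fun w => X t w i 0 + X s w j 0.
Proof. by apply/funext => w; rewrite /lincomb big_cons big_seq1 !mulmx_deltaE. Qed.

Lemma delta_mx_dot (i j : 'I_d) : ((delta_mx 0 i : 'rV[R]_d) *m (delta_mx 0 j : 'rV[R]_d)^T) 0 0 = (i == j)%:R.
Proof. by rewrite mulmx_deltaE !mxE eqxx/= eq_sym. Qed.

Lemma centered_gaussian_coord t i : D t -> gaussian_cf P (fun w => X t w i 0) 0 (K t t).
Proof.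
move=> Dt; have := @cgX [:: (t, delta_mx 0 i)].
rewrite lincomb1 qform1 delta_mx_dot eqxx mulr1; apply => p.
by rewrite inE => /eqP ->.
Qed.

Lemma centered_gaussian_diag_ge0 t (i : 'I_d) : D t -> 0 <= K t t.
Proof.
move=> Dt; have := @K0 [:: (t, delta_mx 0 i)].
by rewrite qform1 delta_mx_dot eqxx mulr1; apply => p; rewrite inE => /eqP ->.
Qed.

Lemma centered_gaussian_coord_Lfun2 t i : D t -> (fun w => X t w i 0) \in Lfun P 2%:E.
Proof.
move=> Dt; have cf := centered_gaussian_coord i Dt.
apply: Lfun2_sqr_integrable; first by case: cf.
exact: gaussian_sqr_integrable (centered_gaussian_diag_ge0 i Dt) cf.
Qed.

Lemma centered_gaussian_mean t i : D t -> \int[P]_w X t w i 0 = 0.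
Proof.
move=> Dt; have cf := centered_gaussian_coord i Dt.
exact: gaussian_mean (centered_gaussian_diag_ge0 i Dt) cf.
Qed.

(** Polarization: the variance of the sum of the two coordinates is known. *)
Lemma centered_gaussian_prod t s i j : D t -> D s ->
  P.-integrable setT (EFin \o (fun w => X t w i 0 * X s w j 0)) /\
  \int[P]_w (X t w i 0 * X s w j 0) = K t s * (i == j)%:R.
Proof.
move=> Dt Ds; have ci := centered_gaussian_coord i Dt; have cj := centered_gaussian_coord j Ds.
have vi := centered_gaussian_diag_ge0 i Dt; have vj := centered_gaussian_diag_ge0 j Ds.
have xi := gaussian_sqr_integrable vi ci; have xj := gaussian_sqr_integrable vj cj.
have xij : P.-integrable setT (EFin \o (fun w => X t w i 0 * X s w j 0)).
  by apply: integrableM_sqr => //; [case: ci|case: cj].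
split => //.
have sD (p : R * 'rV[R]_d) : p \in [:: (t, delta_mx 0 i); (s, delta_mx 0 j)] -> D p.1.
  by rewrite !inE => /orP[] /eqP ->.
have := gaussian_variance (K0 sD) (cgX sD) erefl.
rewrite lincomb2 qform2 !delta_mx_dot !eqxx !mulr1.
have -> : (fun w => (X t w i 0 + X s w j 0) ^+ 2) =
    (fun w => X t w i 0 ^+ 2 + 2 * (X t w i 0 * X s w j 0) + X s w j 0 ^+ 2).
  by apply/funext => w; ring.
have x2 : P.-integrable setT (EFin \o (fun w => 2 * (X t w i 0 * X s w j 0))).
  have := integrableZl measurableT 2 xij.
  by apply: eq_integrable => // w _ /=; rewrite -EFinM.
have x12 := integrableD measurableT xi x2.
rewrite RintegralD// RintegralD// RintegralZl//.
rewrite (gaussian_variance vi ci erefl) (gaussian_variance vj cj erefl).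
by lra.
Qed.

Lemma centered_gaussian_mx_mean t : D t -> mx_expectation P (X t) = 0.
Proof.
move=> Dt; apply/matrixP => i j; rewrite !mxE ord1 unlock.
exact: centered_gaussian_mean.
Qed.

Lemma centered_gaussian_mx_cov t s : D t -> D s ->
  mx_expectation P (fun w => X t w *m (X s w)^T) = (K t s)%:M.
Proof.
move=> Dt Ds; apply/matrixP => i j; rewrite !mxE unlock -[RHS]mulr_natr.
rewrite -(centered_gaussian_prod i j Dt Ds).2; congr fine.
by apply: eq_integral => w _; rewrite mxE big_ord1 mxE.
Qed.

Lemma centered_gaussian_normal_vector t : D t -> normal_vector P (X t).
Proof.
move=> Dt u; have sD p : p \in [:: (t, u)] -> D p.1 by rewrite inE => /eqP ->.
have -> : (fun w => (u *m X t w) 0 0) = lincomb X [:: (t, u)].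
  by apply/funext => w; rewrite /lincomb big_seq1.
exact: cf_normal_rv (K0 sD) (cgX sD).
Qed.

End cf_to_moments.

End gaussian_family.

(** * The variance function of the mixture *)

Section powR_concavity.
Context {R : realType}.
Implicit Types a x y h : R.

Lemma lt1_powR a x : 0 < x < 1 -> 0 < a < 1 -> x < x `^ a.
Proof.
move=> /andP[x0 x1] /andP[a0 a1].
have {1}-> : x = x `^ a * x `^ (1 - a).
  rewrite -powRD; last by rewrite (gt_eqF x0) implybT.
  by rewrite subrKC powRr1// ltW.
have e1 : 1 `^ (1 - a) = 1 :> R by rewrite powR1.
rewrite gtr_pMr ?powR_gt0// -[ltRHS]e1.
by apply: gt0_ltr_powR; rewrite ?subr_gt0 ?nnegrE// ltW.
Qed.

(** Each of the fractions x / (x + y) and y / (x + y) lies in ]0, 1[ and is strictly increased by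
    the power a, while the two add up to 1. *)
Lemma powR_subadd_lt a x y : 0 < a < 1 -> 0 < x -> 0 < y ->
  (x + y) `^ a < x `^ a + y `^ a.
Proof.
move=> a01 x0 y0; have s0 : 0 < x + y by rewrite addr_gt0.
have h (z : R) : 0 < z < x + y -> z / (x + y) * (x + y) `^ a < z `^ a.
  move=> /andP[z0 zs]; have -> : z `^ a = (z / (x + y)) `^ a * (x + y) `^ a.
    by rewrite -powRM ?divr_ge0 ?(ltW z0) ?(ltW s0)// divfK// gt_eqF.
  rewrite ltr_pM2r ?powR_gt0// lt1_powR// divr_gt0//= ltr_pdivrMr// mul1r//.
have := ltrD (h x _) (h y _); rewrite x0 y0 ltrDl ltrDr x0 y0 -mulrDl -mulrDl.
by rewrite divff ?gt_eqF// mul1r; apply.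
Qed.

(** Concavity: at x - y the power lies above the chord from 0 to x. *)
Lemma powR_sub_le a x y : 0 < a < 1 -> 0 <= y <= x -> 0 < x ->
  x `^ a - (x - y) `^ a <= x `^ a * (y / x).
Proof.
move=> /andP[a0 a1] /andP[y0 yx] x0.
have : (x - y) / x * x `^ a <= (x - y) `^ a.
  have [->|yx'] := eqVneq y x; first by rewrite subrr !mul0r powR0 ?gt_eqF.
  have d0 : 0 < x - y by rewrite subr_gt0 lt_neqAle yx'.
  have -> : (x - y) `^ a = ((x - y) / x) `^ a * x `^ a.
    by rewrite -powRM ?divr_ge0 ?(ltW d0) ?(ltW x0)// divfK// gt_eqF.
  rewrite ler_wpM2r ?powR_ge0// ger1_powR ?(ltW a1)// divr_gt0//=.
  by rewrite ler_pdivrMr// mul1r gerBl.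
have -> : (x - y) / x = 1 - y / x by rewrite mulrBl divff// gt_eqF.
lra.
Qed.

(* Weighted AM-GM, from ln z <= z - 1 at z = y / m and z = 1 / m with
   m = a y + (1 - a). *)
Lemma powR_tangent a y : 0 < a < 1 -> 0 <= y -> y `^ a <= 1 + a * (y - 1).
Proof.
move=> /andP[a0 a1]; rewrite le_eqVlt => /predU1P[<-|y0].
  by rewrite powR0 ?gt_eqF//; lra.
pose m := a * y + (1 - a).
have m0 : 0 < m by have := mulr_gt0 a0 y0; rewrite /m; lra.
have ln_le (z : R) : 0 < z -> ln z <= z - 1.
  by move=> z0; have := expR_ge1Dx (ln z); rewrite lnK ?posrE//; lra.
have h1 := ln_le (y / m) (divr_gt0 y0 m0).
have h2 := ln_le m^-1; rewrite invr_gt0 in h2; have {}h2 := h2 m0.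
rewrite lnM ?posrE ?invr_gt0// lnV ?posrE// in h1; rewrite lnV ?posrE// in h2.
have -> : 1 + a * (y - 1) = m by rewrite /m; ring.
rewrite /powR gt_eqF// -[leRHS]lnK ?posrE// ler_expR.
have : a * (y / m) + (1 - a) * m^-1 = 1 by rewrite /m; field; rewrite -/m gt_eqF.
have := ler_wpM2l (ltW a0) h1.
have a1' : 0 <= 1 - a by lra.
have := ler_wpM2l a1' h2.
lra.
Qed.

(** After scaling to x = 1, both values lie below the tangent at 1, and the slopes cancel. *)
Lemma powR_midpoint a x h : 0 < a < 1 -> 0 <= h <= x ->
  (x - h) `^ a + (x + h) `^ a <= 2 * x `^ a.
Proof.
move=> a01 /andP[h0 hx].
have [x0|x0] := eqVneq x 0.
  have -> : h = 0 by lra.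
  by rewrite subr0 addr0; lra.
have {}x0 : 0 < x by rewrite lt_neqAle eq_sym x0 (le_trans h0).
have e (z : R) : 0 <= z -> z `^ a = (z / x) `^ a * x `^ a.
  by move=> z0; rewrite -powRM ?divr_ge0 ?(ltW x0)// divfK// gt_eqF.
rewrite (e (x - h)) ?(e (x + h)) ?subr_ge0 ?addr_ge0 ?(ltW x0)//.
rewrite -mulrDl ler_wpM2r ?powR_ge0//.
have := @powR_tangent a ((x - h) / x) a01; have := @powR_tangent a ((x + h) / x) a01.
rewrite !divr_ge0 ?subr_ge0 ?addr_ge0 ?(ltW x0)// => /(_ isT) h1 /(_ isT) h2.
apply: le_trans (lerD h2 h1) _.
have -> : 1 + a * ((x - h) / x - 1) + (1 + a * ((x + h) / x - 1)) = 2 by field; rewrite gt_eqF.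
by [].
Qed.

Lemma powR_le1D a x : 0 < a < 1 -> 0 <= x -> x `^ a <= 1 + x.
Proof.
move=> /andP[a0 a1] x0; have [x1|x1] := leP x 1.
  rewrite (le_trans (y := 1)) ?lerDl//.
  have -> : 1 = 1 `^ a :> R by rewrite powR1.
  by apply: ge0_ler_powR; rewrite ?nnegrE// ltW.
by rewrite (le_trans (ler1_powR (ltW x1) (ltW a1)))// lerDr.
Qed.

End powR_concavity.

Section mixed_variance.
Context {R : realType}.
Variables (H lam : nat -> R).
Hypothesis H01 : forall n, 0 < H n < 2^-1.
Hypothesis lam1 : cvgn (series (fun n => `|lam n|)).

Definition mixed_var (t : R) : R := limn (series (fun n => lam n ^+ 2 * t `^ (2 * H n))).

Definition mixed_cov (t s : R) : R := limn (series (fun n => lam n ^+ 2 * fbm_cov (H n) t s)).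

Let a01 n : 0 < 2 * H n < 1.
Proof. by have := H01 n; lra. Qed.

Lemma cvg_series_lam_sqr : cvgn (series (fun n => lam n ^+ 2)).
Proof.
set S := limn (series (fun n => `|lam n|)).
have lS n : `|lam n| <= S.
  have nd : nondecreasing_seq (series (fun n => `|lam n|)) by exact: nondecreasing_series.
  apply: le_trans (nondecreasing_cvgn_le nd lam1 n.+1).
  by rewrite /series/= big_nat_recr//= lerDr sumr_ge0.
have : cvgn (series (S *: (fun n => `|lam n|))) by exact: is_cvg_seriesZ.
apply: series_le_cvg => n.
- exact: sqr_ge0.
- by rewrite /= mulr_ge0// (le_trans _ (lS 0)).
- by rewrite /= -real_normK ?num_real// expr2 ler_wpM2r.
Qed.

Lemma cvg_series_mixed_var t : 0 <= t ->
  cvgn (series (fun n => lam n ^+ 2 * t `^ (2 * H n))).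
Proof.
move=> t0; have : cvgn (series ((1 + t) *: (fun n => lam n ^+ 2))).
  by apply: is_cvg_seriesZ; exact: cvg_series_lam_sqr.
apply: series_le_cvg => n.
- by rewrite mulr_ge0 ?sqr_ge0 ?powR_ge0.
- by rewrite /= mulr_ge0 ?sqr_ge0 ?addr_ge0.
- by rewrite /= mulrC ler_wpM2r ?sqr_ge0// powR_le1D.
Qed.

Lemma cvg_series_mixed_var3 c1 c2 c3 t1 t2 t3 : 0 <= t1 -> 0 <= t2 -> 0 <= t3 ->
  series (fun n => lam n ^+ 2 *
    (c1 * t1 `^ (2 * H n) + c2 * t2 `^ (2 * H n) + c3 * t3 `^ (2 * H n))) @ \oo
  --> c1 * mixed_var t1 + c2 * mixed_var t2 + c3 * mixed_var t3.
Proof.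
move=> t10 t20 t30.
pose s t := series (fun n => lam n ^+ 2 * t `^ (2 * H n)).
have -> : series (fun n => lam n ^+ 2 *
    (c1 * t1 `^ (2 * H n) + c2 * t2 `^ (2 * H n) + c3 * t3 `^ (2 * H n))) =
    (fun N => c1 * s t1 N + c2 * s t2 N + c3 * s t3 N).
  apply/funext => N; rewrite /s /series/= !mulr_sumr -!big_split/=.
  by apply: eq_bigr => n _; ring.
have c t : 0 <= t -> s t @ \oo --> mixed_var t by move=> /cvg_series_mixed_var.
by apply: cvgD; [apply: cvgD|]; apply: cvgM; try exact: cvg_cst; exact: c.
Qed.

(** Transfers a linear inequality between powers, valid for every exponent, to the variance
    function. Keeping the n-th term on the left preserves strictness when [lam n] is nonzero; three
    points are enough for every use below. *)
Lemma mixed_var3_ge c1 c2 c3 t1 t2 t3 n : 0 <= t1 -> 0 <= t2 -> 0 <= t3 ->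
  (forall n, 0 <= c1 * t1 `^ (2 * H n) + c2 * t2 `^ (2 * H n) + c3 * t3 `^ (2 * H n)) ->
  lam n ^+ 2 * (c1 * t1 `^ (2 * H n) + c2 * t2 `^ (2 * H n) + c3 * t3 `^ (2 * H n)) <=
  c1 * mixed_var t1 + c2 * mixed_var t2 + c3 * mixed_var t3.
Proof.
move=> t10 t20 t30 h; have := @cvg_series_mixed_var3 c1 c2 c3 t1 t2 t3 t10 t20 t30.
set u := (fun n => _); move=> cu; rewrite -(cvg_lim _ cu)//.
have u0 k : 0 <= u k by rewrite mulr_ge0 ?sqr_ge0.
have nd : nondecreasing_seq (series u) by exact: nondecreasing_series.
apply: le_trans (nondecreasing_cvgn_le nd (cvgP _ cu) n.+1).
by rewrite /series/= big_nat_recr//= lerDr sumr_ge0.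
Qed.

Lemma mixed_var0 : mixed_var 0 = 0.
Proof.
rewrite /mixed_var (_ : series _ = cst 0) ?lim_cst//.
apply/funext => N; rewrite /series/= big1// => n _.
by rewrite powR0 ?mulr0// gt_eqF//; have := a01 n; lra.
Qed.

Lemma mixed_var_ge n t : 0 <= t -> lam n ^+ 2 * t `^ (2 * H n) <= mixed_var t.
Proof.
move=> t0; have := @mixed_var3_ge 1 0 0 t t t n t0 t0 t0.
by rewrite !mul0r !addr0 !mul1r; apply => k; rewrite !mul0r mul1r !addr0 powR_ge0.
Qed.

Lemma mixed_var_gt0 n t : lam n != 0 -> 0 < t -> 0 < mixed_var t.
Proof.
move=> ln t0; apply: lt_le_trans (mixed_var_ge n (ltW t0)).
by rewrite mulr_gt0 ?powR_gt0// exprn_even_gt0.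
Qed.

Lemma mixed_var_subadd n t s : lam n != 0 -> 0 < t -> 0 < s ->
  mixed_var (t + s) < mixed_var t + mixed_var s.
Proof.
move=> ln t0 s0.
have h k : 0 < 1 * t `^ (2 * H k) + 1 * s `^ (2 * H k) + (- 1) * (t + s) `^ (2 * H k).
  by rewrite !mul1r mulN1r subr_gt0 powR_subadd_lt.
have := @mixed_var3_ge 1 1 (-1) t s (t + s) n (ltW t0) (ltW s0) (addr_ge0 (ltW t0) (ltW s0))
  (fun k => ltW (h k)).
have : 0 < lam n ^+ 2 * (1 * t `^ (2 * H n) + 1 * s `^ (2 * H n) + (- 1) * (t + s) `^ (2 * H n)).
  by rewrite mulr_gt0 ?h// exprn_even_gt0.
by move=> h1 /(lt_le_trans h1); rewrite !mul1r mulN1r subr_gt0.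
Qed.

Lemma mixed_var_sub_le t s : 0 <= s <= t -> 0 < t ->
  mixed_var t - mixed_var (t - s) <= mixed_var t * (s / t).
Proof.
move=> /andP[s0 st] t0.
have h k : 0 <= (s / t - 1) * t `^ (2 * H k) + 1 * (t - s) `^ (2 * H k) + 0 * 0 `^ (2 * H k).
  by have := @powR_sub_le _ (2 * H k) t s (a01 k); rewrite s0 st => /(_ isT t0); lra.
have ts0 : 0 <= t - s by rewrite subr_ge0.
have h1 := @mixed_var3_ge (s / t - 1) 1 0 t (t - s) 0 0%N (ltW t0) ts0 (lexx 0) h.
have := le_trans (mulr_ge0 (sqr_ge0 (lam 0%N)) (h 0%N)) h1.
by move: (mixed_var t) (mixed_var (t - s)) (mixed_var 0) => A B C; lra.
Qed.

Lemma mixed_var_midpoint t h : 0 <= h <= t ->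
  mixed_var (t - h) + mixed_var (t + h) <= 2 * mixed_var t.
Proof.
move=> /andP[h0 ht]; have t0 := le_trans h0 ht.
have p k : 0 <= 2 * t `^ (2 * H k) + (-1) * (t - h) `^ (2 * H k) + (-1) * (t + h) `^ (2 * H k).
  by have := @powR_midpoint _ (2 * H k) t h (a01 k); rewrite h0 ht => /(_ isT); lra.
have th0 : 0 <= t - h by rewrite subr_ge0.
have h1 := @mixed_var3_ge 2 (-1) (-1) t (t - h) (t + h) 0%N t0 th0 (addr_ge0 t0 h0) p.
have := le_trans (mulr_ge0 (sqr_ge0 (lam 0%N)) (p 0%N)) h1.
by move: (mixed_var t) (mixed_var (t - h)) (mixed_var (t + h)) => A B C; lra.
Qed.

Lemma cvg_series_mixed_cov t s : 0 <= t -> 0 <= s ->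
  series (fun n => lam n ^+ 2 * fbm_cov (H n) t s) @ \oo -->
  2^-1 * (mixed_var s + mixed_var t - mixed_var `|t - s|).
Proof.
move=> t0 s0; have := @cvg_series_mixed_var3 2^-1 2^-1 (- 2^-1) s t `|t - s| s0 t0 (normr_ge0 (t - s)).
rewrite (_ : 2^-1 * mixed_var s + 2^-1 * mixed_var t + - 2^-1 * mixed_var `|t - s| =
  2^-1 * (mixed_var s + mixed_var t - mixed_var `|t - s|)); last first.
  by move: (mixed_var t) (mixed_var s) (mixed_var `|t - s|) => A B C; lra.
rewrite (_ : (fun n => _) = fun n => lam n ^+ 2 * fbm_cov (H n) t s)//.
by apply/funext => n; rewrite /fbm_cov; ring.
Qed.

Lemma mixed_covE t s : 0 <= t -> 0 <= s ->
  mixed_cov t s = 2^-1 * (mixed_var s + mixed_var t - mixed_var `|t - s|).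
Proof. by move=> t0 s0; apply: cvg_lim => //; exact: cvg_series_mixed_cov. Qed.

End mixed_variance.

(** * Integrals, norms and dense times for the suprema of paths *)

Section integral_lemmas.
Context dsp (Omega : measurableType dsp) (R : realType) (P : probability Omega R).

(** The integral of a nonnegative function is a supremum over the simple functions below it, so it
    is monotone without measurability. It is applied to a supremum over uncountably many times. *)
Lemma ge0_le_integral_nonmeasurable (f g : Omega -> \bar R) :
  (forall w, 0 <= f w)%E -> (forall w, f w <= g w)%E ->
  (\int[P]_w f w <= \int[P]_w g w)%E.
Proof.
move=> f0 fg; rewrite !ge0_integralTE//.
  by apply: ereal_sup_le => _ [h hf <-]; exists h => // w; exact: le_trans (hf w) (fg w).
by move=> w; exact: le_trans (f0 w) (fg w).
Qed.

Lemma ge0_integral_same_law (f g : Omega -> R) :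
  measurable_fun setT f -> measurable_fun setT g -> (forall w, 0 <= f w) -> (forall w, 0 <= g w) ->
  (forall A, measurable A -> P (f @^-1` A) = P (g @^-1` A)) ->
  (\int[P]_w (f w)%:E = \int[P]_w (g w)%:E)%E.
Proof.
move=> mf mg f0 g0 h.
pose f' : Omega -> measurableTypeR R := f; pose g' : Omega -> measurableTypeR R := g.
have e (k : Omega -> measurableTypeR R) : measurable_fun setT k -> (forall w, 0 <= k w) ->
    (\int[P]_w (k w)%:E = \int[pushforward P k]_x (Num.max x 0)%:E)%E.
  move=> mk k0; rewrite (ge0_integral_pushforward (phi := k))//.
  - by rewrite preimage_setT; apply: eq_integral => w _ /=; rewrite max_l.
  - by apply/measurable_EFinP; apply: measurable_maxr.
  - by move=> x _; rewrite lee_fin le_max lexx orbT.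
rewrite (e f')// (e g')//; apply: eq_measure_integral => A mA _.
exact: h.
Qed.

End integral_lemmas.

Section column_vectors.
Context {R : realType} {d : nat}.
Implicit Types x y : 'cV[R]_d.

(** A finite sum of absolute values, easily seen to be measurable, that links the Euclidean norm of
    the hypotheses with the sup norm governing convergence. *)
Definition l1norm x : R := \sum_i `|x i 0|.

Lemma norm_coord_le_enorm x i : `|x i 0| <= enorm x.
Proof.
rewrite /enorm -sqrtr_sqr ler_wsqrtr// (bigD1 i)//= lerDl sumr_ge0// => j _.
exact: sqr_ge0.
Qed.

Lemma l1norm_ge0 x : 0 <= l1norm x.
Proof. by apply: sumr_ge0. Qed.

Lemma l1norm_le_enorm x : l1norm x <= d%:R * enorm x.
Proof.
apply: le_trans (ler_sum _ (fun i _ => norm_coord_le_enorm x i)) _.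
by rewrite sumr_const card_ord mulr_natl.
Qed.

Lemma norm_coord_le x i : `|x i 0| <= `|x|.
Proof.
rewrite -[leRHS]/(mx_norm x) mx_normrE.
exact: (le_bigmax _ (fun ij : 'I_d * 'I_1 => `|x ij.1 ij.2|) (i, 0)).
Qed.

Lemma norm_le_l1norm x : `|x| <= l1norm x.
Proof.
rewrite -[leLHS]/(mx_norm x) mx_normrE; apply: bigmax_le; first exact: l1norm_ge0.
by move=> [i j] _ /=; rewrite ord1 /l1norm (bigD1 i)//= lerDl sumr_ge0.
Qed.

Lemma cvg_cV (T : Type) (F : set_system T) (FF : Filter F) (u : T -> 'cV[R]_d) (l : 'cV[R]_d) :
  (forall i, u t i 0 @[t --> F] --> l i 0) -> u @ F --> l.
Proof.
move=> h; apply/cvgrPdist_le => e e0.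
have : \forall t \near F, forall i, `|l i 0 - u t i 0| <= e.
  by apply: filter_forall => i; move/cvgrPdist_le : (h i); apply.
apply: filterS => t ht.
rewrite -[leLHS]/(mx_norm _) mx_normrE; apply: bigmax_le; first exact: ltW.
by move=> [i j] _ /=; rewrite ord1 !mxE.
Qed.

Lemma cvg_coord (T : Type) (F : set_system T) {FF : Filter F} (u : T -> 'cV[R]_d) (l : 'cV[R]_d) i :
  u @ F --> l -> u t i 0 @[t --> F] --> l i 0.
Proof.
move=> h; apply/cvgrPdist_le => e e0; move/cvgrPdist_le : h => /(_ e e0).
by apply: filterS => t; apply: le_trans; have := norm_coord_le (l - u t) i; rewrite !mxE.
Qed.

Lemma seriesE_coord (u : nat -> 'cV[R]_d) N i : series u N i 0 = series (fun n => u n i 0) N.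
Proof. by rewrite /series/= summxE. Qed.

Lemma cvgn_series_coord (u : nat -> 'cV[R]_d) :
  cvgn (series u) <-> forall i, cvgn (series (fun n => u n i 0)).
Proof.
split=> [cu i|cu].
  have : series u n i 0 @[n --> \oo] --> limn (series u) i 0 by exact: cvg_coord.
  under eq_fun do rewrite seriesE_coord.
  exact: cvgP.
apply: (cvgP (\col_i limn (series (fun n => u n i 0)))); apply: cvg_cV => i.
under eq_fun do rewrite seriesE_coord.
by rewrite mxE; exact: cu.
Qed.

Lemma limn_series_coord (u : nat -> 'cV[R]_d) i : cvgn (series u) ->
  limn (series u) i 0 = limn (series (fun n => u n i 0)).
Proof.
move=> cu; have : series u n i 0 @[n --> \oo] --> limn (series u) i 0 by exact: cvg_coord.
under eq_fun do rewrite seriesE_coord.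
by move=> /cvg_lim <-.
Qed.

End column_vectors.

Section rational_times.
Context {R : realType}.

(** An enumeration of the rationals of [0, 1]; codes of other rationals, and numbers that are no
    code, give 0. *)
Definition rat01 (k : nat) : R :=
  if @unpickle rat k is Some r then let q : R := ratr r in if 0 <= q <= 1 then q else 0 else 0.

Lemma rat01_itv k : 0 <= rat01 k <= 1.
Proof.
rewrite /rat01; case: unpickle => [r|]; last by rewrite lexx ler01.
by case: ifP => //; rewrite lexx ler01.
Qed.

Lemma rat01_dense t e : 0 <= t <= 1 -> 0 < e -> exists k, `|t - rat01 k| < e.
Proof.
move=> /andP[t0 t1] e0.
have [|r] := @rat_in_itvoo R (Num.max 0 (t - e)) (Num.min 1 (t + e)).
  by rewrite gt_max !lt_min ltr01 /=; apply/andP; split; [|apply/andP; split]; lra.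
rewrite in_itv/= gt_max lt_min => /andP[/andP[r0 rt] /andP[r1 rt']].
exists (pickle r); rewrite /rat01 pickleK (ltW r0) (ltW r1)/= ltr_norml; lra.
Qed.

End rational_times.

(** * Joint laws of finitely many linear functionals *)

Section linear_families.
Context dsp (Omega : measurableType dsp) (R : realType) (P : probability Omega R).
Context (d : nat).
Implicit Types (X : R -> Omega -> 'cV[R]_d) (K : R -> R -> R) (s : seq (R * 'rV[R]_d)).

Definition bform K s s' : R := \sum_(p <- s) \sum_(q <- s') K p.1 q.1 * (p.2 *m q.2^T) 0 0.

Lemma lincomb_sum X (J : finType) (u : J -> R) (s : J -> seq (R * 'rV[R]_d)) w :
  lincomb X (flatten [seq [seq (p.1, u j *: p.2) | p <- s j] | j <- enum J]) w =
  \sum_j u j * lincomb X (s j) w.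
Proof.
rewrite /lincomb big_flatten big_map big_enum; apply: eq_bigr => j _.
rewrite big_map mulr_sumr; apply: eq_bigr => p _ /=.
by rewrite -scalemxAl mxE.
Qed.

Lemma qform_sum K (J : finType) (u : J -> R) (s : J -> seq (R * 'rV[R]_d)) :
  qform K (flatten [seq [seq (p.1, u j *: p.2) | p <- s j] | j <- enum J]) =
  \sum_j \sum_k u j * u k * bform K (s j) (s k).
Proof.
rewrite /qform big_flatten big_map big_enum; apply: eq_bigr => j _.
rewrite big_map/= (eq_bigr (fun p => \sum_k u j * u k * \sum_(q <- s k) K p.1 q.1 * (p.2 *m q.2^T) 0 0)); last first.
  move=> p _; rewrite big_flatten big_map big_enum; apply: eq_bigr => k _.
  rewrite big_map mulr_sumr; apply: eq_bigr => q _ /=.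
  rewrite -scalemxAl linearZ/= -scalemxAr !mxE; ring.
by rewrite exchange_big/=; apply: eq_bigr => k _; rewrite -mulr_sumr.
Qed.

Lemma centered_gaussian_sum D X K (J : finType) (u : J -> R) (s : J -> seq (R * 'rV[R]_d)) :
  centered_gaussian P D X K -> (forall j p, p \in s j -> D p.1) ->
  gaussian_cf P (fun w => \sum_j u j * lincomb X (s j) w) 0 (\sum_j \sum_k u j * u k * bform K (s j) (s k)).
Proof.
move=> cg sD; rewrite -qform_sum.
under eq_fun do rewrite -lincomb_sum.
apply: cg => p /flattenP[_ /mapP[j _ ->] /mapP[q qs ->]] /=; exact: sD qs.
Qed.

Lemma centered_gaussian_lincomb D X K s : centered_gaussian P D X K -> (forall p, p \in s -> D p.1) ->
  gaussian_cf P (lincomb X s) 0 (bform K s s).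
Proof. by move=> cg; exact: cg. Qed.

(** A linear combination of functionals of the process is again such a functional, and its variance
    is a quadratic form in the covariances [bform]. *)
Lemma centered_gaussian_same_law D D' X X' K K' (J : finType) (s s' : J -> seq (R * 'rV[R]_d)) :
  centered_gaussian P D X K -> centered_gaussian P D' X' K' ->
  (forall j p, p \in s j -> D p.1) -> (forall j p, p \in s' j -> D' p.1) ->
  (forall j k, bform K (s j) (s k) = bform K' (s' j) (s' k)) ->
  forall A : set (J -> R), sigma_of setT (fun j f => f j) A ->
  P [set w | A (fun j => lincomb X (s j) w)] = P [set w | A (fun j => lincomb X' (s' j) w)].
Proof.
move=> cg cg' sD sD' e A mA.
apply: (@same_law_of_cf _ _ _ _ _ P P J (fun j => lincomb X (s j)) (fun j => lincomb X' (s' j))) mA.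
- by move=> j; case: (cg _ (@sD j)).
- by move=> j; case: (cg' _ (@sD' j)).
- move=> u b.
  have [_ h] := centered_gaussian_sum u cg sD.
  have [_ h'] := centered_gaussian_sum u cg' sD'.
  have := h 1 b; have := h' 1 b.
  rewrite (_ : \sum_j \sum_k u j * u k * bform K (s j) (s k) =
    \sum_j \sum_k u j * u k * bform K' (s' j) (s' k)); last first.
    by apply: eq_bigr => j _; apply: eq_bigr => k _; rewrite e.
  under [in X in X -> _]eq_Rintegral do rewrite mul1r.
  under [in X in _ -> X -> _]eq_Rintegral do rewrite mul1r.
  by move=> -> ->.
Qed.

Definition increment (t r : R) (i : 'I_d) : seq (R * 'rV[R]_d) :=
  [:: (t, delta_mx 0 i); (r, - delta_mx 0 i)].

Lemma lincomb_increment X t r i w : lincomb X (increment t r i) w = X t w i 0 - X r w i 0.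
Proof. by rewrite /lincomb big_cons big_seq1 mulNmx [in X in _ + X]mxE !mulmx_deltaE. Qed.

Lemma bform_increment K t r i t' r' j : bform K (increment t r i) (increment t' r' j) =
  (K t t' - K t r' - K r t' + K r r') * (i == j)%:R.
Proof.
have N1 (x y : 'rV[R]_d) : ((- x) *m y^T) 0 0 = - (x *m y^T) 0 0 by rewrite mulNmx mxE.
have N2 (x y : 'rV[R]_d) : (x *m (- y)^T) 0 0 = - (x *m y^T) 0 0 by rewrite linearN/= mulmxN mxE.
rewrite /bform !big_cons !big_nil/= !addr0 !(N1, N2) !delta_mx_dot; ring.
Qed.

End linear_families.

(** * Suprema of the paths *)

Lemma within_continuousP (R : realType) (V : normedModType R) (A : set R) (f : R -> V) :
  {within A, continuous f} <->
  forall x, A x -> forall e, 0 < e -> exists2 del, 0 < del &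
    forall y, A y -> `|x - y| < del -> `|f x - f y| <= e.
Proof.
split=> [/subspace_continuousP cf x Ax e e0|h].
  have /cvgrPdist_le /(_ e e0) := cf x Ax.
  move=> /nbhs_ballP[del /= del0 hdel]; exists del => // y Ay xy.
  exact: (hdel y xy Ay).
apply/subspace_continuousP => x Ax; apply/cvgrPdist_le => e e0.
have [del del0 hdel] := h x Ax e e0.
apply/nbhs_ballP; exists del => //= y xy Ay; exact: hdel.
Qed.

Section fbm_maximum.
Context dsp (Omega : measurableType dsp) (R : realType) (P : probability Omega R).
Context (d : nat).

Section maximum.
Context d1 (U : measurableType d1).

Lemma measurable_l1norm (X : U -> 'cV[R]_d) :
  (forall i, measurable_fun setT (fun w => X w i 0)) -> measurable_fun setT (fun w => l1norm (X w)).
Proof. by move=> mX; apply: measurable_sum => i; exact: measurableT_comp. Qed.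

Lemma measurable_bigmaxr (I : Type) (s : seq I) (F : I -> U -> R) :
  (forall i, measurable_fun setT (F i)) ->
  measurable_fun setT (fun w => \big[Num.max/0]_(i <- s) F i w).
Proof.
move=> mF; elim: s => [|i s IH].
  by rewrite (_ : (fun _ => _) = cst 0)//; apply/funext => w; rewrite big_nil.
rewrite (_ : (fun _ => _) = (fun w => Num.max (F i w) (\big[Num.max/0]_(i <- s) F i w))).
  exact: measurable_maxr.
by apply/funext => w; rewrite big_cons.
Qed.

End maximum.

Variables (H T : R) (B : R -> Omega -> 'cV[R]_d).
Hypotheses (T0 : 0 < T).
Hypothesis cgB : centered_gaussian P `[0, +oo[ B (fbm_cov H).
Let q (k : nat) : R := rat01 k.

(** Maximum over the first N points of a countable dense set of [0, t]: measurable, unlike a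
    supremum over all times, and a function of finitely many coordinates. *)
Definition grid_max (t : R) (N : nat) (w : Omega) : R :=
  \big[Num.max/0]_(k < N) l1norm (B (t * q k) w).

Let meas t i : 0 <= t -> measurable_fun setT (fun w => B t w i 0).
Proof.
by move=> t0; have [] := centered_gaussian_coord cgB i (t := t) => //; rewrite /= in_itv/= t0.
Qed.

Lemma measurable_grid_max t N : 0 <= t -> measurable_fun setT (grid_max t N).
Proof.
move=> t0; apply: measurable_bigmaxr => k; apply: measurable_l1norm => i.
by apply: meas; rewrite mulr_ge0//; have /andP[] := @rat01_itv R k.
Qed.

Lemma fbm_cov_scale a b : 0 <= a -> 0 <= b ->
  fbm_cov H (T * a) (T * b) = (T `^ H) ^+ 2 * fbm_cov H a b.
Proof.
move=> a0 b0; rewrite /fbm_cov -mulrBr normrM (gtr0_norm T0) !powRM// ?ltW//.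
by rewrite -powR_mulrn ?powR_ge0// -powRrM (mulrC H); ring.
Qed.

(** Self-similarity at finitely many times: B_(T q) and T^H B_q have the same covariances, and the
    maximum is a measurable function [Phi] of the coordinates. *)
Lemma grid_max_same_law N (A : set R) : measurable A ->
  P (grid_max T N @^-1` A) = P ((fun w => T `^ H * grid_max 1 N w) @^-1` A).
Proof.
move=> mA.
pose J : finType := ('I_N * 'I_d)%type.
pose s (j : J) : seq (R * 'rV[R]_d) := [:: (T * q j.1, delta_mx 0 j.2)].
pose s' (j : J) : seq (R * 'rV[R]_d) := [:: (1 * q j.1, T `^ H *: delta_mx 0 j.2)].
pose Phi (f : J -> R) : R := \big[Num.max/0]_(k < N) \sum_(i < d) `|f (k, i)|.
have q0 k : 0 <= q k by have /andP[] := @rat01_itv R k.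
have sD j p : p \in s j -> `[0, +oo[%classic p.1.
  by rewrite inE => /eqP -> /=; rewrite in_itv/= andbT mulr_ge0// ltW.
have s'D j p : p \in s' j -> `[0, +oo[%classic p.1.
  by rewrite inE => /eqP -> /=; rewrite in_itv/= andbT mul1r.
have e j k : bform (fbm_cov H) (s j) (s k) = bform (fbm_cov H) (s' j) (s' k).
  rewrite /bform !big_seq1/= fbm_cov_scale// !mul1r linearZ/= -scalemxAl -scalemxAr !mxE.
  ring.
have mPhi : sigma_of setT (fun j (f : J -> R) => f j) (Phi @^-1` A).
  apply: sigma_of_preimage => //; apply: measurable_bigmaxr => k; apply: measurable_sum => i.
  apply: measurableT_comp => //.
  exact: (@sigma_of_measurable R J setT (J -> R) (fun j f => f j) (k, i)).
have := centered_gaussian_same_law cgB cgB sD s'D e mPhi.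
have -> : [set w | (Phi @^-1` A) (fun j => lincomb B (s j) w)] = grid_max T N @^-1` A.
  apply/funext => w /=; congr A; rewrite /Phi /grid_max; apply: eq_bigr => k _.
  by apply: eq_bigr => i _; rewrite lincomb1.
move=> ->.
suff -> : [set w | (Phi @^-1` A) (fun j => lincomb B (s' j) w)] =
  (fun w => T `^ H * grid_max 1 N w) @^-1` A by [].
apply/funext => w /=; congr A; rewrite /Phi /grid_max.
rewrite (@big_morph _ _ (fun x => T `^ H * x) 0 Num.max 0 Num.max) ?mulr0//; last first.
  by move=> x y; rewrite maxr_pMr ?powR_ge0.
apply: eq_bigr => k _; rewrite /l1norm mulr_sumr; apply: eq_bigr => i _.
by rewrite /lincomb big_seq1/= -scalemxAl mxE mulmx_deltaE normrM ger0_norm ?powR_ge0.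
Qed.

Lemma grid_max_ge0 t N w : 0 <= grid_max t N w.
Proof.
rewrite /grid_max; elim/big_ind : _ => // [x y x0 y0|k _]; first by rewrite le_max x0.
exact: l1norm_ge0.
Qed.

(** The factor compares the two norms; [d.+1] instead of [d] keeps it invertible. *)
Lemma grid_max1_le N w : ((d.+1%:R^-1 * grid_max 1 N w)%:E <=
  ereal_sup [set (enorm (B s w))%:E | s in `[0%R, 1%R]])%E.
Proof.
have h s : 0 <= s <= 1 -> ((enorm (B s w))%:E <=
    ereal_sup [set (enorm (B s w))%:E | s in `[0%R, 1%R]])%E.
  by move=> s01; apply: ereal_sup_ubound; exists s => //=; rewrite in_itv.
rewrite /grid_max; elim/big_ind : _ => [|x y hx hy|k _].
- by rewrite mulr0; apply: le_trans (h 0 _); rewrite ?lexx ?ler01// lee_fin sqrtr_ge0.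
- by rewrite maxEle; case: ifP.
- apply: le_trans (h (q k) (rat01_itv k)); rewrite mul1r lee_fin ler_pdivrMl// mulrC.
  rewrite mulrC; apply: le_trans (l1norm_le_enorm _) _.
  by apply: ler_wpM2r; [exact: sqrtr_ge0|rewrite ler_nat].
Qed.

Lemma integral_grid_max_le N :
  (\int[P]_w (grid_max T N w)%:E <= (T `^ H * d.+1%:R)%:E *
     \int[P]_w ereal_sup [set (enorm (B s w))%:E | s in `[0%R, 1%R]])%E.
Proof.
pose c : R := T `^ H * d.+1%:R.
have c0 : 0 <= c by rewrite mulr_ge0// powR_ge0.
have m1 := @measurable_grid_max 1 N ler01.
rewrite (ge0_integral_same_law (g := fun w => T `^ H * grid_max 1 N w)); first last.
- exact: grid_max_same_law.
- by move=> w; rewrite mulr_ge0 ?powR_ge0 ?grid_max_ge0.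
- by move=> w; rewrite grid_max_ge0.
- by apply: measurable_funM.
- by apply: measurable_grid_max; exact: ltW.
rewrite (_ : (fun w => _) = (fun w => c%:E * (d.+1%:R^-1 * grid_max 1 N w)%:E))%E; last first.
  apply/funext => w; rewrite -EFinM; congr EFin; rewrite /c mulrA; congr (_ * _).
  by rewrite -mulrA divff ?mulr1// pnatr_eq0.
rewrite ge0_integralZl//; last 2 first.
- by apply/measurable_EFinP; apply: measurable_funM.
- by move=> w _; rewrite lee_fin mulr_ge0 ?grid_max_ge0.
rewrite lee_wpmul2l ?lee_fin//; apply: ge0_le_integral_nonmeasurable.
- by move=> w; rewrite lee_fin mulr_ge0 ?grid_max_ge0.
- exact: grid_max1_le.
Qed.

(** Off a null set this dominates the whole path on [0, T]. *)
Definition path_sup (w : Omega) : \bar R := limn (fun N => (grid_max T N w)%:E).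

Lemma nondecreasing_grid_max t w : nondecreasing_seq (grid_max t ^~ w).
Proof.
move=> N M NM; apply: bigmax_le => [|k _]; first exact: grid_max_ge0.
exact: (le_bigmax _ (fun k : 'I_M => l1norm (B (t * q k) w)) (widen_ord NM k)).
Qed.

Lemma grid_max_le_path_sup N w : ((grid_max T N w)%:E <= path_sup w)%E.
Proof.
have nd : nondecreasing_seq (fun N => (grid_max T N w)%:E).
  by move=> i j ij; rewrite lee_fin; exact: nondecreasing_grid_max.
rewrite /path_sup (cvg_lim _ (ereal_nondecreasing_cvgn nd))//.
by apply: ereal_sup_ubound; exists N.
Qed.

Lemma path_sup_ge0 w : (0 <= path_sup w)%E.
Proof. by apply: le_trans (grid_max_le_path_sup 0 w); rewrite lee_fin grid_max_ge0. Qed.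

Lemma measurable_path_sup : measurable_fun setT path_sup.
Proof.
apply: (emeasurable_fun_cvg (fun N w => (grid_max T N w)%:E)).
  by move=> N; apply/measurable_EFinP; apply: measurable_grid_max; exact: ltW.
move=> w _; apply: ereal_nondecreasing_is_cvgn => i j ij.
by rewrite lee_fin; exact: nondecreasing_grid_max.
Qed.

Lemma integral_path_sup_le :
  (\int[P]_w path_sup w <= (T `^ H * d.+1%:R)%:E *
     \int[P]_w ereal_sup [set (enorm (B s w))%:E | s in `[0%R, 1%R]])%E.
Proof.
rewrite /path_sup monotone_convergence//.
- apply: lime_le.
    apply: ereal_nondecreasing_is_cvgn => i j ij; apply: ge0_le_integral => //.
    + by move=> w _; rewrite lee_fin grid_max_ge0.
    + by apply/measurable_EFinP; apply: measurable_grid_max; exact: ltW.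
    + by apply/measurable_EFinP; apply: measurable_grid_max; exact: ltW.
    + by move=> w _; rewrite lee_fin; exact: nondecreasing_grid_max.
  by apply: nearW => N; exact: integral_grid_max_le.
- by move=> N; apply/measurable_EFinP; apply: measurable_grid_max; exact: ltW.
- by move=> N w _; rewrite lee_fin grid_max_ge0.
- by move=> w _ i j ij; rewrite lee_fin; exact: nondecreasing_grid_max.
Qed.

(** By continuity, B_t is within e of its value at some time T q_k, which is one of the points of
    the maxima. *)
Lemma path_sup_ge w t : {within `[0, +oo[, continuous (B ^~ w)} -> 0 <= t <= T ->
  (`|B t w|%:E <= path_sup w)%E.
Proof.
move=> cB t0T.
have [-> //|] := eqVneq (path_sup w) +oo%E; first exact: leey.
rewrite -ltey => psfin.
have psf : (path_sup w \is a fin_num)%E by rewrite ge0_fin_numE// path_sup_ge0.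
rewrite -(fineK psf) lee_fin; apply/ler_addgt0Pr => e e0.
have /andP[t0 tT] := t0T.
have /within_continuousP /(_ t) := cB.
rewrite /= in_itv/= t0 => /(_ erefl e e0)[del del0 hdel].
have [k hk] : exists k, `|t / T - q k| < del / T.
  apply: rat01_dense; last exact: divr_gt0.
  by apply/andP; split; [exact: divr_ge0 (ltW T0)|rewrite ler_pdivrMr ?mul1r].
have /andP[q0 q1] := @rat01_itv R k.
have Tq0 : 0 <= T * q k by rewrite mulr_ge0// ltW.
have : `|B t w - B (T * q k) w| <= e.
  apply: hdel; first by rewrite in_itv/= andbT.
  have -> : t - T * q k = (t / T - q k) * T by field; rewrite gt_eqF.
  by rewrite normrM (gtr0_norm T0) -ltr_pdivlMr.
move=> hB.
have hq : `|B (T * q k) w| <= fine (path_sup w).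
  rewrite -lee_fin fineK//; apply: le_trans (grid_max_le_path_sup k.+1 w).
  rewrite lee_fin; apply: le_trans (norm_le_l1norm _) _.
  exact: (le_bigmax _ (fun k : 'I_k.+1 => l1norm (B (T * q k) w)) ord_max).
rewrite -[B t w](subrK (B (T * q k) w)); apply: le_trans (ler_normD _ _) _.
by rewrite addrC lerD.
Qed.

End fbm_maximum.

(** * The mixed process *)

Section measurable_limits.
Context dsp (Omega : measurableType dsp) (R : realType).

(** The Cauchy criterion with countable quantifiers, so that the set of convergence of measurable
    functions is measurable. *)
Lemma cvgn_cauchyP (S : nat -> R) : cvgn S <->
  forall k : nat, exists N, forall m, `|S (N + m)%N - S N| <= k.+1%:R^-1.
Proof.
split=> [cS k|h].
  have k0 : 0 < (k.+1%:R^-1 / 2 : R) by rewrite divr_gt0.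
  have /cvgrPdist_le /(_ _ k0)[N _ hN] := cS.
  exists N => m; have := hN N (leqnn N); have := hN (N + m)%N (leq_addr m N).
  rewrite /= => h1 h2.
  rewrite (_ : S (N + m)%N - S N = (limn S - S N) - (limn S - S (N + m)%N)); last by ring.
  by apply: le_trans (ler_normB _ _) _; move: (k.+1%:R^-1) h1 h2 => a h1 h2; lra.
apply/cauchy_cvgP; apply: cauchy_exP => e e0.
have [k _ hk] := near_infty_natSinv_lt (PosNum e0).
have [N hN] := h k; exists (S N).
exists N => // n /= Nn; rewrite -ball_normE/= distrC -(subnKC Nn).
by apply: le_lt_trans (hN _) _; exact: (hk k (leqnn k)).
Qed.

Lemma measurable_cvgn (S : nat -> Omega -> R) : (forall n, measurable_fun setT (S n)) ->
  measurable [set w | cvgn (S ^~ w)].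
Proof.
move=> mS.
rewrite (_ : [set w | cvgn (S ^~ w)] = \bigcap_k \bigcup_N \bigcap_m
    [set w | `|S (N + m)%N w - S N w| <= k.+1%:R^-1]).
  apply: bigcapT_measurable => k; apply: bigcup_measurable => N _.
  apply: bigcapT_measurable => m; rewrite -[X in measurable X]setTI.
  apply: measurable_fun_le => //; apply: measurableT_comp => //.
  exact: measurable_funB.
apply/seteqP; split=> w /=.
  by move=> /cvgn_cauchyP h k _; have [N hN] := h k; exists N => // m _; exact: hN.
by move=> h; apply/cvgn_cauchyP => k; have [N _ hN] := h k I; exists N => m; exact: hN.
Qed.

(** Off the set of convergence [limn] is the default value [point]. That set, defined by all the
    coordinates together, is measurable, so the limit is the limit of measurable functions [g n]
    that are constant off it. *)
Lemma measurable_limn_series_cV d (u : nat -> Omega -> 'cV[R]_d) :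
  (forall n i, measurable_fun setT (fun w => u n w i 0)) ->
  forall i, measurable_fun setT (fun w => limn (series (u ^~ w)) i 0).
Proof.
move=> mu i.
pose C := [set w | cvgn (series (u ^~ w))].
have mseries j n : measurable_fun setT (fun w => series (fun n => u n w j 0) n).
  by apply: measurable_sum => m; exact: mu.
have mC : measurable C.
  rewrite (_ : C = \bigcap_(j in [set: 'I_d]) [set w | cvgn (series (fun n => u n w j 0))]).
    by apply: fin_bigcap_measurable => // j _; apply: measurable_cvgn => n; exact: mseries.
  apply/seteqP; split=> w /=; first by move=> /cvgn_series_coord h j _; exact: h.
  by move=> h; apply/cvgn_series_coord => j; exact: (h j I).
pose g n w : R := if w \in C then series (fun n => u n w i 0) n else (point : 'cV[R]_d) i 0.
apply: (@measurable_fun_cvg _ _ _ _ g) => [n|w _].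
  apply: measurable_fun_ifT; [|exact: mseries|exact: measurable_cst].
  apply: (measurable_fun_bool true).
  rewrite setTI (_ : _ @^-1` _ = C)//; apply/seteqP; split=> w /=; first by move=> /set_mem.
  by move=> Cw; apply/mem_set.
rewrite /g; have [/set_mem Cw|/negP Cw] := boolP (w \in C); last first.
  rewrite (_ : limn _ = point); first exact: cvg_cst.
  by apply: dvgP => h; apply: Cw; exact/mem_set.
by rewrite limn_series_coord//; exact: ((cvgn_series_coord _).1 Cw i).
Qed.

End measurable_limits.

Section dominated_series.
Context {R : realType} {d : nat}.
Variables (u : nat -> 'cV[R]_d) (M : nat -> R).
Hypotheses (uM : forall n, `|u n| <= M n) (cM : cvgn (series M)).

Let uM_coord i n : `|u n i 0| <= M n.
Proof. exact: le_trans (norm_coord_le _ _) (uM n). Qed.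

Lemma cvgn_series_dominated : cvgn (series u).
Proof.
apply/cvgn_series_coord => i; apply: normed_cvg.
apply: (series_le_cvg _ _ _ cM) => n; [exact: normr_ge0| |exact: uM_coord].
exact: le_trans (normr_ge0 _) (uM n).
Qed.

(** The estimate of the Weierstrass test: the bound depends on the majorant alone, hence is uniform
    over all times sharing it. *)
Lemma norm_series_tail_le N : `|limn (series u) - series u N| <= limn (series M) - series M N.
Proof.
have M0 n : 0 <= M n by exact: le_trans (normr_ge0 _) (uM n).
have tail : 0 <= limn (series M) - series M N.
  rewrite subr_ge0; apply: nondecreasing_cvgn_le => //.
  by apply/nondecreasing_seqP => n; rewrite seriesSr lerDl.
rewrite -[leLHS]/(mx_norm _) mx_normrE; apply: bigmax_le => //= -[i j] _ /=.
rewrite ord1 !mxE.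
have cu := cvgn_series_dominated.
have h : `|series u n i 0 - series u N i 0| @[n --> \oo] --> `|limn (series u) i 0 - series u N i 0|.
  apply: cvg_norm; apply: cvgB; last exact: cvg_cst.
  exact: cvg_coord.
have h' : series M n - series M N @[n --> \oo] --> limn (series M) - series M N.
  by apply: cvgB; [exact: cM|exact: cvg_cst].
apply: (ler_cvg_to h h'); near=> n.
have Nn : (N <= n)%N by near: n; exact: nbhs_infty_ge.
rewrite !seriesE_coord !sub_series_geq//.
by apply: le_trans (ler_norm_sum _ _ _) _; apply: ler_sum => k _; exact: uM_coord.
Unshelve. all: by end_near. Qed.

End dominated_series.

Lemma cvg_sum_seq (R : realType) (I : eqType) (r : seq I) (u : I -> nat -> R) (l : I -> R) :
  (forall i, i \in r -> u i n @[n --> \oo] --> l i) ->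
  \sum_(i <- r) u i n @[n --> \oo] --> \sum_(i <- r) l i.
Proof.
elim: r => [|i r IH] h.
  rewrite big_nil (_ : (fun n => _) = cst 0); first exact: cvg_cst.
  by apply/funext => n; rewrite big_nil.
rewrite big_cons; under eq_fun do rewrite big_cons.
apply: cvgD; first by apply: h; rewrite mem_head.
by apply: IH => j jr; apply: h; rewrite in_cons jr orbT.
Qed.

Lemma measurable_linear_form dsp (U : measurableType dsp) (R : realType) d
    (X : R -> U -> 'cV[R]_d) (s : seq (R * 'rV[R]_d)) :
  (forall p i, p \in s -> measurable_fun setT (fun w => X p.1 w i 0)) ->
  measurable_fun setT (fun w => \sum_(p <- s) (p.2 *m X p.1 w) 0 0).
Proof.
(* The conditional makes every summand measurable, also for the pairs outside [s], about which
   nothing is assumed. *)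
move=> mX; rewrite (_ : (fun w => _) =
    fun w => \sum_(p <- s) if p \in s then \sum_i p.2 0 i * X p.1 w i 0 else 0).
  apply: measurable_sum => p; case: (boolP (p \in s)) => ps /=; last exact: measurable_cst.
  by apply: measurable_sum => i; apply: measurable_funM => //; exact: mX.
apply/funext => w; rewrite big_seq big_mkcond/=; apply: eq_bigr => p _.
by case: ifP => // _; rewrite mulmxE00.
Qed.

(** A mean of cosines is at most 1, so e^(-v/2) <= 1. *)
Lemma gaussian_cf_ge0 dsp (Omega : measurableType dsp) (R : realType) (P : probability Omega R)
  (Y : Omega -> R) v : gaussian_cf P Y 0 v -> 0 <= v.
Proof.
move=> [mY /(_ 1 0)]; rewrite mulr0 addr0 cos0 mul1r => h.
have : expR (- (1 ^+ 2 * v) / 2) <= 1.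
  rewrite -h -[leRHS](Rintegral_cst_prob P 1); apply: le_Rintegral => //.
  - apply: (@bounded_integrable _ _ _ _ 1); first by apply: measurable_fun_cos; apply: measurable_funD => //; exact: measurable_funM.
    by move=> w; exact: norm_cos_le1.
  - by apply: (@bounded_integrable _ _ _ _ 1) => // w; rewrite normr1.
rewrite -[X in _ <= X -> _]expR0 ler_expR => h1.
by lra.
Qed.

Section mixed_process.
Context dsp (Omega : measurableType dsp) (R : realType) (P : probability Omega R).
Variables (T : R) (d : nat) (H lam : nat -> R) (B : nat -> R -> Omega -> 'cV[R]_d).
Hypothesis T0 : 0 < T.
Hypothesis H01 : forall n, 0 < H n < 2^-1.
Hypothesis lam1 : cvgn (series (fun n => `|lam n|)).
Hypothesis cgB : forall n, centered_gaussian P `[0, +oo[ (B n) (fbm_cov (H n)).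
Hypothesis ctB : forall n, {ae P, forall w, {within `[0, +oo[, continuous (B n ^~ w)}}.
Hypothesis supB : (\sum_(0 <= n <oo) (`|lam n|%:E *
     \int[P]_w ereal_sup [set (enorm (B n s w))%:E | s in `[0%R, 1%R]]) < +oo)%E.
Hypothesis indB : independent P setT (fun n => sigma_process `[0, +oo[ (B n)).

Let wsup n (w : Omega) : \bar R := (`|lam n|%:E * path_sup T (B n) w)%E.

Let wsup_ge0 n w : (0 <= wsup n w)%E.
Proof. by rewrite mule_ge0// path_sup_ge0. Qed.

Let measurable_wsup n : measurable_fun setT (wsup n).
Proof. by apply: measurable_funeM; exact: measurable_path_sup (cgB n). Qed.

(** The self-similarity factors T^(H_n) are at most 1 + T, uniformly in n, so the sum of the
    weighted suprema has a finite mean. *)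
Let ae_summable_sup : {ae P, forall w, (\sum_(0 <= n <oo) wsup n w < +oo)%E}.
Proof.
pose S w := (\sum_(0 <= n <oo) wsup n w)%E.
have S0 w : (0 <= S w)%E by apply: nneseries_ge0 => n _ _; exact: wsup_ge0.
have mS : measurable_fun setT S by apply: ge0_emeasurable_sum => n; [move=> w _ _; exact: wsup_ge0|].
pose J n := (\int[P]_w ereal_sup [set (enorm (B n s w))%:E | s in `[0%R, 1%R]])%E.
have J0 n : (0 <= J n)%E.
  apply: integral_ge0 => w _; apply: le_trans (_ : ((enorm (B n 0 w))%:E <= _)%E).
    by rewrite lee_fin sqrtr_ge0.
  by apply: ereal_sup_ubound; exists 0; rewrite //= in_itv/= lexx ler01.
have bound n : (\int[P]_w wsup n w <= ((1 + T) * d.+1%:R)%:E * (`|lam n|%:E * J n))%E.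
  rewrite ge0_integralZl//; last 2 first.
  - exact: measurable_path_sup (cgB n).
  - by move=> w _; exact: path_sup_ge0.
  rewrite muleCA; apply: lee_wpmul2l => //.
  apply: le_trans (integral_path_sup_le T0 (cgB n)) _.
  apply: lee_wpmul2r; first exact: J0.
  rewrite lee_fin ler_wpM2r//; apply: powR_le1D; last exact: ltW.
  by have := H01 n; lra.
have iS : (\int[P]_w S w < +oo)%E.
  rewrite integral_nneseries//.
  apply: le_lt_trans (_ : (((1 + T) * d.+1%:R)%:E * (\sum_(0 <= n <oo) (`|lam n|%:E * J n)) < +oo)%E).
    rewrite -nneseriesZl//; last by move=> n _; rewrite mule_ge0.
    apply: lee_nneseries => n _ //.
    by move=> _; apply: integral_ge0 => w _; exact: wsup_ge0.
  by rewrite lte_mul_pinfty// lee_fin mulr_ge0// addr_ge0// ltW.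
have : P.-integrable setT S.
  by apply/integrableP; split=> //; under eq_integral do rewrite gee0_abs//.
move=> /(integrable_ae measurableT); apply: filterS => w /(_ I).
by rewrite ge0_fin_numE.
Qed.

Lemma ae_good : {ae P, forall w, (forall n, {within `[0, +oo[, continuous (B n ^~ w)}) /\
  exists M : nat -> R, cvgn (series M) /\
    forall n t, 0 <= t <= T -> `|lam n *: B n t w| <= M n}.
Proof.
have : {ae P, forall w, forall n, {within `[0, +oo[, continuous (B n ^~ w)}} by exact: ae_foralln.
move: ae_summable_sup; apply: filterS2 => w Sw cw; split=> //.
have fin n : wsup n w \is a fin_num.
  rewrite ge0_fin_numE//; apply: le_lt_trans Sw.
  have := @nneseries_lim_ge R (wsup ^~ w) xpredT 0 n.+1 (fun n _ _ => wsup_ge0 n w).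
  rewrite big_nat_recr//=; apply: le_trans; rewrite leeDr//.
  by apply: sume_ge0 => k _; exact: wsup_ge0.
exists (fun n => fine (wsup n w)); split.
  apply: nondecreasing_is_cvgn.
    by apply/nondecreasing_seqP => n; rewrite seriesSr lerDl fine_ge0.
  exists (fine (\sum_(0 <= n <oo) wsup n w)) => _ [N _ <-].
  rewrite -lee_fin fineK; last first.
    by rewrite ge0_fin_numE//; apply: nneseries_ge0 => n _ _; exact: wsup_ge0.
  rewrite /series/= -sumEFin; under eq_bigr do rewrite fineK//.
  exact: (@nneseries_lim_ge R (wsup ^~ w) xpredT 0 N (fun n _ _ => wsup_ge0 n w)).
move=> n t t0T; rewrite -lee_fin fineK// normrZ EFinM; apply: lee_wpmul2l => //.
exact: path_sup_ge.
Qed.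

Let BH := series_process lam B.

Lemma ae_cvgn_series : {ae P, forall w, forall t, 0 <= t <= T ->
  cvgn (series (fun n => lam n *: B n t w))}.
Proof.
move: ae_good; apply: filterS => w [_ [M [cM hM]]] t t0T.
by apply: cvgn_series_dominated cM => n; exact: hM.
Qed.

Lemma series_process_continuous : {ae P, forall w, {within `[0, T], continuous (BH ^~ w)}}.
Proof.
move: ae_good; apply: filterS => w [cB [M [cM hM]]].
apply/within_continuousP => t; rewrite /= in_itv/= => t0T e e0.
have [N hN] : exists N, limn (series M) - series M N <= e / 3.
  have /cvgrPdist_le /(_ (e / 3)) [|N _ hN] := cM; first by rewrite divr_gt0.
  by exists N; apply: le_trans (ler_norm _) (hN N (leqnn N)).
have cS : {within `[0, T], continuous (fun s => series (fun n => lam n *: B n s w) N)}.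
  apply/subspace_continuousP => s sT; elim: (N) => [|k IH].
    rewrite (_ : (fun s => _) = fun=> 0); last by apply/funext => r; rewrite seriesEnat/= big_geq.
    exact: cvg_cst.
  rewrite (_ : (fun s => _) = (fun s => series (fun n => lam n *: B n s w) k + lam k *: B k s w)); last first.
    by apply/funext => r; rewrite seriesSr.
  apply: cvgD; first exact: IH.
  apply: cvgZr.
  have /subspace_continuousP : {within `[0, T], continuous (B k ^~ w)}.
    by apply: continuous_subspaceW (cB k) => x; rewrite /= !in_itv/= andbT => /andP[].
  exact.
move/within_continuousP : cS => /(_ t); rewrite /= in_itv/= => /(_ t0T (e / 3)) [|del del0 hdel].
  by rewrite divr_gt0.
exists del => // s; rewrite in_itv/= => s0T ts.
have := norm_series_tail_le (fun n => hM n t t0T) cM N.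
have := norm_series_tail_le (fun n => hM n s s0T) cM N.
have := hdel s; rewrite in_itv/= => /(_ s0T ts).
rewrite -/(series_process lam B t w) -/(series_process lam B s w) -/BH.
set a := series _ N; set b := series _ N => h1 h2 h3.
rewrite (_ : BH t w - BH s w = (BH t w - a) + (a - b) - (BH s w - b)); last first.
  by rewrite addrA subrK opprB addrA subrK.
apply: le_trans (ler_normB _ _) _; apply: le_trans (lerD (ler_normD _ _) (lexx _)) _.
lra.
Qed.

Lemma measurable_series_process t i : 0 <= t -> measurable_fun setT (fun w => BH t w i 0).
Proof.
move=> t0; apply: measurable_limn_series_cV => n j.
under eq_fun do rewrite mxE.
apply: measurable_funM => //.
by have [] := centered_gaussian_coord (@cgB n) j (t := t) => //; rewrite /= in_itv/= t0.
Qed.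

(** A fixed functional of the partial sums is a sum of independent centered normal variables; it
    converges almost surely, its variances converge, and the means of cosines pass to the limit. *)
Lemma series_process_centered_gaussian : centered_gaussian P `[0, T] BH (mixed_cov H lam).
Proof.
move=> s sT.
have sT' p : p \in s -> 0 <= p.1 <= T by move=> /sT; rewrite /= in_itv.
have sD p : p \in s -> `[0, +oo[%classic p.1.
  by move=> /sT'; rewrite /= in_itv/= andbT => /andP[].
pose X n w := lam n * lincomb (B n) s w.
pose v n := lam n ^+ 2 * qform (fbm_cov (H n)) s.
apply: (@gaussian_cf_cvg _ _ _ _ (fun N w => \sum_(n < N) X n w) _ (fun N => \sum_(n < N) v n)).
- move=> N; apply: (independent_gaussian_cf_sum indB) => // [n _|n _|n _ C mC].
  + apply: sigma_of_sub => -[t i] [/= tD _]; have [] := centered_gaussian_coord (@cgB n) i tD.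
    by [].
  + by have := gaussian_cfZ (lam n) (@cgB n s sD); rewrite mulr0.
  + apply: sigma_of_preimage mC; apply: measurable_funM => //.
    apply: measurable_linear_form => p i ps.
    exact: (@sigma_of_measurable R (R * 'I_d)%type (`[0, +oo[ `*` setT) Omega (fun j w => B n j.1 w j.2 0) (p.1, i) (conj (sD p ps) I)).
- apply: measurable_linear_form => p i ps.
  by apply: measurable_series_process; case/andP : (sT' p ps).
- move: ae_cvgn_series; apply: filterS => w cw.
  have -> : (fun N => \sum_(n < N) X n w) =
      (fun N => \sum_(p <- s) (p.2 *m series (fun n => lam n *: B n p.1 w) N) 0 0).
    apply/funext => N; rewrite /X; under eq_bigr do rewrite mulr_sumr.
    rewrite exchange_big/=; apply: eq_bigr => p _.
    rewrite seriesEord mulmx_sumr summxE; apply: eq_bigr => n _.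
    by rewrite -scalemxAr [RHS]mxE.
  rewrite /lincomb; apply: cvg_sum_seq => p ps.
  under eq_fun do rewrite mulmxE00; rewrite mulmxE00.
  apply: cvg_sum_seq => i _; apply: cvgMr; apply: cvg_coord.
  exact: cw (sT' p ps).
- have -> : (fun N => \sum_(n < N) v n) = (fun N => \sum_(p <- s) \sum_(q <- s)
      series (fun n => lam n ^+ 2 * fbm_cov (H n) p.1 q.1) N * (p.2 *m q.2^T) 0 0).
    apply/funext => N; rewrite /v /qform; under eq_bigr do rewrite mulr_sumr.
    rewrite exchange_big/=; apply: eq_bigr => p _.
    under eq_bigr do rewrite mulr_sumr.
    rewrite exchange_big/=; apply: eq_bigr => q _.
    by rewrite seriesEord mulr_suml; apply: eq_bigr => n _; rewrite mulrA.
  rewrite /qform; apply: cvg_sum_seq => p ps; apply: cvg_sum_seq => q qs; apply: cvgMl.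
  have /andP[p0 _] := sT' p ps; have /andP[q0 _] := sT' q qs.
  by rewrite /mixed_cov; apply/cvg_ex; eexists; exact: cvg_series_mixed_cov.
Qed.

End mixed_process.

(** * Stationary increments and Hoelder continuity *)

Lemma cvg_powR0 (R : realType) (a : R) (t : nat -> R) : 0 < a -> (forall n, 0 <= t n) ->
  t n @[n --> \oo] --> 0 -> t n `^ a @[n --> \oo] --> 0.
Proof.
move=> a0 t0 ct; apply/cvgrPdist_le => e e0.
have := ct; move/cvgrPdist_le => /(_ (e `^ a^-1)) [|N _ hN]; first exact: powR_gt0.
exists N => // n Nn; have := hN n Nn; rewrite /= !sub0r !normrN !ger0_norm ?powR_ge0// => h.
have : t n `^ a <= (e `^ a^-1) `^ a by apply: ge0_ler_powR; rewrite ?nnegrE// ltW// powR_gt0.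
by rewrite -powRrM mulVf ?gt_eqF// powRr1// ltW.
Qed.

Section gaussian_increments.
Context dsp (Omega : measurableType dsp) (R : realType) (P : probability Omega R).
Variables (T : R) (d : nat) (X : R -> Omega -> 'cV[R]_d) (K : R -> R -> R) (v : R -> R).
Hypothesis T0 : 0 < T.
Hypothesis cgX : centered_gaussian P `[0, T] X K.
Hypothesis KE : forall t s, 0 <= t -> 0 <= s -> K t s = 2^-1 * (v s + v t - v `|t - s|).
Hypothesis v0 : v 0 = 0.

(** The terms depending on a single time cancel, and only time differences remain: the source of
    stationarity. *)
Lemma bform_stationary (t r : R) (i : 'I_d) (t' r' : R) (j : 'I_d) : 0 <= t -> 0 <= r -> 0 <= t' -> 0 <= r' ->
  bform K (increment t r i) (increment t' r' j) =
  2^-1 * (v `|t - r'| + v `|r - t'| - v `|t - t'| - v `|r - r'|) * (i == j)%:R.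
Proof. by move=> *; rewrite bform_increment !KE//; congr (_ * _); ring. Qed.

Lemma mem_increment (t r : R) (i : 'I_d) p : 0 <= t <= T -> 0 <= r <= T ->
  p \in increment t r i -> `[0, T]%classic p.1.
Proof. by move=> tT rT; rewrite !inE => /orP[] /eqP -> /=; rewrite in_itv. Qed.

Lemma increment_cf (t r : R) (i : 'I_d) : 0 <= t <= T -> 0 <= r <= T ->
  gaussian_cf P (fun w => X t w i 0 - X r w i 0) 0 (v `|t - r|).
Proof.
move=> tT rT; have /andP[t0 _] := tT; have /andP[r0 _] := rT.
have := centered_gaussian_lincomb cgX (fun p => @mem_increment t r i p tT rT).
rewrite bform_stationary// eqxx mulr1 !subrr normr0 v0 !subr0 (distrC r t).
rewrite (_ : lincomb X _ = fun w => X t w i 0 - X r w i 0); last first.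
  by apply/funext => w; rewrite lincomb_increment.
by rewrite (_ : 2^-1 * _ = v `|t - r|)//; field.
Qed.

Lemma gaussian_stationary_increments : stationary_increments P T X.
Proof.
move=> k t h h0 th A mA.
have hT j : [/\ 0 <= t j <= T, 0 <= t j + h <= T & 0 <= h <= T].
  by have [t0 ht] := th j; split; apply/andP; split => //; lra.
pose J : finType := ('I_k * 'I_d)%type.
pose s (j : J) := increment (t j.1 + h) h j.2.
pose s' (j : J) := increment (t j.1) 0 j.2.
have Z0 : (0 : R) <= 0 <= T by rewrite lexx ltW.
have sD j p : p \in s j -> `[0, T]%classic p.1.
  by have [? ? ?] := hT j.1; exact: mem_increment.
have s'D j p : p \in s' j -> `[0, T]%classic p.1.
  by have [? ? ?] := hT j.1; exact: mem_increment.
have e j l : bform K (s j) (s l) = bform K (s' j) (s' l).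
  have [/andP[tj _] /andP[thj _] _] := hT j.1; have [/andP[tl _] /andP[thl _] _] := hT l.1.
  rewrite !bform_stationary//; congr (_ * (_ + _ - _ - _) * _); congr v; congr `| _ |; ring.
have := centered_gaussian_same_law cgX cgX sD s'D e mA.
rewrite (_ : (fun w => A _) = fun w => A ((fun j w => (X (t j.1 + h) w - X h w) j.2 0) ^~ w)); last first.
  by apply/funext => w; congr A; apply/funext => j; rewrite lincomb_increment !mxE.
move=> ->; rewrite (_ : (fun w => A _) = fun w => A ((fun j w => (X (t j.1) w - X 0 w) j.2 0) ^~ w))//.
by apply/funext => w; congr A; apply/funext => j; rewrite lincomb_increment !mxE.
Qed.

Lemma gaussian_cf_uniq (Y : Omega -> R) v1 v2 :
  gaussian_cf P Y 0 v1 -> gaussian_cf P Y 0 v2 -> v1 = v2.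
Proof.
move=> [_ /(_ 1 0) h1] [_ /(_ 1 0)]; rewrite h1 !mulr0 !addr0 cos0 !mul1r !expr1n !mul1r.
by move=> /expR_inj; lra.
Qed.

Variable i0 : 'I_d.

Lemma gaussian_dependent_increments : (forall t s, 0 < t -> 0 < s -> v (t + s) < v t + v s) ->
  ~ independent_increments P `[0, T] X.
Proof.
move=> vsub ind.
(* The two halves of [0, T] suffice: independence would give v(T) = 2 v(T / 2). *)
pose t (j : nat) : R := T / 2 * j%:R.
have tT j : (j <= 2)%N -> 0 <= t j <= T.
  rewrite -(ler_nat R) => j2; rewrite /t; have : (0 : R) <= j%:R by [].
  move: (j%:R) j2 => x x2 x0; have := mulr_ge0 (ltW T0) x0.
  have := mulr_ge0 (ltW T0) (_ : 0 <= 2 - x); rewrite subr_ge0 => /(_ x2).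
  by move=> h1 h2; apply/andP; split; lra.
have tS j : t j.+1 - t j = T / 2 by rewrite /t -natr1; ring.
have {}ind : independent P [set j | (j < 2)%N]
      (fun j => sigma_vec (fun w => X (t j.+1) w - X (t j) w)).
  apply: (ind 2%N t) => j j2; first by rewrite /= in_itv tT.
  by rewrite -subr_ge0 tS divr_ge0// ltW.
pose Z j w := X (t j.+1) w i0 0 - X (t j) w i0 0.
have cfZ j : (j < 2)%N -> gaussian_cf P (Z j) 0 (v (T / 2)).
  move=> j2; have := increment_cf i0 (tT j.+1 j2) (tT j (ltnW j2)).
  by rewrite tS ger0_norm// ltW// divr_gt0.
have coordm (j : nat) i : (j <= 2)%N -> measurable_fun setT (fun w => X (t j) w i 0).
  by move=> j2; have [] := centered_gaussian_coord cgX i (t := t j) => //; rewrite /= in_itv tT.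
have cf2 : gaussian_cf P (fun w => \sum_(j < 2) Z j w) 0 (\sum_(j < 2) v (T / 2)).
  apply: (@independent_gaussian_cf_sum _ _ _ _ _ _ ind _ 2 Z (fun=> v (T / 2))) => // [j j2|j j2 C mC].
  - apply: sigma_of_sub => i _; under eq_fun do rewrite !mxE.
    by apply: measurable_funB; apply: coordm; rewrite // ltnW.
  - apply: sigma_of_preimage mC.
    rewrite (_ : Z j = fun w => (X (t j.+1) w - X (t j) w) i0 0).
      exact: (@sigma_of_measurable R 'I_d setT Omega (fun i w => (X (t j.+1) w - X (t j) w) i 0) i0 I).
    by apply/funext => w; rewrite !mxE.
have cf1 : gaussian_cf P (fun w => \sum_(j < 2) Z j w) 0 (v T).
  have Z0 : (0 : R) <= 0 <= T by rewrite lexx ltW.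
  have TT : 0 <= T <= T by rewrite lexx ltW.
  have := increment_cf i0 TT Z0; rewrite subr0 gtr0_norm//.
  rewrite (_ : (fun w => X T w i0 0 - _) = (fun w => \sum_(j < 2) Z j w))//.
  apply/funext => w; rewrite !big_ord_recr big_ord0/= add0r /Z /t mulr0 mulr1 divfK ?pnatr_eq0//.
  by rewrite addrC subrKA.
have := gaussian_cf_uniq cf1 cf2; rewrite !big_ord_recr big_ord0/= add0r => e.
have := vsub (T / 2) (T / 2); rewrite -e -splitr ltxx => /(_ _ _)/negP.
by have : 0 < T / 2 by [rewrite divr_gt0]; move=> h; apply.
Qed.

Lemma gaussian_not_holder : (forall b, 0 < b -> exists c a, [/\ 0 < c, 0 < a < b &
    forall t, 0 <= t -> c * t `^ a <= v t]) ->
  ~ exists (alpha : R) (Y : R -> Omega -> 'cV[R]_d),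
     [/\ 0 < alpha, is_version P `[0, T] X Y &
         {ae P, forall w, holder_path alpha T (Y ^~ w)}].
Proof.
move=> vslow [alpha [Y [alpha0 XY hY]]].
(* With a < 2 alpha, the quotient t^alpha / sqrt (v t) is bounded by a multiple of t^(alpha - a/2),
   which tends to 0 with t. *)
have [|c [a [c0 /andP[a0 ab] va]]] := vslow (2 * alpha); first by rewrite mulr_gt0.
pose t (k : nat) : R := T / k.+1%:R.
have t0 k : 0 < t k by rewrite divr_gt0.
have tT k : 0 <= t k <= T by rewrite ltW//= ler_pdivrMr//; apply: ler_peMr; [exact: ltW|rewrite ler1n].
have Z0 : (0 : R) <= 0 <= T by rewrite lexx ltW.
have vt0 k : 0 < v (t k) by apply: lt_le_trans (va _ (ltW (t0 k))); rewrite mulr_gt0// powR_gt0.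
pose sg k := Num.sqrt (v (t k)).
have sg0 k : 0 < sg k by rewrite sqrtr_gt0.
pose Z k w := (sg k)^-1 * (X (t k) w i0 0 - X 0 w i0 0).
have cfZ k : gaussian_cf P (Z k) 0 1.
  have := gaussian_cfZ (sg k)^-1 (increment_cf i0 (tT k) Z0).
  rewrite mulr0 subr0 gtr0_norm// exprVn sqr_sqrtr; last exact: ltW.
  by rewrite mulVf// gt_eqF.
have Zto0 : {ae P, forall w, Z k w @[k --> \oo] --> 0}.
  have h0 : {ae P, forall w, Y 0 w = X 0 w} by apply: XY; rewrite /= in_itv/= Z0.
  have ht : {ae P, forall w, forall k, Y (t k) w = X (t k) w}.
    by apply: ae_foralln => k; apply: XY; rewrite /= in_itv/= tT.
  move: hY; apply: filterS3 h0 ht => w Y0 Yt [C hC].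
  have bnd k : `|Z k w| <= (C / Num.sqrt c) * t k `^ (alpha - a / 2).
    rewrite /Z normrM gtr0_norm ?invr_gt0// ler_pdivrMl//.
    have := hC 0 (t k) Z0 (tT k); rewrite subr0 Yt Y0 (gtr0_norm (t0 k)) => h.
    have {h} h : `|X (t k) w i0 0 - X 0 w i0 0| <= C * t k `^ alpha.
      by apply: le_trans h; have := norm_coord_le_enorm (X (t k) w - X 0 w) i0; rewrite !mxE.
    have C0 : 0 <= C.
      by have := le_trans (normr_ge0 _) h; rewrite pmulr_lge0// powR_gt0.
    apply: le_trans h _.
    have sgc : Num.sqrt c * t k `^ (a / 2) <= sg k.
      rewrite -[leLHS]ger0_norm ?mulr_ge0 ?sqrtr_ge0 ?powR_ge0// -sqrtr_sqr ler_wsqrtr//.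
      rewrite exprMn sqr_sqrtr ?(ltW c0)// -powR_mulrn ?powR_ge0// -powRrM divfK ?pnatr_eq0//.
      by apply: va; exact: ltW.
    have e : t k `^ alpha = t k `^ (alpha - a / 2) * t k `^ (a / 2).
      by rewrite -powRD ?subrK// (gt_eqF (t0 k)) implybT.
    rewrite e; have sc : 0 < Num.sqrt c by rewrite sqrtr_gt0.
    rewrite -[C in leLHS](divfK (lt0r_neq0 sc)).
    have : 0 <= C / Num.sqrt c * t k `^ (alpha - a / 2) by rewrite mulr_ge0 ?divr_ge0 ?powR_ge0// ltW.
    move: (C / _) (t k `^ _) (t k `^ _) sgc => A p q sgc A0; nra.
  pose b k := (C / Num.sqrt c) * t k `^ (alpha - a / 2).
  have cb : b k @[k --> \oo] --> 0.
    rewrite -(mulr0 (C / Num.sqrt c)); apply: cvgMr; apply: cvg_powR0; first by lra.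
      by move=> k; exact: ltW.
    by rewrite -(mulr0 T); apply: cvgMr; exact: cvg_harmonic.
  apply: (squeeze_cvgr (f := fun k => - b k) (h := b)) => //.
    by apply: nearW => k; rewrite -ler_norml bnd.
  by rewrite -oppr0; exact: cvgN.
have l1 : \int[P]_w cos (1 * Z k w + 0) @[k --> \oo] --> (1 : R).
  rewrite -[X in _ --> X](Rintegral_cst_prob P 1).
  apply: (@bounded_cvg_Rintegral _ _ _ _ 1).
  - move=> k; apply: measurable_fun_cos; apply: measurable_funD => //.
    by apply: measurable_funM => //; case: (cfZ k).
  - by move=> k w; exact: norm_cos_le1.
  - exact: measurable_cst.
  move: Zto0; apply: filterS => w h; rewrite -[X in _ --> X](cos0 R).
  apply: continuous_cvg; first exact: continuous_cos.
  by under eq_fun do rewrite mul1r addr0.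
have l2 : \int[P]_w cos (1 * Z k w + 0) @[k --> \oo] --> expR (- (1 ^+ 2 * 1) / 2 : R).
  under eq_fun do rewrite (cfZ _).2 mulr0 addr0 cos0 mul1r.
  exact: cvg_cst.
have e : expR 0 = expR (- (1 ^+ 2 * 1) / 2) :> R.
  by rewrite expR0; exact: (cvg_unique (@Rhausdorff R) l1 l2).
by have := expR_inj e; lra.
Qed.

End gaussian_increments.

(** An event of sigma(f) is described by one and the same set of coordinates through any two
    families that extend f. The families will consist of X_s with a residual, and of X_s with the
    opposite residual. *)
Lemma sigma_of_functional (R : realType) (I J U : Type) (D : set I) (f : I -> U -> R) (phi : I -> J)
    (F G : J -> U -> R) :
  (forall i, F (phi i) = f i) -> (forall i, G (phi i) = f i) ->
  forall E, sigma_of D f E -> exists A : set (J -> R),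
    [/\ sigma_of setT (fun j g => g j) A, E = [set w | A (F ^~ w)] & E = [set w | A (G ^~ w)]].
Proof.
move=> Ff Gf; set S : set (set (J -> R)) := sigma_of _ _.
have [S0 SC SU] : sigma_algebra setT S by exact: smallest_sigma_algebra.
apply: smallest_sub.
  split.
  - by exists set0; split=> //.
  - move=> E [A [SA e1 e2]]; exists (setT `\` A); split; first exact: SC.
      by rewrite {1}e1.
    by rewrite {1}e2.
  - move=> E hE; have [A hA] := choice hE.
    exists (\bigcup_n A n); split.
    + by apply: SU => n; have [] := hA n.
    + by apply/seteqP; split=> w /= [n _ h]; exists n => //; have [_ e _] := hA n; move: h; rewrite e.
    + by apply/seteqP; split=> w /= [n _ h]; exists n => //; have [_ _ e] := hA n; move: h; rewrite e.
move=> _ [i Di [C mC <-]]; exists [set g | C (g (phi i))]; split.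
- apply: sub_sigma_algebra; exists (phi i) => //; exists C => //.
  by rewrite setTI.
- by rewrite setTI -Ff.
- by rewrite setTI -Gf.
Qed.

(** * Failure of the Markov property *)

(** The defining property on the events of [G] extends to bounded [G]-measurable factors, because
    [f - g] integrates to 0 over each event of [h]. *)
Lemma cond_expectation_orth dsp (Omega : measurableType dsp) (R : realType) (P : probability Omega R)
    (C : R) (G : set (set Omega)) (f g h : Omega -> R) :
  cond_expectation P G f g -> G `<=` measurable ->
  measurable_fun setT h -> (forall w, `|h w| <= C) -> (forall C, measurable C -> G (h @^-1` C)) ->
  \int[P]_w (h w * f w) = \int[P]_w (h w * g w).
Proof.
move=> [fi gi gG fg] Gm mh hC hG.
have /integrableP[/measurable_EFinP mf _] := fi.
have /integrableP[/measurable_EFinP mg _] := gi.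
have bd k : P.-integrable setT (EFin \o k) -> P.-integrable setT (EFin \o (fun w => h w * k w)).
  move=> ki; have /integrableP[/measurable_EFinP mk ki'] := ki.
  have kC : P.-integrable setT (fun w => `|C|%:E * (k w)%:E)%E by exact: integrableZl.
  apply: le_integrable kC => //; first by apply/measurable_EFinP; exact: measurable_funM.
  move=> w _ /=; rewrite lee_fin !normrM normr_id ler_wpM2r//.
  exact: le_trans (hC w) (ler_norm C).
have fgi : P.-integrable setT (EFin \o (fun w => f w - g w)).
  by rewrite (_ : EFin \o _ = (fun w => (f w)%:E - (g w)%:E)%E)//; exact: integrableB.
have : \int[P]_w (h w * (f w - g w)) = 0.
  apply: Rintegral_orth => //; first exact: bd.
  move=> D mD; have mA := Gm _ (hG D mD).
  rewrite RintegralB//; [|exact: integrableS fi|exact: integrableS gi].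
  by rewrite /Rintegral fg ?subrr//; exact: hG.
under eq_Rintegral do rewrite mulrBr.
rewrite RintegralB//; [|exact: bd|exact: bd].
by move/eqP; rewrite subr_eq0 => /eqP.
Qed.

Section gaussian_markov.
Context dsp (Omega : measurableType dsp) (R : realType) (P : probability Omega R).
Variables (T : R) (d : nat) (X : R -> Omega -> 'cV[R]_d) (K : R -> R -> R) (v : R -> R).
Hypothesis T0 : 0 < T.
Hypothesis cgX : centered_gaussian P `[0, T] X K.
Hypothesis KE : forall t s, 0 <= t -> 0 <= s -> K t s = 2^-1 * (v s + v t - v `|t - s|).
Hypothesis v0 : v 0 = 0.
Hypothesis v_gt0 : forall t, 0 < t -> 0 < v t.
Variable i0 : 'I_d.

Let x t w : R := X t w i0 0.
Let c r s := K r s / v s.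

(** The residual of the regression of [x r] on [x s]. *)
Let res r s w := x r w - c r s * x s w.

Let inD t : 0 <= t <= T -> `[0, T]%classic t.
Proof. by rewrite /= in_itv. Qed.

Let mX t i : 0 <= t <= T -> measurable_fun setT (fun w => X t w i 0).
Proof. by move=> /inD tT; have [] := centered_gaussian_coord cgX i tT. Qed.

Let mres r s : 0 <= r <= T -> 0 <= s <= T -> measurable_fun setT (res r s).
Proof.
by move=> rT sT; apply: measurable_funB; [exact: mX|apply: measurable_funM => //; exact: mX].
Qed.

Let Kdiag t : 0 <= t -> K t t = v t.
Proof. by move=> t0; rewrite KE// subrr normr0 v0; field. Qed.

Let Ksym t s : 0 <= t -> 0 <= s -> K t s = K s t.
Proof. by move=> t0 s0; rewrite !KE// distrC (addrC (v s)). Qed.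

Let measurable_sigma_vec t E : 0 <= t <= T -> sigma_vec (X t) E -> measurable E.
Proof. by move=> tT; apply: sigma_of_sub => i _; exact: mX. Qed.

(** The residual is uncorrelated with all the coordinates of X_s, so changing its sign while keeping
    X_s does not alter the joint law; the sine being odd, the integral equals its opposite. *)
Let res_sin_orth r s a E : 0 <= r <= T -> 0 < s <= T -> sigma_vec (X s) E ->
  \int[P]_w (\1_E w * sin (a * res r s w)) = 0.
Proof.
move=> rT /andP[s0 sT'] sE.
have sT : 0 <= s <= T by rewrite (ltW s0).
have [r0 _] := andP rT.
have mE := measurable_sigma_vec sT sE.
pose J : finType := option 'I_d.
(* The coordinates of X_s, indexed by [Some], together with b times the residual at [None]; b is 1
   or -1. *)
pose S (b : R) (j : J) : seq (R * 'rV[R]_d) :=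
  if j is Some i then [:: (s, delta_mx 0 i)] else [:: (r, b *: delta_mx 0 i0); (s, (- b * c r s) *: delta_mx 0 i0)].
have SD b j p : p \in S b j -> `[0, T]%classic p.1.
  by case: j => [i|]; rewrite !inE; [move=> /eqP ->|move=> /orP[] /eqP ->] => /=; rewrite in_itv.
have Sl b : lincomb X (S b None) = fun w => b * res r s w.
  apply/funext => w; rewrite /lincomb big_cons big_seq1 /= -!scalemxAl [X in X + _]mxE [X in _ + X]mxE.
  by rewrite !mulmx_deltaE /res /x; ring.
have dotl (b : R) (y z : 'rV[R]_d) : ((b *: y) *m z^T) 0 0 = b * (y *m z^T) 0 0.
  by rewrite -scalemxAl mxE.
have dotr (b : R) (y z : 'rV[R]_d) : (y *m (b *: z)^T) 0 0 = b * (y *m z^T) 0 0.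
  by rewrite linearZ/= -scalemxAr mxE.
have vs : v s != 0 by rewrite gt_eqF// v_gt0.
have e j k : bform K (S 1 j) (S 1 k) = bform K (S (- 1) j) (S (- 1) k).
  case: j k => [j|] [k|] //; rewrite /bform /S !big_cons !big_nil/= !(dotl, dotr) !delta_mx_dot
    /c ?(Ksym r0 (ltW s0)) ?(Kdiag (ltW s0)) ?(Kdiag r0); by field; exact: vs.
have [A [SA EF EG]] := @sigma_of_functional R _ J _ _ _ Some (fun j => lincomb X (S 1 j))
  (fun j => lincomb X (S (- 1) j)) (fun i => lincomb1 _ _ _) (fun i => lincomb1 _ _ _) E sE.
(* Adding 1 makes the integrand nonnegative, as the comparison of integrals under equal laws
   requires. *)
pose h (f : J -> R) : R := 1 + \1_A f * sin (a * f None).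
have mh C : measurable C -> sigma_of setT (fun j (f : J -> R) => f j) (h @^-1` C).
  apply: sigma_of_preimage; apply: measurable_funD => //; apply: measurable_funM.
    exact: measurable_indic.
  apply: measurableT_comp.
    by apply: continuous_measurable_fun; exact: continuous_sin.
  apply: measurable_funM => //.
  exact: (@sigma_of_measurable R J setT (J -> R) (fun j f => f j) None).
have law C : measurable C -> P ((fun w => 1 + \1_E w * sin (a * res r s w)) @^-1` C) =
    P ((fun w => 1 - \1_E w * sin (a * res r s w)) @^-1` C).
  move=> mC; have := centered_gaussian_same_law cgX cgX (SD 1) (SD (- 1)) e (mh C mC).
  rewrite (_ : [set w | (h @^-1` C) (fun j => lincomb X (S 1 j) w)] =
    (fun w => 1 + \1_E w * sin (a * res r s w)) @^-1` C); last first.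
    apply/funext => w /=; rewrite /h Sl mul1r; congr (C (1 + _ * _)).
    by rewrite EF !indicE; congr (_%:R); apply/idP/idP; rewrite !inE.
  move=> ->; rewrite (_ : [set w | (h @^-1` C) (fun j => lincomb X (S (- 1) j) w)] =
    (fun w => 1 - \1_E w * sin (a * res r s w)) @^-1` C)//.
  apply/funext => w /=; rewrite /h Sl mulN1r mulrN sinN mulrN; congr (C (1 - _ * _)).
  by rewrite EG !indicE; congr (_%:R); apply/idP/idP; rewrite !inE.
have mU : measurable_fun setT (fun w => \1_E w * sin (a * res r s w)).
  apply: measurable_funM; first exact: measurable_indic.
  apply: measurableT_comp; first by apply: continuous_measurable_fun; exact: continuous_sin.
  by apply: measurable_funM => //; exact: mres.
have bU w : `|\1_E w * sin (a * res r s w)| <= 1.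
  rewrite normrM -[leRHS]mulr1 ler_pM// ?norm_sin_le1//.
    by rewrite indicE; case: (_ \in _); rewrite ?normr1 ?normr0.
  by rewrite ler_norml sin_geN1 sin_le1.
have iU : P.-integrable setT (EFin \o (fun w => \1_E w * sin (a * res r s w))).
  exact: (@bounded_integrable _ _ _ _ 1).
have i1 : P.-integrable setT (EFin \o (fun w => 1 : R)).
  by apply: (@bounded_integrable _ _ _ _ 1) => // w; rewrite normr1.
have := ge0_integral_same_law (P := P) _ _ _ _ law.
move=> /(_ _ _ _ _)/(congr1 (@fine R)).
have -> : fine (\int[P]_w (1 + \1_E w * sin (a * res r s w))%:E) = 1 + \int[P]_w (\1_E w * sin (a * res r s w)).
  by rewrite -[LHS]/(\int[P]_w (1 + \1_E w * sin (a * res r s w)))%R RintegralD// Rintegral_cst_prob.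
have -> : fine (\int[P]_w (1 - \1_E w * sin (a * res r s w))%:E) = 1 - \int[P]_w (\1_E w * sin (a * res r s w)).
  by rewrite -[LHS]/(\int[P]_w (1 - \1_E w * sin (a * res r s w)))%R RintegralB// Rintegral_cst_prob.
move=> H; suff : 1 + \int[P]_w (\1_E w * sin (a * res r s w)) = 1 - \int[P]_w (\1_E w * sin (a * res r s w)).
  by move: (\int[P]_w _) => I; lra.
apply: H.
- exact: measurable_funD.
- exact: measurable_funB.
- by move=> w; have := bU w; rewrite ler_norml => /andP[]; lra.
- by move=> w; have := bU w; rewrite ler_norml => /andP[]; lra.
Qed.

Let integrable_x t : 0 <= t <= T -> P.-integrable setT (EFin \o x t).
Proof.
move=> tT; have cf := centered_gaussian_coord cgX i0 (inD tT).
exact: gaussian_integrable (gaussian_cf_ge0 cf) cf.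
Qed.

Let integrable_res r s : 0 <= r <= T -> 0 <= s <= T -> P.-integrable setT (EFin \o res r s).
Proof.
move=> rT sT; rewrite (_ : EFin \o _ = (fun w => (x r w)%:E - (c r s)%:E * (x s w)%:E)%E)//.
by apply: integrableB => //; [exact: integrable_x|apply: integrableZl => //; exact: integrable_x].
Qed.

Let integrable_indicM E f : measurable E -> P.-integrable setT (EFin \o f) ->
  P.-integrable setT (EFin \o (fun w => \1_E w * f w)).
Proof.
move=> mE /integrableP[mf fi]; apply/integrableP; split.
  apply/measurable_EFinP; apply: measurable_funM; first exact: measurable_indic.
  exact/measurable_EFinP.
apply: le_lt_trans fi; apply: ge0_le_integral => //.
- apply: measurableT_comp => //; apply/measurable_EFinP; apply: measurable_funM.
    exact: measurable_indic.
  exact/measurable_EFinP.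
- exact: measurableT_comp.
- move=> w _ /=; rewrite lee_fin normrM indicE; case: (_ \in _).
    by rewrite normr1 mul1r.
  by rewrite normr0 mul0r.
Qed.

(* n sin (f / n) converges to f and is dominated by |f|. *)
Let orth_of_sin E f : measurable E -> P.-integrable setT (EFin \o f) ->
  (forall a, \int[P]_w (\1_E w * sin (a * f w)) = 0) -> \int[P]_w (\1_E w * f w) = 0.
Proof.
move=> mE fi h; have /integrableP[/measurable_EFinP mf _] := fi.
have msin n : measurable_fun setT (fun w => sin (f w / n.+1%:R)).
  apply: measurableT_comp; first by apply: continuous_measurable_fun; exact: continuous_sin.
  exact: measurable_funM.
have l1 : \int[P]_w (\1_E w * (n.+1%:R * sin (f w / n.+1%:R))) @[n --> \oo] -->
    \int[P]_w (\1_E w * f w).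
  apply: (@dominated_cvg_Rintegral _ _ _ _ _ _ (fun w => `|f w|)).
  - by move=> n; apply: measurable_funM; [exact: measurable_indic|exact: measurable_funM].
  - by apply: measurable_funM => //; exact: measurable_indic.
  - by apply: aeW => w; apply: cvgMr; exact: cvg_natM_sin.
  - have := integrable_abse fi; by apply: eq_integrable => // w _ /=.
  - apply: aeW => w n; rewrite normrM -[leRHS]mul1r ler_pM//.
      by rewrite indicE; case: (_ \in _); rewrite ?normr1 ?normr0.
    rewrite normrM gtr0_norm// -ler_pdivlMl//; apply: le_trans (norm_sin_le _) _.
    by rewrite normrM [X in _ * X]gtr0_norm ?invr_gt0// mulrC.
have l2 : \int[P]_w (\1_E w * (n.+1%:R * sin (f w / n.+1%:R))) @[n --> \oo] --> (0 : R).
  rewrite (_ : (fun n => _) = fun=> 0); first exact: cvg_cst.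
  apply/funext => n; have := h (n.+1%:R^-1).
  under eq_Rintegral do rewrite mulrC.
  move=> h'; under eq_Rintegral do rewrite mulrCA (mulrC (\1_E _)) (mulrC (f _)).
  rewrite RintegralZl// ?h' ?mulr0//.
  apply: (@bounded_integrable _ _ _ _ 1).
    by apply: measurable_funM; [have := msin n; under eq_fun do rewrite mulrC|exact: measurable_indic].
  move=> w; rewrite normrM -[leRHS]mulr1 ler_pM// ?norm_sin_le1//.
    by rewrite ler_norml sin_geN1 sin_le1.
  by rewrite indicE; case: (_ \in _); rewrite ?normr1 ?normr0.
exact: (cvg_unique (@Rhausdorff R) l1 l2).
Qed.

Let res_orth r s E : 0 <= r <= T -> 0 < s <= T -> sigma_vec (X s) E ->
  \int[P]_w (\1_E w * res r s w) = 0.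
Proof.
move=> rT sT sE; have sT' : 0 <= s <= T by case/andP : sT => /ltW -> ->.
apply: orth_of_sin; first exact: measurable_sigma_vec sE.
  exact: integrable_res.
by move=> a; exact: res_sin_orth.
Qed.

Let pos t : set Omega := [set w | 0 < x t w].

Let sigma_pos t : sigma_vec (X t) (pos t).
Proof.
rewrite (_ : pos t = (fun w => X t w i0 0) @^-1` `]0, +oo[%classic).
  apply: sigma_of_preimage; last exact: measurable_itv.
  exact: (@sigma_of_measurable R 'I_d setT Omega (fun i w => X t w i 0) i0 I).
by apply/seteqP; split=> w; rewrite /pos/= in_itv/= andbT.
Qed.

(** Since |x| = 2 x 1_(x > 0) - x and x is centered, a vanishing mean would make x_t zero almost
    surely, against v t > 0. *)
Let pos_part_neq0 t : 0 < t <= T -> \int[P]_w (\1_(pos t) w * x t w) != 0.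
Proof.
move=> /andP[t0 tT']; have tT : 0 <= t <= T by rewrite ltW.
apply/eqP => h.
have mp := measurable_sigma_vec tT (@sigma_pos t).
have cf := centered_gaussian_coord cgX i0 (inD tT).
have mean : \int[P]_w x t w = 0 by exact: (gaussian_mean (gaussian_cf_ge0 cf) cf).
have ip := integrable_indicM mp (integrable_x tT).
have habs : \int[P]_w `|x t w| = 0.
  transitivity (\int[P]_w (2 * (\1_(pos t) w * x t w) - x t w)).
    apply: eq_Rintegral => w _; rewrite indicE.
    case: (ltP 0 (x t w)) => xw.
      have xp : pos t w := xw.
      by rewrite (mem_set xp) gtr0_norm// mul1r; ring.
    have xp : ~ pos t w by rewrite /pos/=; apply/negP; rewrite -leNgt.
    by rewrite (memNset xp) ler0_norm// mul0r; ring.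
  rewrite RintegralB//; last 2 first.
  - rewrite (_ : EFin \o _ = (fun w => 2%:E * (\1_(pos t) w * x t w)%:E)%E)//.
    exact: integrableZl.
  - exact: integrable_x.
  by rewrite RintegralZl// h mean mulr0 subr0.
have x0 : {ae P, forall w, x t w = 0}.
  have : (\int[P]_w `|(x t w)%:E| = 0)%E.
    rewrite -[LHS]fineK; first by congr (_%:E).
    have /integrableP[_] := integrable_x tT.
    by rewrite ge0_fin_numE// integral_ge0.
  have /integrableP[mx _] := integrable_x tT.
  move/(ae_eq_integral_abs P measurableT mx); apply: filterS => w /(_ I) /=.
  by case.
have := gaussian_variance (gaussian_cf_ge0 cf) cf erefl.
rewrite (@ae_eq_Rintegral _ _ _ _ _ (fun=> 0)).
- by rewrite Rintegral_cst_prob (Kdiag (ltW t0)) => e; have := v_gt0 t0; rewrite -e ltxx.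
- by apply: measurable_funX; exact: mX.
- exact: measurable_cst.
- by move: x0; apply: filterS => w; rewrite /x => ->; rewrite expr0n.
Qed.

(** The residual of x_r on x_s is a combination of the residuals of x_r and x_s on x_t, both
    orthogonal to the events of X_t, and of x_t itself. *)
Let res_pos r s t : 0 <= r <= T -> 0 < s <= T -> 0 < t <= T ->
  \int[P]_w (\1_(pos t) w * res r s w) =
  (c r t - c r s * c s t) * \int[P]_w (\1_(pos t) w * x t w).
Proof.
move=> rT sT' tT'; have sT : 0 <= s <= T by case/andP : sT' => /ltW -> ->.
have tT : 0 <= t <= T by case/andP : tT' => /ltW -> ->.
have mp := measurable_sigma_vec tT (@sigma_pos t).
have ir := integrable_indicM mp (integrable_res rT tT).
have is_ := integrable_indicM mp (integrable_res sT tT).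
have ix := integrable_indicM mp (integrable_x tT).
transitivity (\int[P]_w (\1_(pos t) w * res r t w + (- c r s * (\1_(pos t) w * res s t w) +
    (c r t - c r s * c s t) * (\1_(pos t) w * x t w)))).
  by apply: eq_Rintegral => w _; rewrite /res; ring.
have Z (k : R) f : P.-integrable setT (EFin \o f) -> P.-integrable setT (EFin \o (fun w => k * f w)).
  by move=> fi; rewrite (_ : EFin \o _ = (fun w => k%:E * (f w)%:E)%E)//; exact: integrableZl.
rewrite RintegralD//; last first.
  rewrite (_ : EFin \o _ = (fun w => (- c r s * (\1_(pos t) w * res s t w))%:E +
    ((c r t - c r s * c s t) * (\1_(pos t) w * x t w))%:E)%E)//.
  by apply: integrableD => //; exact: Z.
rewrite RintegralD//; [|exact: Z|exact: Z].
rewrite !RintegralZl// (res_orth rT tT' (@sigma_pos t)) (res_orth sT tT' (@sigma_pos t)).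
by rewrite mulr0 !add0r.
Qed.

Let sigma_process_measurable s : s <= T -> sigma_process `[0, s] X `<=` measurable.
Proof.
move=> sT; apply: sigma_of_sub => -[t i] [/= tD _]; apply: mX.
by move: tD; rewrite in_itv/= => /andP[-> /le_trans]; apply.
Qed.

(** The sine of the residual is measurable for the past up to s, so the event may be replaced by its
    conditional probability. By the Markov property this is almost surely a function of X_s, to
    which the residual is orthogonal. *)
Let markov_res r s t : markov_process P T X -> 0 <= r -> r < s -> s < t -> t <= T ->
  \int[P]_w (\1_(pos t) w * res r s w) = 0.
Proof.
move=> mk r0 rs st tT.
have s0 : 0 < s by apply: le_lt_trans rs.
have rT' : 0 <= r <= T by lra.
have sT' : 0 < s <= T by lra.
have sT'' : 0 <= s <= T by lra.
have tT' : 0 <= t <= T by lra.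
have mp := measurable_sigma_vec tT' (@sigma_pos t).
apply: orth_of_sin => //; first exact: integrable_res.
move=> a.
have [Y [Z [hY hZ YZ]]] := mk s t (ltW s0) (ltW st) tT _ (@sigma_pos t).
have msin : measurable_fun setT (fun w => sin (a * res r s w)).
  apply: measurableT_comp; first by apply: continuous_measurable_fun; exact: continuous_sin.
  by apply: measurable_funM => //; exact: mres.
have sin1 w : `|sin (a * res r s w)| <= 1 by rewrite ler_norml sin_geN1 sin_le1.
under eq_Rintegral do rewrite mulrC.
rewrite (cond_expectation_orth (C := 1) hY _ msin sin1); first last.
- apply: sigma_of_preimage; apply: measurableT_comp.
    by apply: continuous_measurable_fun; exact: continuous_sin.
  apply: measurable_funM => //; apply: measurable_funB; last apply: measurable_funM => //.
    apply: (@sigma_of_measurable R (R * 'I_d)%type (`[0, s] `*` setT) Omega (fun j w => X j.1 w j.2 0) (r, i0)).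
    by split => //=; rewrite in_itv/= r0 ltW.
  apply: (@sigma_of_measurable R (R * 'I_d)%type (`[0, s] `*` setT) Omega (fun j w => X j.1 w j.2 0) (s, i0)).
  by split => //=; rewrite in_itv/= lexx ltW.
- by apply: sigma_process_measurable; lra.
have [_ /integrableP[/measurable_EFinP mY _] _ _] := hY.
have [_ iZ ZG _] := hZ.
have /integrableP[/measurable_EFinP mZ _] := iZ.
rewrite (@ae_eq_Rintegral _ _ _ _ _ (fun w => Z w * sin (a * res r s w))); first last.
- by move: YZ; apply: filterS => w ->; rewrite mulrC.
- exact: measurable_funM.
- exact: measurable_funM.
apply: Rintegral_orth => //.
- exact: (@bounded_integrable _ _ _ _ 1).
- have /integrableP[_ iZ'] := iZ; apply/integrableP; split.
    by apply/measurable_EFinP; exact: measurable_funM.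
  apply: le_lt_trans iZ'; apply: ge0_le_integral => //.
  + by apply: measurableT_comp => //; apply/measurable_EFinP; exact: measurable_funM.
  + by apply: measurableT_comp => //; exact/measurable_EFinP.
  + by move=> w _ /=; rewrite lee_fin normrM -[leRHS]mulr1 ler_pM.
- move=> C mC; rewrite Rintegral_mkcond.
  rewrite -[RHS](res_sin_orth a rT' sT' (ZG C mC)).
  apply: eq_Rintegral => w _; rewrite patchE indicE.
  by case: (w \in _); rewrite ?mul1r ?mul0r.
Qed.

Lemma gaussian_not_markov :
  (forall t s, 0 < t -> 0 < s -> v (t + s) < v t + v s) ->
  (forall t s, 0 <= s <= t -> v s <= v t) ->
  (forall t s, 0 <= s <= t -> 0 < t -> v t - v (t - s) <= v t * (s / t)) ->
  (exists C a, [/\ 0 < C, 0 < a < 1 & forall t, 0 <= t -> C * t `^ a <= v t]) ->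
  ~ markov_process P T X.
Proof.
move=> vsub vmono vlip [C [a [C0 /andP[a0 a1] va]]] mk.
(* At the midpoint K(s, T) reduces to v(T) / 2, which strict subadditivity places below v(s). *)
pose s := T / 2.
have s0 : 0 < s by rewrite divr_gt0.
have sT : s < T by rewrite /s ltr_pdivrMr// ltr_pMr// ltr1n.
have vs0 := v_gt0 s0; have vT0 := v_gt0 T0.
pose L := K s T.
have LE : L = 2^-1 * v T.
  rewrite /L KE ?ltW// distrC ger0_norm ?subr_ge0 ?ltW//.
  by rewrite (_ : T - s = s) ?[v s + _]addrC ?addrK// /s; field.
have L0 : 0 < L by rewrite LE mulr_gt0.
have Ls : L < v s.
  have := vsub s s s0 s0; rewrite (_ : s + s = T); last by rewrite /s; field.
  by rewrite LE; lra.
(* Regression identity with t = T, after bounding v(T) - v(T - r) below by 0 and v(s) - v(s - r)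
   above by concavity. *)
have key r : 0 < r < s -> v r * (v s - L) <= L * (v s * (r / s)).
  move=> /andP[r0 rs].
  have r0' := ltW r0.
  have := markov_res mk r0' rs sT (lexx T).
  rewrite res_pos//; [|lra|lra|by rewrite T0/=].
  move/eqP; rewrite mulf_eq0 (negbTE (pos_part_neq0 _)) ?T0 ?lexx// orbF.
  rewrite /c subr_eq0 -/L => /eqP e.
  have {}e : K r T * v s = K r s * L.
    have := congr1 (fun z => z * v T * v s) e.
    rewrite (_ : K r T / v T * v T * v s = K r T * v s); last by field; rewrite gt_eqF.
    by move=> ->; field; rewrite !gt_eqF.
  move: e; rewrite !KE//; [|exact: ltW|exact: ltW].
  rewrite (distrC r) (distrC r) !gtr0_norm ?subr_gt0//; last exact: lt_trans sT.
  have r0s : 0 <= r <= s by rewrite r0' ltW.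
  have := vlip s r r0s s0.
  have : v (T - r) <= v T by apply: vmono; lra.
  move: (v (T - r)) (v (s - r)) (r / s) => A B q h1 h2 e.
  have h3 := ler_wpM2l (ltW L0) h2.
  have h4 := mulr_ge0 (ltW vs0) (_ : 0 <= v T - A); rewrite subr_ge0 in h4.
  have {}h4 := h4 h1.
  lra.
pose r (n : nat) : R := s / 2 / n.+1%:R.
have r0 n : 0 < r n by rewrite !divr_gt0.
have rs n : r n < s.
  apply: (@le_lt_trans _ _ (s / 2)); last by rewrite ltr_pdivrMr// ltr_pMr// ltr1n.
  by rewrite ler_pdivrMr// ler_peMr ?ler1n// divr_ge0// ltW.
pose D := L * v s / s.
(* Inserting C r^a <= v(r) in [key] and dividing by r^a leaves a right-hand side that tends to 0. *)
have bnd n : C * (v s - L) <= D * r n `^ (1 - a).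
  have h := key (r n); rewrite r0 rs in h; have {}h := h isT.
  have h' : C * r n `^ a * (v s - L) <= D * r n.
    apply: le_trans (_ : v (r n) * (v s - L) <= _).
      by rewrite ler_wpM2r ?va ?ltW// subr_gt0.
    by rewrite (_ : D * r n = L * (v s * (r n / s)))// /D; field; rewrite gt_eqF.
  have pa : 0 < r n `^ a by rewrite powR_gt0.
  rewrite -(ler_pM2r pa) mulrAC; apply: le_trans h' _.
  rewrite -[leRHS]mulrA -powRD; last by rewrite (gt_eqF (r0 n)) implybT.
  by rewrite subrK powRr1// ltW.
have : C * (v s - L) <= 0.
  have l : D * r n `^ (1 - a) @[n --> \oo] --> (0 : R).
    rewrite -(mulr0 D); apply: cvgMr; apply: cvg_powR0; first by lra.
      by move=> n; exact: ltW.
    by rewrite -(mulr0 (s / 2)); apply: cvgMr; exact: cvg_harmonic.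
  apply: (ler_cvg_to (cvg_cst (C * (v s - L))) l); exact: nearW.
by rewrite pmulr_rle0// subr_le0 leNgt Ls.
Qed.

End gaussian_markov.

(** * Averages of cosines of increments *)

Section second_differences.
Context {R : realType}.
Variables (v : R -> R) (h : R).
Hypotheses (h0 : 0 < h) (v0 : v 0 = 0).
Hypothesis v_mono : forall t s, 0 <= s <= t -> v s <= v t.
Hypothesis v_mid : forall t h, 0 <= h <= t -> v (t - h) + v (t + h) <= 2 * v t.

(** The covariance of the increments over [j h, (j + 1) h] and [k h, (k + 1) h]. *)
Definition second_diff (j k : nat) : R :=
  2^-1 * (v `|(j%:R - k%:R + 1) * h| + v `|(j%:R - k%:R - 1) * h| - 2 * v `|(j%:R - k%:R) * h|).

Lemma second_diffC j k : second_diff j k = second_diff k j.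
Proof.
rewrite /second_diff (_ : (j%:R - k%:R + 1) * h = - ((k%:R - j%:R - 1) * h)); last by ring.
rewrite (_ : (j%:R - k%:R - 1) * h = - ((k%:R - j%:R + 1) * h)); last by ring.
rewrite (_ : (j%:R - k%:R) * h = - ((k%:R - j%:R) * h)); last by ring.
by rewrite !normrN; ring.
Qed.

Lemma second_diff_diag j : second_diff j j = v h.
Proof.
rewrite /second_diff subrr add0r sub0r mul0r mul1r mulN1r normrN normr0 v0 gtr0_norm//.
by field.
Qed.

Let far (j k : nat) : (k < j)%N -> 1 <= (j%:R - k%:R : R).
Proof. by move=> kj; rewrite lerBrDl natr1 ler_nat. Qed.

Lemma second_diffE j k : (k < j)%N -> let y := (j%:R - k%:R) * h in
  second_diff j k = 2^-1 * (v (y + h) + v (y - h) - 2 * v y).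
Proof.
move=> /far kj y; rewrite /second_diff.
rewrite (_ : (j%:R - k%:R + 1) * h = y + h); last by rewrite /y; ring.
rewrite (_ : (j%:R - k%:R - 1) * h = y - h); last by rewrite /y; ring.
have hy : h <= y by rewrite ler_peMl// ltW.
rewrite -/y !ger0_norm//; first by apply: le_trans hy; exact: ltW.
  by rewrite subr_ge0.
by apply: addr_ge0; [apply: le_trans hy|]; exact: ltW.
Qed.

Lemma second_diff_le0 j k : k != j -> second_diff j k <= 0.
Proof.
wlog kj : j k / (k < j)%N.
  by move=> hw; rewrite neq_ltn => /orP[] kj; [|rewrite second_diffC]; apply: hw; rewrite ?neq_ltn ?kj ?orbT.
move=> _; rewrite second_diffE//=.
have hy : 0 <= h <= (j%:R - k%:R) * h by rewrite ltW//= ler_peMl ?far// ltW.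
by have := v_mid hy; lra.
Qed.

(** Second differences telescope into first differences: half of v(h) minus an increment of v, which
    is nonnegative by monotonicity. *)
Lemma sum_second_diff_lt j : \sum_(0 <= k < j) - second_diff j k <= 2^-1 * v h.
Proof.
pose u (k : nat) : R := v ((j%:R - k%:R) * h) - v ((j%:R - k%:R + 1) * h).
rewrite (eq_big_nat _ _ (F2 := fun k => 2^-1 * (u k - u k.+1))).
  rewrite -mulr_sumr ler_pM2l// -(opprK (\sum_(_ <= _ < _) _)) -sumrN.
  rewrite (eq_bigr (fun k => u k.+1 - u k)); last by move=> k _; rewrite opprB.
  have u0 : u 0%N = v (j%:R * h) - v ((j%:R + 1) * h) by rewrite /u subr0.
  have uj : u j = - v h by rewrite /u subrr mul0r add0r mul1r v0 sub0r.
  have : v (j%:R * h) <= v ((j%:R + 1) * h).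
    by apply: v_mono; rewrite mulr_ge0 ?(ltW h0)//= ler_pM2r// lerDl.
  by rewrite telescope_sumr// u0 uj; lra.
move=> k /andP[_ kj]; have e : (k.+1%:R : R) = k%:R + 1 by rewrite natr1.
rewrite second_diffE//= /u e.
rewrite (_ : j%:R - (k%:R + 1) + 1 = j%:R - k%:R); last by ring.
rewrite (_ : (j%:R - k%:R) * h - h = (j%:R - (k%:R + 1)) * h); last by ring.
rewrite (_ : (j%:R - k%:R) * h + h = (j%:R - k%:R + 1) * h); last by ring.
by ring.
Qed.

Lemma sum_second_diff_gt j m : \sum_(j.+1 <= k < m) - second_diff j k <= 2^-1 * v h.
Proof.
have [mj|jm] := leqP m j.+1.
  by rewrite big_geq// mulr_ge0// -v0; apply: v_mono; rewrite lexx ltW.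
pose u (k : nat) : R := v ((k%:R - j%:R) * h) - v ((k%:R - j%:R - 1) * h).
rewrite (eq_big_nat _ _ (F2 := fun k => 2^-1 * (u k - u k.+1))).
  rewrite -mulr_sumr ler_pM2l// -(opprK (\sum_(_ <= _ < _) _)) -sumrN.
  rewrite (eq_bigr (fun k => u k.+1 - u k)); last by move=> k _; rewrite opprB.
  rewrite telescope_sumr; last exact: ltnW.
  have e : (j.+1%:R : R) - j%:R = 1 by rewrite -natr1 addrAC subrr add0r.
  have uj : u j.+1 = v h by rewrite /u e subrr mul0r mul1r v0 subr0.
  have mj := far (ltnW jm).
  have : v ((m%:R - j%:R - 1) * h) <= v ((m%:R - j%:R) * h).
    by apply: v_mono; rewrite mulr_ge0 ?subr_ge0 ?(ltW h0)//= ler_pM2r// gerBl.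
  by rewrite uj /u; lra.
move=> k /andP[jk _]; have e : (k.+1%:R : R) = k%:R + 1 by rewrite natr1.
rewrite second_diffC second_diffE//= /u e.
rewrite (_ : k%:R + 1 - j%:R - 1 = k%:R - j%:R); last by ring.
rewrite (_ : (k%:R - j%:R) * h - h = (k%:R - j%:R - 1) * h); last by ring.
rewrite (_ : (k%:R - j%:R) * h + h = (k%:R + 1 - j%:R) * h); last by ring.
by ring.
Qed.

(** The diagonal contributes v h, and the terms on either side of it at most half as much. *)
Lemma sum_norm_second_diff j m : (j < m)%N -> \sum_(0 <= k < m) `|second_diff j k| <= 2 * v h.
Proof.
move=> jm; have vh0 : 0 <= v h by rewrite -v0; apply: v_mono; rewrite lexx ltW.
rewrite (@big_cat_nat _ _ _ j) ?(ltnW jm)//= (big_ltn jm) second_diff_diag (ger0_norm vh0).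
have := sum_second_diff_lt j; have := sum_second_diff_gt j m.
rewrite (eq_big_nat _ _ (F2 := fun k => `|second_diff j k|)); last first.
  by move=> k /andP[jk _]; rewrite ler0_norm// second_diff_le0// gtn_eqF.
rewrite (eq_big_nat (m := 0) (n := j) _ _ (F2 := fun k => `|second_diff j k|)); last first.
  by move=> k /andP[_ kj]; rewrite ler0_norm// second_diff_le0// ltn_eqF.
by move: (\sum_(_ <= _ < _) _) (\sum_(_ <= _ < _) _) => A B; lra.
Qed.

(** It is one of the nonnegative terms of a sum bounded by v h / 2; distinct increments thus have
    correlation at most 1/2 in absolute value. *)
Lemma norm_second_diff_le j k : k != j -> `|second_diff j k| <= 2^-1 * v h.
Proof.
wlog kj : j k / (k < j)%N.
  by move=> hw; rewrite neq_ltn => /orP[] kj; [|rewrite second_diffC]; apply: hw; rewrite ?neq_ltn ?kj ?orbT.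
move=> kj'; rewrite ler0_norm ?second_diff_le0//.
apply: le_trans (sum_second_diff_lt j).
rewrite (@big_cat_nat _ _ _ k) ?(ltnW kj)//= (big_ltn kj) addrCA lerDl addr_ge0//.
  rewrite big_nat; apply: sumr_ge0 => l /andP[_ lk].
  by rewrite oppr_ge0 second_diff_le0// ltn_eqF// (ltn_trans lk).
rewrite big_nat; apply: sumr_ge0 => l /andP[_ lj].
by rewrite oppr_ge0 second_diff_le0// ltn_eqF.
Qed.

End second_differences.

(** The left-hand side is the covariance of the cosines of two standard normal variables with
    correlation r. The two cases are those of distinct increments and of the diagonal. *)
Lemma mean_cosh_le (R : realType) (r : R) : `|r| <= 2^-1 \/ r = 1 ->
  2^-1 * (expR (- (1 + r)) + expR (- (1 - r))) - expR (- 1) <= `|r|.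
Proof.
have e10 : 0 < expR (- 1) :> R by exact: expR_gt0.
have e11 : expR (- 1) <= 1 :> R by rewrite -[leRHS]expR0 ler_expR; lra.
case=> [r2|->].
  rewrite !opprD opprK !expRD -mulrDr.
  have key (a : R) : 0 <= a <= 2^-1 -> expR a + expR (- a) <= 2 + 2 * a.
    move=> /andP[a0 a2].
    have h1 : expR (- a) <= 1 by rewrite -expR0 ler_expR oppr_le0.
    have h2 : 1 - a <= expR (- a) by have := expR_ge1Dx (- a); lra.
    have h3 : expR a * expR (- a) = 1 by rewrite -expRD subrr expR0.
    have h4 : 0 < expR a by exact: expR_gt0.
    move: (expR a) (expR (- a)) h1 h2 h3 h4 => p q h1 h2 h3 h4.
    have : p * (1 - a) <= 1 by rewrite -[leRHS]h3 ler_pM2l.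
    nra.
  have : expR (- r) + expR r <= 2 + 2 * `|r|.
    have := key `|r|; rewrite normr_ge0 r2 => /(_ isT).
    by case: (ger0P r) => _; rewrite ?opprK; lra.
  have := normr_ge0 r.
  by move: (expR _ + expR r) `|r| => p a a0 h; nra.
rewrite normr1 subrr oppr0 expR0.
have : expR (- (1 + 1)) <= 1 :> R by rewrite -[leRHS]expR0 ler_expR; lra.
by lra.
Qed.

(** * Concentration of the averages along uniform grids *)

Section gaussian_variation.
Context dsp (Omega : measurableType dsp) (R : realType) (P : probability Omega R).
Variables (T : R) (d : nat) (X : R -> Omega -> 'cV[R]_d) (K : R -> R -> R) (v : R -> R).
Hypothesis T0 : 0 < T.
Hypothesis cgX : centered_gaussian P `[0, T] X K.
Hypothesis KE : forall t s, 0 <= t -> 0 <= s -> K t s = 2^-1 * (v s + v t - v `|t - s|).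
Hypothesis v0 : v 0 = 0.
Hypothesis v_gt0 : forall t, 0 < t -> 0 < v t.
Hypothesis v_mono : forall t s, 0 <= s <= t -> v s <= v t.
Hypothesis v_mid : forall t h, 0 <= h <= t -> v (t - h) + v (t + h) <= 2 * v t.
Variable i0 : 'I_d.

Definition mesh (m : nat) : R := T / m.+1%:R.
Definition grid (m j : nat) : R := j%:R * mesh m.
Definition grid_inc (m j : nat) (w : Omega) : R := X (grid m j.+1) w i0 0 - X (grid m j) w i0 0.
Definition mean_cos (m : nat) (w : Omega) : R :=
  m.+1%:R^-1 * \sum_(j < m.+1) cos (grid_inc m j w / Num.sqrt (v (mesh m))).

Let mesh_gt0 m : 0 < mesh m. Proof. by rewrite divr_gt0. Qed.

Lemma grid_itv m j : (j <= m.+1)%N -> 0 <= grid m j <= T.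
Proof.
move=> jm; rewrite /grid mulr_ge0 ?(ltW (mesh_gt0 m))//= /mesh mulrCA ler_piMr ?(ltW T0)//.
by rewrite ler_pdivrMr// mul1r ler_nat.
Qed.

Let gridB m j k : grid m j - grid m k = (j%:R - k%:R) * mesh m.
Proof. by rewrite /grid mulrBl. Qed.

Let vh0 m : 0 < v (mesh m). Proof. exact: v_gt0. Qed.

Let inc m (j : nat) := increment (grid m j.+1) (grid m j) i0.

Let bform_inc m j k : (j <= m)%N -> (k <= m)%N ->
  bform K (inc m j) (inc m k) = second_diff v (mesh m) j k.
Proof.
move=> jm km.
have g0 l : (l <= m.+1)%N -> 0 <= grid m l by move=> /grid_itv /andP[].
rewrite (bform_stationary KE) ?g0// ?(leq_trans jm)// ?(leq_trans km)//.
rewrite eqxx mulr1 !gridB /second_diff -!natr1.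
rewrite (_ : j%:R + 1 - k%:R = j%:R - k%:R + 1); last by ring.
rewrite (_ : j%:R - (k%:R + 1) = j%:R - k%:R - 1); last by ring.
rewrite (_ : j%:R + 1 - (k%:R + 1) = j%:R - k%:R); last by ring.
by ring.
Qed.

Let Z m (j : nat) w := grid_inc m j w / Num.sqrt (v (mesh m)).
Let rho m j k := second_diff v (mesh m) j k / v (mesh m).

Let Z_cf m j k a b : (j <= m)%N -> (k <= m)%N ->
  gaussian_cf P (fun w => a * Z m j w + b * Z m k w) 0 (a ^+ 2 + b ^+ 2 + 2 * a * b * rho m j k).
Proof.
move=> jm km; set sg := Num.sqrt (v (mesh m)).
have sg2 : sg ^+ 2 = v (mesh m) by rewrite sqr_sqrtr// ltW.
have sg0 : sg != 0 by rewrite gt_eqF// sqrtr_gt0.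
pose u (c : bool) := if c then a / sg else b / sg.
pose s (c : bool) := if c then inc m j else inc m k.
have sD c p : p \in s c -> `[0, T]%classic p.1.
  by case: c; apply: mem_increment; apply: grid_itv; rewrite ?ltnS// ltnW.
have := centered_gaussian_sum u cgX sD.
rewrite !big_bool/= !bform_inc// !second_diff_diag// (second_diffC _ _ k j).
rewrite (_ : (fun w => _) = (fun w => a * Z m j w + b * Z m k w)); last first.
  by apply/funext => w; rewrite big_bool/= !lincomb_increment /Z /grid_inc -/sg; ring.
move=> h; rewrite (_ : a ^+ 2 + b ^+ 2 + 2 * a * b * rho m j k = a / sg * (a / sg) * v (mesh m) +
  a / sg * (b / sg) * second_diff v (mesh m) j k + (b / sg * (a / sg) * second_diff v (mesh m) j k +
  b / sg * (b / sg) * v (mesh m)))//.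
by rewrite /rho -sg2; field.
Qed.

Let mZ m j : (j <= m)%N -> measurable_fun setT (Z m j).
Proof.
move=> jm; have [] := Z_cf 1 0 jm jm.
by rewrite (_ : (fun w => _) = Z m j)//; apply/funext => w; rewrite mul1r mul0r addr0.
Qed.

Let Rintegral_cosZ m j : (j <= m)%N -> \int[P]_w cos (Z m j w) = expR (- 2^-1).
Proof.
move=> jm; have [_ /(_ 1 0)] := Z_cf 1 0 jm jm.
under eq_Rintegral do rewrite !mul1r mul0r !addr0.
by move=> ->; rewrite !mulr0 addr0 cos0 mul1r mul0r addr0; congr expR; field.
Qed.

Let Rintegral_cosZZ m j k : (j <= m)%N -> (k <= m)%N ->
  \int[P]_w (cos (Z m j w) * cos (Z m k w)) =
  2^-1 * (expR (- (1 + rho m j k)) + expR (- (1 - rho m j k))).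
Proof.
move=> jm km.
have [m1 /(_ 1 0)] := Z_cf 1 1 jm km; have [m2 /(_ 1 0)] := Z_cf 1 (- 1) jm km.
rewrite !mulr0 !addr0 cos0 !mul1r.
rewrite (_ : - (1 ^+ 2 * (1 ^+ 2 + (- 1) ^+ 2 + 2 * 1 * - 1 * rho m j k)) / 2 = - (1 - rho m j k)); last by field.
rewrite (_ : - (1 ^+ 2 * (1 ^+ 2 + 1 ^+ 2 + 2 * 1 * 1 * rho m j k)) / 2 = - (1 + rho m j k)); last by field.
move=> e2 e1; rewrite -e1 -e2.
transitivity (\int[P]_w (2^-1 * (cos (1 * (1 * Z m j w + 1 * Z m k w) + 0) + cos (1 * (1 * Z m j w + -1 * Z m k w) + 0)))).
  apply: eq_Rintegral => w _; by rewrite !mul1r !mulN1r !addr0 cosD cosB; field.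
have ib (f : Omega -> R) : measurable_fun setT f -> P.-integrable setT (EFin \o (fun w => cos (1 * f w + 0))).
  move=> mf; apply: (@bounded_integrable _ _ _ _ 1); last by move=> w; exact: norm_cos_le1.
  by apply: measurable_fun_cos; apply: measurable_funD => //; exact: measurable_funM.
rewrite RintegralZl//; first by rewrite RintegralD//; exact: ib.
have := integrableD measurableT (ib _ m1) (ib _ m2).
by apply: eq_integrable => // w _ /=.
Qed.

Let sum_rho m j : (j <= m)%N -> \sum_(k < m.+1) `|rho m j k| <= 2.
Proof.
move=> jm; rewrite -(big_mkord xpredT (fun k => `|rho m j k|)).
have := @sum_norm_second_diff R v (mesh m) (mesh_gt0 m) v0 v_mono v_mid j m.+1 jm.
rewrite -ler_pdivrMr// mulr_suml; apply: le_trans.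
by apply: ler_sum => k _; rewrite /rho normrM normfV (gtr0_norm (vh0 m)).
Qed.

(** Expanding the square leaves covariances bounded by the correlations |rho|; each row sums to at
    most 2, and there are m + 1 rows against a factor 1 / (m + 1)^2. *)
Lemma mean_cos_variance m : \int[P]_w (mean_cos m w - expR (- 2^-1)) ^+ 2 <= 2 / m.+1%:R.
Proof.
set mu := expR (- 2^-1).
have mu2 : mu * mu = expR (- 1) by rewrite -expRD; congr expR; field.
pose G (j k : 'I_m.+1) w := (cos (Z m j w) - mu) * (cos (Z m k w) - mu).
have lem (j : 'I_m.+1) : (j <= m)%N by rewrite -ltnS.
have ic (j : 'I_m.+1) : P.-integrable setT (EFin \o (fun w => cos (Z m j w))).
  apply: (@bounded_integrable _ _ _ _ 1); last by move=> w; exact: norm_cos_le1.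
  by apply: measurable_fun_cos; exact: mZ.
have icc (j k : 'I_m.+1) : P.-integrable setT (EFin \o (fun w => cos (Z m j w) * cos (Z m k w))).
  apply: (@bounded_integrable _ _ _ _ 1).
    by apply: measurable_funM; apply: measurable_fun_cos; exact: mZ.
  by move=> w; rewrite normrM -[leRHS]mulr1 ler_pM// norm_cos_le1.
have iG (j k : 'I_m.+1) : P.-integrable setT (EFin \o G j k).
  apply: (@bounded_integrable _ _ _ _ ((1 + `|mu|) * (1 + `|mu|))).
    by apply: measurable_funM; apply: measurable_funB => //; apply: measurable_fun_cos; exact: mZ.
  move=> w; rewrite normrM ler_pM//.
    by apply: le_trans (ler_normB _ _) _; rewrite lerD2r norm_cos_le1.
  by apply: le_trans (ler_normB _ _) _; rewrite lerD2r norm_cos_le1.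
have EG (j k : 'I_m.+1) : \int[P]_w G j k w <= `|rho m j k|.
  have -> : \int[P]_w G j k w = \int[P]_w (cos (Z m j w) * cos (Z m k w)) - expR (- 1).
    transitivity (\int[P]_w (cos (Z m j w) * cos (Z m k w) - (mu * cos (Z m j w) + mu * (cos (Z m k w) - mu)))).
      by apply: eq_Rintegral => w _; rewrite /G; ring.
    have iB : P.-integrable setT (EFin \o (fun w => cos (Z m k w) - mu)).
      apply: (@bounded_integrable _ _ _ _ (1 + `|mu|)).
        by apply: measurable_funB => //; apply: measurable_fun_cos; exact: mZ.
      by move=> w; apply: le_trans (ler_normB _ _) _; rewrite lerD2r norm_cos_le1.
    have i1 : P.-integrable setT (EFin \o (fun w => mu * cos (Z m j w))).
      by rewrite (_ : EFin \o _ = (fun w => mu%:E * (cos (Z m j w))%:E)%E)//; exact: (integrableZl measurableT mu (ic j)).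
    have i2 : P.-integrable setT (EFin \o (fun w => mu * (cos (Z m k w) - mu))).
      by rewrite (_ : EFin \o _ = (fun w => mu%:E * (cos (Z m k w) - mu)%:E)%E)//; exact: (integrableZl measurableT mu iB).
    have i3 : P.-integrable setT (EFin \o (fun w => mu * cos (Z m j w) + mu * (cos (Z m k w) - mu))).
      by have := integrableD measurableT i1 i2; apply: eq_integrable => // w _ /=.
    have i4 : P.-integrable setT (EFin \o (fun _ => mu)).
      by apply: (@bounded_integrable _ _ _ _ `|mu|).
    rewrite RintegralB// RintegralD// !RintegralZl// RintegralB//.
    rewrite !Rintegral_cosZ// Rintegral_cst_prob subrr mulr0 addr0 -/mu mu2.
    by [].
  rewrite Rintegral_cosZZ//; apply: mean_cosh_le.
  have [->|kj] := eqVneq k j.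
    by right; rewrite /rho second_diff_diag// divff// gt_eqF.
  left; rewrite /rho normrM normfV (gtr0_norm (vh0 m)) ler_pdivrMr//.
  by apply: norm_second_diff_le.
have -> : \int[P]_w (mean_cos m w - mu) ^+ 2 =
    \int[P]_w ((m.+1%:R ^+ 2)^-1 * \sum_(j < m.+1) \sum_(k < m.+1) G j k w).
  apply: eq_Rintegral => w _.
  have -> : mean_cos m w - mu = m.+1%:R^-1 * \sum_(j < m.+1) (cos (Z m j w) - mu).
    rewrite /mean_cos sumrB mulrBr sumr_const card_ord -[mu *+ _]mulr_natl mulrA mulVf ?mul1r//.
  by rewrite exprMn exprVn; congr (_ * _); rewrite expr2 big_distrlr.
have [iGG eGG] : P.-integrable setT (EFin \o (fun w => \sum_(j < m.+1) \sum_(k < m.+1) G j k w)) /\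
    \int[P]_w (\sum_(j < m.+1) \sum_(k < m.+1) G j k w) = \sum_(j < m.+1) \sum_(k < m.+1) \int[P]_w G j k w.
  have h j := Rintegral_sum (fun k (_ : k \in index_enum 'I_m.+1) => iG j k).
  have [i e] := Rintegral_sum (fun j (_ : j \in index_enum 'I_m.+1) => (h j).1).
  by split => //; rewrite e; apply: eq_bigr => j _; rewrite (h j).2.
rewrite RintegralZl// eGG.
have le : \sum_(j < m.+1) \sum_(k < m.+1) \int[P]_w G j k w <= \sum_(j < m.+1) 2.
  apply: ler_sum => j _; apply: le_trans (sum_rho (lem j)).
  by apply: ler_sum => k _.
have mp : 0 < (m.+1%:R ^+ 2)^-1 :> R by rewrite invr_gt0 exprn_gt0.
apply: le_trans (ler_wpM2l (ltW mp) le) _.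
rewrite sumr_const card_ord -[2 *+ _]mulr_natl.
have : m.+1%:R != 0 :> R by rewrite pnatr_eq0.
move: (m.+1%:R : R) => z z0; rewrite le_eqVlt; apply/orP; left; apply/eqP.
by field.
Qed.

End gaussian_variation.

(** * Infinite p-variation *)

Section partitions.
Context {R : realType}.

Lemma path_incr_map (f : nat -> R) n k : (forall j, f j < f j.+1) ->
  path <%R (f n) [seq f j | j <- iota n.+1 k] /\ last (f n) [seq f j | j <- iota n.+1 k] = f (n + k)%N.
Proof.
move=> fi; elim: k n => [|k IH] n /=; first by rewrite addn0.
by have [-> ->] := IH n.+1; rewrite fi addSnnS.
Qed.

Lemma big_zip_map (f : nat -> R) (F : R * R -> R) n k :
  \sum_(x <- zip [seq f j | j <- iota n.+1 k] (f n :: [seq f j | j <- iota n.+1 k])) F x =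
  \sum_(n <= j < n + k) F (f j.+1, f j).
Proof.
elim: k n => [|k IH] n /=; first by rewrite big_nil addn0 big_geq.
by rewrite big_cons IH addSnnS [RHS]big_ltn// -addSnnS leq_addr.
Qed.

Lemma Rmarkov dsp (Omega : measurableType dsp) (P : probability Omega R) (f : Omega -> R) (c : R) A :
  measurable A -> P.-integrable setT (EFin \o f) -> (forall w, 0 <= f w) -> 0 <= c ->
  (forall w, A w -> c <= f w) -> c * fine (P A) <= \int[P]_w f w.
Proof.
move=> mA fi f0 c0 cf.
have -> : c * fine (P A) = \int[P]_w (c * \1_A w).
  rewrite RintegralZl//; last exact: integrable_indic.
  by rewrite /Rintegral integral_indic// setIT.
apply: le_Rintegral => //.
  rewrite (_ : EFin \o _ = (fun w => c%:E * (\1_A w)%:E)%E)//.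
  by apply: integrableZl => //; exact: integrable_indic.
move=> w _; rewrite indicE; have [/set_mem Aw|_] := boolP (w \in A); last by rewrite mulr0.
by rewrite mulr1 cf.
Qed.

(** Below the threshold [del] the quadratic bound applies; above it (|z| / del)^p is at least 1 and
    pays for 1 - cos z <= 2. Any exponent p is thus comparable with the cosine. *)
Lemma one_sub_cos_le_powR (p del z : R) : 0 < p -> 0 < del ->
  1 - cos z <= del ^+ 2 / 2 + 2 * (`|z| * del^-1) `^ p.
Proof.
move=> p0 d0; have [zd|dz] := leP `|z| del.
  apply: le_trans (one_sub_cos_le _) _.
  have : z ^+ 2 <= del ^+ 2 by rewrite -[z ^+ 2]real_normK ?num_real// lerXn2r// nnegrE ltW.
  have : 0 <= (`|z| * del^-1) `^ p by exact: powR_ge0.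
  by move: (z ^+ 2) (del ^+ 2) (_ `^ _) => x y q; lra.
have : 1 <= (`|z| * del^-1) `^ p.
  have e1 : (1 : R) `^ p = 1 by rewrite powR1.
  rewrite -[leLHS]e1; apply: ge0_ler_powR; rewrite ?nnegrE ?(ltW p0)//.
    by rewrite mulr_ge0// invr_ge0 ltW.
  by rewrite ler_pdivlMr// mul1r ltW.
have := @cos_geN1 R z; have := sqr_ge0 del.
by move: (cos z) (del ^+ 2) (_ `^ _) => x y q; lra.
Qed.

End partitions.

Section infinite_variation.
Context dsp (Omega : measurableType dsp) (R : realType) (P : probability Omega R).
Variables (T : R) (d : nat) (X : R -> Omega -> 'cV[R]_d) (K : R -> R -> R) (v : R -> R).
Hypothesis T0 : 0 < T.
Hypothesis cgX : centered_gaussian P `[0, T] X K.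
Hypothesis KE : forall t s, 0 <= t -> 0 <= s -> K t s = 2^-1 * (v s + v t - v `|t - s|).
Hypothesis v0 : v 0 = 0.
Hypothesis v_gt0 : forall t, 0 < t -> 0 < v t.
Hypothesis v_mono : forall t s, 0 <= s <= t -> v s <= v t.
Hypothesis v_mid : forall t h, 0 <= h <= t -> v (t - h) + v (t + h) <= 2 * v t.
Hypothesis v_slow : forall b, 0 < b -> exists c a, [/\ 0 < c, 0 < a < b &
    forall t, 0 <= t -> c * t `^ a <= v t].
Variable i0 : 'I_d.

Local Notation M := (mean_cos T X v i0).
Local Notation mesh := (mesh T).
Local Notation grid := (grid T).
Local Notation inc := (grid_inc T X i0).

Let mesh_gt0 m : 0 < mesh m. Proof. by rewrite divr_gt0. Qed.

Lemma grid_partition m : itv_partition 0 T [seq grid m j | j <- iota 1 m.+1].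
Proof.
have gi j : grid m j < grid m j.+1.
  by rewrite /grid ltr_pM2r// ltr_nat.
have [] := path_incr_map 0 m.+1 gi; rewrite {1 3}/grid mul0r => h1 h2; split => //.
by rewrite h2 add0n /grid /mesh mulrCA divff ?mulr1// pnatr_eq0.
Qed.

Lemma big_zip_grid m (F : R * R -> R) :
  \sum_(x <- zip [seq grid m j | j <- iota 1 m.+1] (0 :: [seq grid m j | j <- iota 1 m.+1])) F x =
  \sum_(j < m.+1) F (grid m j.+1, grid m j).
Proof.
by have := big_zip_map (grid m) F 0 m.+1; rewrite {2}/grid mul0r => ->; rewrite big_mkord.
Qed.

Lemma measurable_grid_inc m j : (j <= m)%N -> measurable_fun setT (inc m j).
Proof.
have mX k : (k <= m.+1)%N -> measurable_fun setT (fun w => X (grid m k) w i0 0).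
  move=> km; have [] := centered_gaussian_coord cgX i0 (t := grid m k) => //.
  by rewrite /= in_itv/=; exact: grid_itv.
by move=> jm; apply: measurable_funB; apply: mX; rewrite ?ltnS// ltnW.
Qed.

Lemma measurable_mean_cos m : measurable_fun setT (M m).
Proof.
apply: measurable_funM => //; apply: measurable_sum => j; apply: measurable_fun_cos.
by apply: measurable_funM => //; apply: measurable_grid_inc; rewrite -ltnS.
Qed.

Lemma norm_mean_cos_le1 m w : `|M m w| <= 1.
Proof.
rewrite /mean_cos normrM gtr0_norm ?invr_gt0// ler_pdivrMl// mulr1.
apply: le_trans (ler_norm_sum _ _ _) _.
apply: le_trans (ler_sum _ (fun j _ => norm_cos_le1 _)) _.
by rewrite sumr_const card_ord.
Qed.

Lemma mean_cos_ge (theta : R) m : expR (- 2^-1) < theta ->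
  fine (P [set w | theta <= M m w]) <= 2 / m.+1%:R / (theta - expR (- 2^-1)) ^+ 2.
Proof.
set mu := expR _ => mt.
have mt0 : 0 < theta - mu by rewrite subr_gt0.
rewrite ler_pdivlMr ?exprn_gt0// mulrC.
apply: le_trans (mean_cos_variance T0 cgX KE v0 v_gt0 v_mono v_mid i0 m).
apply: Rmarkov.
- rewrite -[X in measurable X]setTI; apply: measurable_fun_le => //; exact: measurable_mean_cos.
- apply: (@bounded_integrable _ _ _ _ ((1 + `|mu|) ^+ 2)).
    by apply: measurable_funX; apply: measurable_funB => //; exact: measurable_mean_cos.
  move=> w; rewrite normrX lerXn2r ?nnegrE ?addr_ge0//.
  by apply: le_trans (ler_normB _ _) _; rewrite lerD2r norm_mean_cos_le1.
- by move=> w; exact: sqr_ge0.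
- exact: sqr_ge0.
- by move=> w /= tw; rewrite lerXn2r ?nnegrE ?(ltW mt0) ?lerD2r ?subr_ge0// (le_trans (ltW mt)).
Qed.

(** Convergence to 1 would place the path in every event [A m] from some rank on. Such an
    intersection has probability at most that of each of its members, which tends to 0 by
    Chebyshev's inequality. *)
Lemma ae_mean_cos_not1 : {ae P, forall w, ~ (M m w @[m --> \oo] --> (1 : R))}.
Proof.
set mu : R := expR (- 2^-1).
have mu1 : mu < 1 by rewrite -[ltRHS]expR0 ltr_expR; lra.
pose theta := 2^-1 * (1 + mu).
have mt : mu < theta by rewrite /theta; lra.
have t1 : theta < 1 by rewrite /theta; lra.
pose A m := [set w | theta <= M m w].
have mA m : measurable (A m).
  by rewrite -[X in measurable X]setTI; apply: measurable_fun_le => //; exact: measurable_mean_cos.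
pose B N := \bigcap_m A (N + m)%N.
have mB N : measurable (B N) by exact: bigcapT_measurable.
have PB N : P (B N) = 0%E.
  have Pfin : (P (B N) \is a fin_num)%E by exact: fin_num_measure.
  rewrite -(fineK Pfin); congr (_%:E); apply/eqP; rewrite eq_le fine_ge0// andbT.
  pose C := 2 / (theta - mu) ^+ 2.
  have l : C / m.+1%:R @[m --> \oo] --> (0 : R).
    by rewrite -(mulr0 C); apply: cvgMr; exact: cvg_harmonic.
  apply: (ler_cvg_to (cvg_cst (fine (P (B N)))) l); apply: nearW => m.
  apply: le_trans (_ : fine (P (A (N + m)%N)) <= _).
    apply: fine_le; [exact: Pfin|exact: fin_num_measure|].
    by apply: le_measure; rewrite ?inE// => w; apply.
  apply: le_trans (mean_cos_ge _ mt) _; rewrite mulrAC -/C ler_wpM2l//.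
    by rewrite divr_ge0// sqr_ge0.
  by rewrite lef_pV2 ?posrE// ler_nat ltnS leq_addl.
have : P.-negligible (\bigcup_N B N).
  by apply: negligible_bigcup => N; exists (B N); split; [exact: mB|exact: PB|].
apply: negligibleS => w /= /contrapT cw.
have /cvgrPdist_le /(_ (1 - theta)) [|N _ hN] := cw; first by rewrite subr_gt0.
exists N => // m _; have := hN (N + m)%N (leq_addr m N).
by rewrite /A/= => /ler_normlW; lra.
Qed.

Section finite_variation.
Variables (p : R) (f : R -> 'cV[R]_d).
Hypothesis p0 : 0 < p.
Hypothesis fp : (p_variation p 0 T f < +oo)%E.

Lemma p_variation_grid : exists C, forall m,
  \sum_(j < m.+1) `|f (grid m j.+1) i0 0 - f (grid m j) i0 0| `^ p <= C.
Proof.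
exists (fine (p_variation p 0 T f)) => m.
pose S := \sum_(j < m.+1) enorm (f (grid m j.+1) - f (grid m j)) `^ p.
have S0 : 0 <= S by apply: sumr_ge0 => j _; exact: powR_ge0.
have SV : (S%:E <= p_variation p 0 T f)%E.
  apply: ereal_sup_ubound; exists [seq grid m j | j <- iota 1 m.+1]; first exact: grid_partition.
  by rewrite (big_zip_grid m (fun x => enorm (f x.1 - f x.2) `^ p)).
have Vfin : (p_variation p 0 T f \is a fin_num)%E.
  by rewrite ge0_fin_numE// (le_trans _ SV)// lee_fin.
apply: (@le_trans _ _ S); last by rewrite -lee_fin fineK.
apply: ler_sum => j _; apply: ge0_ler_powR; rewrite ?nnegrE ?(ltW p0) ?sqrtr_ge0//.
by have := norm_coord_le_enorm (f (grid m j.+1) - f (grid m j)) i0; rewrite !mxE.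
Qed.

End finite_variation.

Lemma finite_variation_mean_cos (p : R) w : 0 < p -> (p_variation p 0 T (X ^~ w) < +oo)%E ->
  M m w @[m --> \oo] --> (1 : R).
Proof.
move=> p0 /(p_variation_grid p0)[C hC].
(* The total p-variation contributes to 1 - M at most a multiple of mesh v(mesh)^(-p/2), hence of
   mesh^(1 - a p/2); the exponent is positive because a < 2 / p. *)
have [|c [a [c0 /andP[a0 ab] va]]] := v_slow (b := 2 / p); first by rewrite divr_gt0.
pose g := 1 - a * p / 2.
have g0 : 0 < g by rewrite /g subr_gt0 ltr_pdivrMr// mul1r -ltr_pdivlMr.
have C0 : 0 <= C by apply: le_trans (hC 0%N); apply: sumr_ge0 => j _; exact: powR_ge0.
have bound del m : 0 < del -> 1 - M m w <= del ^+ 2 / 2 +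
    (2 * C / T * (del * Num.sqrt c)^-1 `^ p) * mesh m `^ g.
  move=> d0; set sg := Num.sqrt (v (mesh m)).
  have sg0 : 0 < sg by rewrite sqrtr_gt0 v_gt0.
  have dc0 : 0 < del * Num.sqrt c by rewrite mulr_gt0// sqrtr_gt0.
  have h1 : 1 - M m w <= del ^+ 2 / 2 + m.+1%:R^-1 * (2 * (C * (del * sg)^-1 `^ p)).
    have -> : 1 - M m w = m.+1%:R^-1 * \sum_(j < m.+1) (1 - cos (inc m j w / sg)).
      rewrite sumrB sumr_const card_ord mulrBr /mean_cos -/sg; congr (_ - _).
      by rewrite mulVf// pnatr_eq0.
    have le j : 1 - cos (inc m j w / sg) <= del ^+ 2 / 2 + 2 * (`|inc m j w| `^ p * (del * sg)^-1 `^ p).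
      apply: le_trans (one_sub_cos_le_powR _ p0 d0) _.
      have -> : `|inc m j w / sg| / del = `|inc m j w| * (del * sg)^-1.
        by rewrite normrM normfV (gtr0_norm sg0) invfM mulrA mulrAC.
      by rewrite powRM// ?invr_ge0 ?mulr_ge0 ?ltW.
    have sle : \sum_(j < m.+1) (1 - cos (inc m j w / sg)) <=
        \sum_(j < m.+1) (del ^+ 2 / 2 + 2 * (`|inc m j w| `^ p * (del * sg)^-1 `^ p)).
      by apply: ler_sum => j _; exact: le.
    have m0 : 0 <= m.+1%:R^-1 :> R by rewrite invr_ge0.
    apply: le_trans (ler_wpM2l m0 sle) _.
    rewrite big_split/= sumr_const card_ord -[(del ^+ 2 / 2) *+ _]mulr_natl mulrDr [X in X + _]mulrA mulVf ?pnatr_eq0// mul1r.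
    rewrite lerD2l ler_pM2l ?invr_gt0// -mulr_sumr -mulr_suml ler_pM2l//.
    by rewrite ler_wpM2r ?powR_ge0//; exact: hC.
  apply: le_trans h1 _; rewrite lerD2l.
  have sgc : Num.sqrt c * mesh m `^ (a / 2) <= sg.
    rewrite -[leLHS]ger0_norm ?mulr_ge0 ?sqrtr_ge0 ?powR_ge0// -sqrtr_sqr ler_wsqrtr//.
    rewrite exprMn sqr_sqrtr ?(ltW c0)// -powR_mulrn ?powR_ge0// -powRrM divfK ?pnatr_eq0//.
    by apply: va; exact: ltW.
  have h2 : (del * sg)^-1 `^ p <= (del * Num.sqrt c)^-1 `^ p * mesh m `^ (- (a * p / 2)).
    rewrite (_ : - (a * p / 2) = - (a / 2) * p); last by field.
    rewrite powRrM -powRM ?invr_ge0 ?powR_ge0 ?(ltW dc0)//.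
    apply: ge0_ler_powR; rewrite ?nnegrE ?(ltW p0)//.
    - by rewrite invr_ge0 mulr_ge0 ?ltW.
    - by rewrite mulr_ge0 ?powR_ge0 ?invr_ge0 ?ltW.
    rewrite powRN -invfM lef_pV2 ?posrE ?mulr_gt0 ?powR_gt0 ?sqrtr_gt0 ?v_gt0//.
    by rewrite -mulrA ler_pM2l.
  have eg : mesh m `^ g = mesh m * mesh m `^ (- (a * p / 2)).
    by rewrite /g powRD ?powRr1 ?(ltW (mesh_gt0 m))// (gt_eqF (mesh_gt0 m)) implybT.
  have em : m.+1%:R^-1 = mesh m / T by rewrite /mesh mulrAC divff ?mul1r// gt_eqF.
  have {}h2 := ler_wpM2l (_ : 0 <= mesh m / T * (2 * C)) h2.
  rewrite em eg (_ : _ * (2 * (C * _)) = mesh m / T * (2 * C) * (del * sg)^-1 `^ p); last by ring.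
  apply: le_trans (h2 _) _.
    by rewrite mulr_ge0 ?(mulr_ge0 _ C0)// divr_ge0 ?(ltW (mesh_gt0 m)) ?(ltW T0).
  by rewrite le_eqVlt; apply/orP; left; apply/eqP; ring.
apply/cvgrPdist_le => e e0.
have sqe : 0 < Num.sqrt e by rewrite sqrtr_gt0.
(* With the threshold del = sqrt e the first term of [bound] is e / 2, which leaves e / 2 for the
   second. *)
pose D := 2 * C / T * (Num.sqrt e * Num.sqrt c)^-1 `^ p.
have l : D * mesh m `^ g @[m --> \oo] --> (0 : R).
  rewrite -(mulr0 D); apply: cvgMr; apply: cvg_powR0 => // [m|]; first exact: ltW.
  by rewrite -(mulr0 T); apply: cvgMr; exact: cvg_harmonic.
have e2 : 0 < e / 2 by rewrite divr_gt0.
move/cvgrPdist_le : l => /(_ _ e2); apply: filterS => m.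
rewrite sub0r normrN => /ler_normlW h; rewrite ler_norml.
have := bound _ m sqe; rewrite sqr_sqrtr ?(ltW e0)// -/D.
have := norm_mean_cos_le1 m w; rewrite ler_norml => /andP[_].
by move: h; move: (D * _) (M m w) => q r h1 h2 h3; apply/andP; split; lra.
Qed.

Lemma ae_p_variation_infinite (p : R) : 0 < p -> {ae P, forall w, p_variation p 0 T (X ^~ w) = +oo%E}.
Proof.
move=> p0; move: ae_mean_cos_not1; apply: filterS => w hw.
have [//|] := eqVneq (p_variation p 0 T (X ^~ w)) +oo%E.
rewrite -ltey => /(finite_variation_mean_cos p0) h.
by case: (hw h).
Qed.

End infinite_variation.

(** * Failure of the semimartingale property *)

Section square_function_path.
Context {R : realType}.
Implicit Types (l : R) (N : nat -> R).

(** The indicator of the event that the path has not left [-l, l] before time k. *)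
Fixpoint alive l N k : R := if k is k'.+1 then alive l N k' * \1_`[- l, l] (N k) else 1.

(** A sign with value 1 at 0, written through an indicator so that measurability is immediate. *)
Definition sgn1 (x : R) : R := 2 * \1_`[0, +oo[ x - 1.

(** The sum of the integrands of [square_function_alive] and of [l] times
    [exit_cost]. *)
Definition square_integrand l N k : R :=
  3 * l * sgn1 (N k) * (1 - alive l N k) + 2 * N k * alive l N k.

Lemma sgn1E (x : R) : sgn1 x = if 0 <= x then 1 else - 1.
Proof.
rewrite /sgn1 indicE; have [x0|x0] := leP 0 x.
  by rewrite mem_set ?mulr1/=; [ring|rewrite in_itv/= x0].
by rewrite memNset ?mulr0 ?sub0r//= in_itv/= andbT leNgt x0.
Qed.

Lemma sgn1_norm (x : R) : sgn1 x * x = `|x|.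
Proof. by rewrite sgn1E; case: ger0P => _; rewrite ?mul1r ?mulN1r. Qed.

Lemma sgn1_le (x y : R) : sgn1 x * y <= `|y|.
Proof. by rewrite sgn1E; case: ifP => _; rewrite ?mul1r ?mulN1r ?ler_norm// -normrN ler_norm. Qed.

Lemma alive01 l N k : alive l N k = 0 \/ alive l N k = 1.
Proof.
elim: k => [|k [IH|IH]] /=; [by right|by left; rewrite IH mul0r|].
by rewrite IH mul1r indicE; case: (_ \in _); [right|left].
Qed.

Lemma alive_norm l N k : 0 <= l -> N 0%N = 0 -> `|N k| * alive l N k <= l * alive l N k.
Proof.
move=> l0 N0; case: k => [|k]; first by rewrite N0 normr0 mul0r mulr_ge0.
have [->|a1] := alive01 l N k.+1; first by rewrite !mulr0.
rewrite a1 !mulr1; move: a1 => /=; rewrite indicE.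
have [/set_mem|] := boolP (N k.+1 \in `[- l, l]%classic); last by rewrite mulr0 => _ /eqP; rewrite eq_sym oner_eq0.
by rewrite /= in_itv/= ler_norml.
Qed.

Lemma aliveS l N k : alive l N k.+1 <= alive l N k.
Proof.
have [|] := alive01 l N k => /= ->; first by rewrite mul0r.
by rewrite mul1r indicE lern1 leq_b1.
Qed.

Lemma alive_exit l N k : alive l N k - alive l N k.+1 = 0 \/
  [/\ alive l N k = 1, alive l N k.+1 = 0 & l <= `|N k.+1|].
Proof.
rewrite /= indicE; have [->|->] := alive01 l N k; first by left; rewrite mul0r subrr.
have [|] := boolP (N k.+1 \in `[- l, l]%classic); first by left; rewrite mulr1 subrr.
rewrite notin_setE/= in_itv/= -ler_norml => /negP; rewrite -ltNge => h.
by right; split; rewrite ?mul1r// ltW.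
Qed.

Lemma square_integrand_bound l N k : 0 <= l -> N 0%N = 0 -> `|square_integrand l N k| <= 3 * l.
Proof.
move=> l0 N0; rewrite /square_integrand.
have := alive_norm k l0 N0; have [->|->] := alive01 l N k.
  move=> _; rewrite subr0 mulr0 addr0 mulr1 sgn1E; case: ifP => _.
    by rewrite mulr1 ger0_norm// mulr_ge0.
  by rewrite mulrN1 normrN ger0_norm// mulr_ge0.
by rewrite !mulr1 subrr mulr0 add0r normrM ger0_norm// => h; lra.
Qed.

Let D N k := N k.+1 - N k.

(** Induction on n. While the path is alive, this is the discrete Ito formula for N^2; afterwards
    |N| grows at least by sgn(N) times the increment. At the exit step |N_k| <= l gives 2 N_k
    N_(k+1) <= 2 l |N_(k+1)|, whence the weight 2 l of |N| after the exit. *)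
Lemma square_function_alive l N n : 0 <= l -> N 0%N = 0 ->
  \sum_(k < n) (D N k) ^+ 2 * alive l N k.+1 <=
    N n ^+ 2 * alive l N n + 2 * l * `|N n| * (1 - alive l N n)
    - \sum_(k < n) (2 * N k * alive l N k + 2 * l * sgn1 (N k) * (1 - alive l N k)) * D N k.
Proof.
move=> l0 N0; elim: n => [|n IH].
  by rewrite !big_ord0 N0 expr0n/= normr0; lra.
rewrite !big_ord_recr /=.
move: IH; move: (\sum_(k < n) _) (\sum_(k < n) _) => S I IH.
rewrite -/(alive l N n.+1).
have hn := alive_norm n l0 N0; have hn1 := alive_norm n.+1 l0 N0.
have hs := sgn1_norm (N n); have hs1 := sgn1_le (N n) (N n.+1).
have nn := normr_ge0 (N n); have nn1 := normr_ge0 (N n.+1).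
have q (z : R) : `|z| ^+ 2 = z ^+ 2 by rewrite real_normK ?num_real.
have := alive_exit l N n; rewrite /D => -[e|[a1 a0 out]].
  have e' : alive l N n.+1 = alive l N n by lra.
  rewrite e'; have [a|a] := alive01 l N n; rewrite a in IH *.
    have h := mulr_ge0 l0 (_ : 0 <= `|N n.+1| - sgn1 (N n) * N n.+1).
    rewrite subr_ge0 in h; have {}h := h hs1.
    rewrite !mulr0 !subr0 !mulr1 !addr0 ?add0r in IH *.
    have e1 : 2 * l * sgn1 (N n) * (N n.+1 - N n) = 2 * l * (sgn1 (N n) * N n.+1) - 2 * l * `|N n|.
      by rewrite -hs; ring.
    by rewrite e1; lra.
  rewrite !subrr !mulr0 !mulr1 !addr0 in IH *.
  have e1 : (N n.+1 - N n) ^+ 2 = N n.+1 ^+ 2 - N n ^+ 2 - 2 * N n * (N n.+1 - N n) by ring.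
  by rewrite e1; lra.
rewrite a1 in IH hn; rewrite a1 a0; rewrite !subrr !mulr0 !mulr1 !addr0 ?add0r !subr0 in IH hn *.
have h1 : N n * N n.+1 <= l * `|N n.+1|.
  apply: le_trans (ler_norm _) _; rewrite normrM ler_wpM2r//.
have h2 := sqr_ge0 (N n).
have e1 : 2 * N n * (N n.+1 - N n) = 2 * (N n * N n.+1) - 2 * N n ^+ 2 by ring.
by rewrite e1; lra.
Qed.

(** At the exit |N| is at least l, and from then on |N| minus the stochastic sum does not
    decrease. *)
Lemma exit_cost l N n : 0 <= l ->
  l * (1 - alive l N n) <= `|N n| * (1 - alive l N n) -
    \sum_(k < n) sgn1 (N k) * (1 - alive l N k) * D N k.
Proof.
move=> l0; elim: n => [|n IH]; first by rewrite big_ord0 /= subrr !mulr0 subrr.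
rewrite big_ord_recr/=; move: IH; move: (\sum_(k < n) _) => I IH.
rewrite -/(alive l N n.+1).
have hs := sgn1_norm (N n); have hs1 := sgn1_le (N n) (N n.+1).
have e1 : sgn1 (N n) * D N n = sgn1 (N n) * N n.+1 - `|N n| by rewrite /D mulrBr hs.
have := alive_exit l N n => -[e|[a1 a0 out]].
  have e' : alive l N n.+1 = alive l N n by lra.
  rewrite e'; have [a|a] := alive01 l N n; rewrite a in IH *.
    by rewrite !subr0 !mulr1 in IH *; rewrite e1; lra.
  by rewrite !subrr !mulr0 mul0r in IH *; lra.
rewrite a1 in IH; rewrite a1 a0; rewrite !subrr !mulr0 !mul0r !subr0 !mulr1 in IH *.
by lra.
Qed.

(** [square_function_alive] plus l times [exit_cost]. The boundary terms N^2 before the exit and 2 l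
    |N| + l |N| after it are all at most 3 l |N|. *)
Lemma square_function_le l N n : 0 <= l -> N 0%N = 0 ->
  alive l N n * \sum_(k < n) (N k.+1 - N k) ^+ 2 + l ^+ 2 * (1 - alive l N n) <=
  3 * l * `|N n| - \sum_(k < n) square_integrand l N k * (N k.+1 - N k).
Proof.
move=> l0 N0.
have h1 := square_function_alive n l0 N0; have h2 := exit_cost N n l0.
have an k : (k <= n)%N -> alive l N n <= alive l N k.
  elim: n {h1 h2} => [|n IH]; first by rewrite leqn0 => /eqP ->.
  by rewrite leq_eqVlt => /orP[/eqP -> //|kn]; exact: le_trans (aliveS _ _ _) (IH kn).
have h3 : alive l N n * \sum_(k < n) (N k.+1 - N k) ^+ 2 <= \sum_(k < n) D N k ^+ 2 * alive l N k.+1.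
  rewrite mulr_sumr; apply: ler_sum => k _; rewrite mulrC ler_wpM2l ?sqr_ge0//.
  exact: an.
have e : \sum_(k < n) square_integrand l N k * (N k.+1 - N k) =
    \sum_(k < n) (2 * N k * alive l N k + 2 * l * sgn1 (N k) * (1 - alive l N k)) * D N k +
    l * \sum_(k < n) sgn1 (N k) * (1 - alive l N k) * D N k.
  rewrite mulr_sumr -big_split/=; apply: eq_bigr => k _; rewrite /square_integrand /D.
  by ring.
have h4 := ler_wpM2l l0 h2.
have h5 : N n ^+ 2 * alive l N n <= l * `|N n| * alive l N n.
  have := ler_wpM2l (normr_ge0 (N n)) (alive_norm n l0 N0).
  by rewrite -[N n ^+ 2]real_normK ?num_real// expr2; lra.
rewrite e; set A1 := \sum_(k < n) (N k.+1 - N k) ^+ 2 in h3 *.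
set A2 := \sum_(k < n) D N k ^+ 2 * _ in h1 h3; set A3 := \sum_(k < n) (2 * _ * _ + _) * _ in h1 *.
set A4 := \sum_(k < n) sgn1 _ * _ * _ in h2 h4 *.
move: A1 A2 A3 A4 h1 h2 h3 h4 => A1 A2 A3 A4 h1 h2 h3 h4.
have h6 : 0 <= l * `|N n| * alive l N n.
  by rewrite !mulr_ge0//; have [->|->] := alive01 l N n.
lra.
Qed.

End square_function_path.

Lemma measurable_indic_comp dsp (U : measurableType dsp) (R : realType) (f : U -> R) (A : set R) :
  measurable A -> measurable_fun setT f -> measurable_fun setT (fun w => \1_A (f w) : R).
Proof.
move=> mA mf; rewrite (_ : (fun w => _) = \1_(f @^-1` A) :> (U -> R)).
  by apply: measurable_indic; rewrite -[X in measurable X]setTI; exact: mf.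
by apply/funext => w; rewrite !indicE; congr (_%:R); apply/idP/idP; rewrite !inE.
Qed.

(** * A weak-type inequality for the square function of a martingale *)

Section discrete_martingale.
Context dsp (Omega : measurableType dsp) (R : realType) (P : probability Omega R).

Lemma sigma_algebra_measurable_fun (G : set (set Omega)) (f : Omega -> R) : sigma_algebra setT G ->
  measurable_fun setT (f : g_sigma_algebraType G -> R) <-> (forall C, measurable C -> G (f @^-1` C)).
Proof.
move=> sG; have e : <<s G >> = G by exact: sigma_algebra_id.
split=> [mf C mC|h _ C mC].
  by have := mf measurableT C mC; rewrite setTI /measurable/= e.
by rewrite setTI /measurable/= e; exact: h.
Qed.

Variables (n : nat) (N : nat -> Omega -> R) (G : nat -> set (set Omega)).
Hypothesis sG : forall k, (k <= n)%N -> sigma_algebra setT (G k) /\ G k `<=` measurable.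
Hypothesis GS : forall j k, (j <= k)%N -> (k <= n)%N -> G j `<=` G k.
Hypothesis N0 : forall w, N 0 w = 0.
Hypothesis mgN : forall k, (k < n)%N -> cond_expectation P (G k) (N k.+1) (N k).
Hypothesis Nn : P.-integrable setT (EFin \o N n).

Let intN k : (k <= n)%N -> P.-integrable setT (EFin \o N k).
Proof.
by rewrite leq_eqVlt => /orP[/eqP -> //|kn]; have [_ ? _ _] := mgN kn.
Qed.

Let measN j k : (j <= k)%N -> (k < n)%N -> measurable_fun setT (N j : g_sigma_algebraType (G k) -> R).
Proof.
move=> jk kn; have [sk _] := sG (ltnW kn).
apply/(sigma_algebra_measurable_fun _ sk) => C mC.
apply: (GS jk (ltnW kn)); have [_ _ h _] := mgN (leq_ltn_trans jk kn).
exact: h.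
Qed.

Let meas_integrand l k : (k < n)%N ->
  measurable_fun setT ((fun w => square_integrand l (N ^~ w) k) : g_sigma_algebraType (G k) -> R).
Proof.
move=> kn.
have ma j : (j <= k)%N -> measurable_fun setT ((fun w => alive l (N ^~ w) j) : g_sigma_algebraType (G k) -> R).
  elim: j => [|j IH] jk; first exact: measurable_cst.
  apply: measurable_funM; first by apply: IH; exact: ltnW.
  apply: measurable_indic_comp; first exact: measurable_itv.
  exact: measN.
have mN := measN (leqnn k) kn.
have ms : measurable_fun setT ((fun w => sgn1 (N k w)) : g_sigma_algebraType (G k) -> R).
  apply: measurable_funB => //; apply: measurable_funM => //.
  by apply: measurable_indic_comp; first exact: measurable_itv.
have mak := ma k (leqnn k).
apply: measurable_funD.
  apply: measurable_funM; first exact: measurable_funM.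
  exact: measurable_funB.
by apply: measurable_funM => //; exact: measurable_funM.
Qed.

(** On the event, the left-hand side of [square_function_le] is at least l^2, whether or not the
    path has left [-l, l]. The integrand of the stochastic sum is bounded by 3 l, so for a merely
    integrable martingale that sum is integrable with mean zero; Markov's inequality concludes. *)
Lemma martingale_square_function l : 0 <= l ->
  l ^+ 2 * fine (P [set w | l ^+ 2 <= \sum_(k < n) (N k.+1 w - N k w) ^+ 2]) <=
  3 * l * \int[P]_w `|N n w|.
Proof.
move=> l0.
have measN' k : (k <= n)%N -> measurable_fun setT (N k).
  by move=> kn; have /integrableP[/measurable_EFinP] := intN kn.
pose g k w := square_integrand l (N ^~ w) k.
have Gg k : (k < n)%N -> forall C, measurable C -> G k (g k @^-1` C).
  by move=> kn; have [sk _] := sG (ltnW kn); apply/(sigma_algebra_measurable_fun _ sk); exact: meas_integrand.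
have mg k : (k < n)%N -> measurable_fun setT (g k).
  by move=> kn _ C mC; rewrite setTI; have [_] := sG (ltnW kn); apply; exact: Gg.
have gb k w : `|g k w| <= 3 * l by exact: square_integrand_bound.
have ibd f k : (k < n)%N -> P.-integrable setT (EFin \o f) -> P.-integrable setT (EFin \o (fun w => g k w * f w)).
  move=> kn fi; have /integrableP[/measurable_EFinP mf _] := fi.
  have fC : P.-integrable setT (fun w => (3 * l)%:E * (f w)%:E)%E by exact: integrableZl.
  apply: le_integrable fC => //; first by apply/measurable_EFinP; apply: measurable_funM => //; exact: mg.
  move=> w _ /=; rewrite lee_fin !normrM ler_wpM2r//.
  by apply: le_trans (gb k w) _; rewrite -normrM ler_norm.
have gD k : (k < n)%N -> P.-integrable setT (EFin \o (fun w => g k w * (N k.+1 w - N k w))) /\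
    \int[P]_w (g k w * (N k.+1 w - N k w)) = 0.
  move=> kn; have i1 := ibd _ _ kn (intN kn); have i2 := ibd _ _ kn (intN (ltnW kn)).
  have e : (fun w => g k w * (N k.+1 w - N k w)) = (fun w => g k w * N k.+1 w - g k w * N k w).
    by apply/funext => w; rewrite mulrBr.
  split; first by rewrite e; have := integrableB measurableT i1 i2; apply: eq_integrable => // w _ /=.
  under eq_Rintegral do rewrite mulrBr.
  rewrite RintegralB//; have [_ Gm] := sG (ltnW kn).
  by rewrite (cond_expectation_orth (mgN kn) Gm (mg k kn) (gb k) (Gg k kn)) subrr.
pose f w := 3 * l * `|N n w| - \sum_(k < n) g k w * (N k.+1 w - N k w).
have [iS eS] := Rintegral_sum (s := index_enum 'I_n) (F := fun (k : 'I_n) w => g k w * (N k.+1 w - N k w))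
  (fun k _ => (gD k (ltn_ord k)).1).
have iA : P.-integrable setT (EFin \o (fun w => `|N n w|)).
  by have := integrable_abse Nn; apply: eq_integrable => // w _ /=.
have iA' : P.-integrable setT (EFin \o (fun w => 3 * l * `|N n w|)).
  by rewrite (_ : EFin \o _ = (fun w => (3 * l)%:E * (`|N n w|)%:E)%E)//; exact: integrableZl.
have fi : P.-integrable setT (EFin \o f).
  by have := integrableB measurableT iA' iS; apply: eq_integrable => // w _ /=.
have -> : 3 * l * \int[P]_w `|N n w| = \int[P]_w f w.
  rewrite /f RintegralB// eS big1 ?subr0; last by move=> k _; exact: (gD k (ltn_ord k)).2.
  by rewrite RintegralZl.
have fge w : alive l (N ^~ w) n * \sum_(k < n) (N k.+1 w - N k w) ^+ 2 + l ^+ 2 * (1 - alive l (N ^~ w) n) <= f w.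
  exact: square_function_le.
apply: Rmarkov => //.
- rewrite -[X in measurable X]setTI; apply: measurable_fun_le => //.
  apply: measurable_sum => k; apply: measurable_funX; apply: measurable_funB; apply: measN' => //.
  exact: ltnW.
- move=> w; apply: le_trans (fge w).
  have S0 : 0 <= \sum_(k < n) (N k.+1 w - N k w) ^+ 2 by apply: sumr_ge0 => k _; exact: sqr_ge0.
  have [->|->] := alive01 l (N ^~ w) n; rewrite ?mul0r ?subr0 ?mulr1 ?add0r ?sqr_ge0//.
  by rewrite mul1r subrr mulr0 addr0.
- exact: sqr_ge0.
- move=> w /= hw; apply: le_trans (fge w).
  have [->|->] := alive01 l (N ^~ w) n; rewrite ?mul0r ?subr0 ?mulr1 ?add0r//.
  by rewrite mul1r subrr mulr0 addr0.
Qed.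

End discrete_martingale.

Section eventually.
Context dsp (Omega : measurableType dsp) (R : realType) (P : probability Omega R).

Lemma ae_eventually_prob (E : nat -> set Omega) (e : R) : (forall n, measurable (E n)) ->
  (forall n m, (n <= m)%N -> E n `<=` E m) -> {ae P, forall w, exists n, E n w} -> 0 < e ->
  exists n, fine (P (~` E n)) < e.
Proof.
move=> mE nE aeE e0.
have PU : P (\bigcup_n E n) = 1%E.
  have mU : measurable (\bigcup_n E n) by exact: bigcupT_measurable.
  have P0 : P (~` (\bigcup_n E n)) = 0%E.
    apply/measure_negligible; first exact: measurableC.
    apply: negligibleS aeE => w /= h [n En]; apply: h; exists n => //.
  rewrite -[\bigcup_n E n]setCK probability_setC ?P0 ?sube0//.
  exact: measurableC.
have : P (E n) @[n --> \oo] --> 1%E.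
  rewrite -PU; apply: nondecreasing_cvg_mu => //; first exact: bigcupT_measurable.
  by move=> n m nm; apply/subsetPset; exact: nE.
move/fine_cvgP => [_] /cvgrPdist_lt /(_ e e0)[n _ /(_ n (leqnn n))] /= h.
exists n; rewrite probability_setC// fineB//; last exact: fin_num_measure.
by apply: le_lt_trans h; rewrite ler_norm.
Qed.

End eventually.

Lemma sum_sqr_le (R : realType) n (x : 'I_n -> R) (L : R) :
  \sum_(j < n) `|x j| <= L -> \sum_(j < n) x j ^+ 2 <= L ^+ 2.
Proof.
move=> xL; have L0 : 0 <= L by apply: le_trans xL; exact: sumr_ge0.
have xjL j : `|x j| <= L.
  by apply: le_trans xL; rewrite (bigD1 j)//= lerDl sumr_ge0.
apply: le_trans (_ : \sum_(j < n) L * `|x j| <= _).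
  apply: ler_sum => j _; rewrite -[x j ^+ 2]real_normK ?num_real// expr2.
  by rewrite ler_wpM2r.
by rewrite -mulr_sumr expr2 ler_wpM2l.
Qed.

Section not_semimartingale.
Context dsp (Omega : measurableType dsp) (R : realType) (P : probability Omega R).
Variables (T : R) (d : nat) (X : R -> Omega -> 'cV[R]_d) (K : R -> R -> R) (v : R -> R).
Hypothesis T0 : 0 < T.
Hypothesis cgX : centered_gaussian P `[0, T] X K.
Hypothesis KE : forall t s, 0 <= t -> 0 <= s -> K t s = 2^-1 * (v s + v t - v `|t - s|).
Hypothesis v0 : v 0 = 0.
Hypothesis v_gt0 : forall t, 0 < t -> 0 < v t.
Hypothesis v_mono : forall t s, 0 <= s <= t -> v s <= v t.
Hypothesis v_mid : forall t h, 0 <= h <= t -> v (t - h) + v (t + h) <= 2 * v t.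
Hypothesis v_slow : forall b, 0 < b -> exists c a, [/\ 0 < c, 0 < a < b &
    forall t, 0 <= t -> c * t `^ a <= v t].
Variable i0 : 'I_d.

Local Notation M := (mean_cos T X v i0).
Local Notation mesh := (mesh T).
Local Notation grid := (grid T).
Local Notation inc := (grid_inc T X i0).

Let mesh_gt0 m : 0 < mesh m. Proof. by rewrite divr_gt0. Qed.

(** The bound 1 - cos x <= x^2 / 2 at the normalized increments: an average of cosines away from 1
    forces a large quadratic variation. *)
Let quadratic_variation_ge m w :
  2 * (m.+1%:R * v (mesh m)) * (1 - M m w) <= \sum_(j < m.+1) inc m j w ^+ 2.
Proof.
set sg := Num.sqrt (v (mesh m)).
have vm : 0 < v (mesh m) by exact: v_gt0.
have sg2 : sg ^+ 2 = v (mesh m) by rewrite sqr_sqrtr// ltW.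
have sg0 : sg != 0 by rewrite gt_eqF// sqrtr_gt0.
have -> : 2 * (m.+1%:R * v (mesh m)) * (1 - M m w) =
    \sum_(j < m.+1) 2 * v (mesh m) * (1 - cos (inc m j w / sg)).
  rewrite -mulr_sumr sumrB sumr_const card_ord /mean_cos -/sg.
  have m0 : m.+1%:R != 0 :> R by rewrite pnatr_eq0.
  by move: (\sum_(j < m.+1) _) => S; move: (m.+1%:R : R) m0 => x x0; field.
apply: ler_sum => j _; have := one_sub_cos_le (inc m j w / sg).
rewrite exprMn exprVn sg2 ler_pdivlMr// ler_pdivlMr//.
by rewrite mulrC mulrA (mulrC (v _)) => h; rewrite (mulrC 2) -mulrA (mulrC 2) mulrA mulrC mulrA; lra.
Qed.

Let cvg_mesh_powR a : 0 < a -> mesh m `^ a @[m --> \oo] --> (0 : R).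
Proof.
move=> a0; apply: cvg_powR0 => // [m|]; first exact: ltW.
by rewrite -(mulr0 T); apply: cvgMr; exact: cvg_harmonic.
Qed.

(** The expected quadratic variation (m + 1) v(mesh) is at least a multiple of mesh^(a - 1) with a <
    1. *)
Let variance_blowup L : exists N, forall m, (N <= m)%N -> L < 2^-1 * (m.+1%:R * v (mesh m)).
Proof.
have [|c [a [c0 /andP[a0 a1] va]]] := v_slow (b := 1); first exact: ltr01.
pose L' := `|L| + 1.
have L'0 : 0 < L' by rewrite ltr_wpDl.
have e0 : 0 < T * c / (2 * L') by rewrite divr_gt0 ?mulr_gt0.
have a1' : 0 < 1 - a by rewrite subr_gt0.
move/cvgrPdist_le : (cvg_mesh_powR a1') => /(_ _ e0)[N _ hN].
exists N => m Nm; have := hN m Nm; rewrite /= sub0r normrN ger0_norm ?powR_ge0//.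
rewrite ler_pdivlMr ?mulr_gt0// => h.
apply: (@lt_le_trans _ _ L'); first by rewrite /L' (le_lt_trans (ler_norm L))// ltrDl.
have hm := mesh_gt0 m; have pa : 0 < mesh m `^ a by rewrite powR_gt0.
have em : mesh m = mesh m `^ (1 - a) * mesh m `^ a.
  by rewrite -powRD ?subrK ?powRr1// ?ltW// (gt_eqF hm) implybT.
have eT : m.+1%:R * mesh m = T by rewrite /mesh mulrC divfK// pnatr_eq0.
have vm : c * mesh m `^ a <= v (mesh m) by apply: va; exact: ltW.
have h2 := ler_wpM2r (ltW pa) h.
have h3 : L' * mesh m <= 2^-1 * T * (c * mesh m `^ a) by rewrite {1}em; lra.
rewrite -(ler_pM2r hm); apply: le_trans h3 _.
have -> : 2^-1 * (m.+1%:R * v (mesh m)) * mesh m = 2^-1 * (m.+1%:R * mesh m) * v (mesh m) by ring.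
by rewrite eT ler_wpM2l// mulr_ge0// ltW.
Qed.

Let bad_prob : exists N, forall m, (N <= m)%N -> fine (P [set w | 3 / 4 <= M m w]) < 4^-1.
Proof.
set mu : R := expR (- 2^-1).
(* From e^(1/2) >= 3/2 one gets e^(-1/2) <= 2/3. *)
have mu34 : mu < 3 / 4.
  have h1 : mu * expR (2^-1) = 1 by rewrite -expRD addrC subrr expR0.
  have h2 : 1 + 2^-1 <= expR (2^-1) :> R by exact: expR_ge1Dx.
  have h3 : 0 < mu by exact: expR_gt0.
  have := ler_wpM2l (ltW h3) h2; rewrite h1; lra.
pose C := 2 / (3 / 4 - mu) ^+ 2.
have l : C / m.+1%:R @[m --> \oo] --> (0 : R).
  by rewrite -(mulr0 C); apply: cvgMr; exact: cvg_harmonic.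
have q0 : 0 < 4^-1 :> R by rewrite invr_gt0.
move/cvgrPdist_lt : l => /(_ _ q0)[N _ hN].
exists N => m Nm; have := hN m Nm; rewrite /= sub0r normrN => h.
apply: le_lt_trans (le_lt_trans (ler_norm _) h).
apply: le_trans (mean_cos_ge T0 cgX KE v0 v_gt0 v_mono v_mid i0 m mu34) _.
by rewrite mulrAC.
Qed.

(** Off four events of probability less than 1/4 each, the quadratic variation
    of [X] along the grid would have to stay bounded. *)
Lemma gaussian_not_semimartingale : ~ semimartingale P T X.
Proof.
move=> [F [[Fs Fmono] /(_ i0)[Mt [A [[[adM _ [tau [stau ndtau extau mgtau]]] Mt0] adA _ bvA XMA]]]]].
have mA t : 0 <= t <= T -> measurable_fun setT (A t).
  move=> tT _ C mC; rewrite setTI; have [_ Fm] := Fs t tT.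
  by apply: Fm; exact: adA.
have mtau k : measurable [set w | T <= tau k w].
  (* A stopping time only gives the events tau <= t with t in [0, T]; the times T - mesh p stay in
     this interval and increase to T. *)
  rewrite (_ : [set w | T <= tau k w] = \bigcap_p ~` [set w | tau k w <= T - mesh p]).
    apply: bigcapT_measurable => p; apply: measurableC.
    have tp : 0 <= T - mesh p <= T.
      rewrite subr_ge0 gerBl (ltW (mesh_gt0 p)) andbT /mesh.
      by rewrite ler_pdivrMr//; apply: ler_peMr; [exact: ltW|rewrite ler1n].
    have [_ Fm] := Fs _ tp; apply: Fm; exact: (stau k).2.
  apply/seteqP; split=> w /=.
    move=> h p _ /=; apply/negP; rewrite -ltNge; apply: lt_le_trans h.
    by rewrite gtrBl.
  move=> h; rewrite leNgt; apply/negP => tw.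
  have d0 : 0 < T - tau k w by rewrite subr_gt0.
  have /cvgrPdist_le /(_ _ d0)[p _ /(_ p (leqnn p))] : mesh m @[m --> \oo] --> (0 : R).
    by rewrite -(mulr0 T); apply: cvgMr; exact: cvg_harmonic.
  rewrite /= sub0r normrN => /ler_normlW hp.
  by apply: (h p I) => /=; lra.
(* Intersecting over all k >= n makes these events increasing in n everywhere, while the stopping
   times are monotone only almost surely. *)
pose E2 n := \bigcap_(k in [set k | (n <= k)%N]) [set w | T <= tau k w].
have mE2 n : measurable (E2 n) by apply: bigcap_measurable => [|k _]; [exists n => /=|exact: mtau].
have q0 : 0 < 4^-1 :> R by rewrite invr_gt0.
have [k0 hk0] : exists n, fine (P (~` E2 n)) < 4^-1.
  apply: ae_eventually_prob => //.
    by move=> n m nm w h k /= mk; apply: h => /=; exact: leq_trans mk.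
  move: ndtau extau; apply: filterS2 => w nd [k hk]; exists k => l /= kl.
  by apply: le_trans hk _; exact: nd.
pose V m w := \sum_(j < m.+1) `|A (grid m j.+1) w - A (grid m j) w|.
have mV m : measurable_fun setT (V m).
  apply: measurable_sum => j; apply: measurableT_comp => //.
  by apply: measurable_funB; apply: mA; apply: grid_itv => //; rewrite ltnW.
(* One bound for all grids at once, so that the level [L] can be chosen before the mesh. *)
pose E3 n := \bigcap_m [set w | V m w <= n%:R].
have mE3 n : measurable (E3 n).
  apply: bigcapT_measurable => m; rewrite -[X in measurable X]setTI.
  exact: measurable_fun_le.
have [L hL] : exists n, fine (P (~` E3 n)) < 4^-1.
  apply: ae_eventually_prob => //.
    by move=> n m nm w h k _ /=; apply: le_trans (h k I) _; rewrite ler_nat.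
  move: bvA; apply: filterS => w [C hC].
  exists (Num.trunc `|C|).+1 => m _ /=; apply: (@le_trans _ _ C).
    apply: hC; exists [seq grid m j | j <- iota 1 m.+1]; first exact: grid_partition.
    rewrite (variation_zip (A ^~ w) (grid_partition T0 m)).
    by rewrite (big_zip_grid T m (fun x => `|A x.1 w - A x.2 w|)).
  apply: le_trans (ler_norm C) _.
  by rewrite ltW// truncnS_gt.
pose N t w := Mt (Num.min t (tau k0 w)) w.
have [_ mgN] := mgtau k0.
have iN : P.-integrable setT (EFin \o N T).
  by have [ ] := mgN T T (ltW T0) (lexx T) (lexx T).
pose e0 := \int[P]_w `|N T w|.
have e00 : 0 <= e0 by apply: Rintegral_ge0.
(* Chosen so that 3 e0 < l / 4: the weak-type inequality then bounds the probability of [B4 m] by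
   less than 1/4 for every m. *)
pose l := 12 * e0 + 1.
have l0 : 0 < l by rewrite ltr_wpDl// mulr_ge0.
pose B4 m := [set w | l ^+ 2 <= \sum_(j < m.+1) (N (grid m j.+1) w - N (grid m j) w) ^+ 2].
have gridT m : grid m m.+1 = T by rewrite /grid /mesh mulrC divfK// pnatr_eq0.
have mN m j : (j <= m.+1)%N -> measurable_fun setT (N (grid m j)).
  move=> jm; have /andP[g0 gT] := grid_itv T0 jm.
  have [_ iNj _ _] := mgN _ _ g0 gT (lexx T).
  by have /integrableP[/measurable_EFinP] := iNj.
have mB4 m : measurable (B4 m).
  rewrite -[X in measurable X]setTI; apply: measurable_fun_le => //.
  apply: measurable_sum => j; apply: measurable_funX; apply: measurable_funB; apply: mN => //.
  exact: ltnW.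
have hB4 m : fine (P (B4 m)) < 4^-1.
  have gmono j k : (j <= k)%N -> grid m j <= grid m k.
    by move=> jk; rewrite /grid ler_pM2r// ler_nat.
  have sG k : (k <= m.+1)%N -> sigma_algebra setT (F (grid m k)) /\ F (grid m k) `<=` measurable.
    by move=> km; apply: Fs; exact: grid_itv.
  have GS j k : (j <= k)%N -> (k <= m.+1)%N -> F (grid m j) `<=` F (grid m k).
    move=> jk km; have /andP[_ kT] := grid_itv T0 km.
    by have /andP[j0 _] := grid_itv T0 (leq_trans jk km); apply: Fmono => //; exact: gmono.
  have N0 w : N (grid m 0) w = 0.
    by rewrite /N /grid mul0r min_l ?Mt0//; exact: (stau k0).1.
  have mg k : (k < m.+1)%N -> cond_expectation P (F (grid m k)) (N (grid m k.+1)) (N (grid m k)).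
    move=> km; have /andP[_ kT] := grid_itv T0 km; have /andP[k0' _] := grid_itv T0 (ltnW km).
    by apply: mgN => //; exact: gmono.
  have iN' : P.-integrable setT (EFin \o N (grid m m.+1)) by rewrite gridT.
  have := martingale_square_function (N := fun j => N (grid m j)) sG GS N0 mg iN' (ltW l0).
  rewrite gridT -/e0 -/(B4 m) expr2 -mulrA (mulrAC 3) [leRHS]mulrC ler_pM2l// => h.
  have : l * fine (P (B4 m)) < l * 4^-1 by apply: le_lt_trans h _; rewrite /l; lra.
  by rewrite ltr_pM2l.
(* Off the bad events, (x + y)^2 <= 2 x^2 + 2 y^2 keeps the quadratic variation of X below this
   threshold, while 1 - M > 1/4 makes it at least half of (m + 1) v(mesh). *)
have [N1 hN1] := variance_blowup (2 * l ^+ 2 + 2 * L%:R ^+ 2).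
have [N2 hN2] := bad_prob.
pose m := maxn N1 N2.
have {hN1} h1 := hN1 m (leq_maxl _ _); have {hN2} h2 := hN2 m (leq_maxr _ _).
pose B1 := [set w | 3 / 4 <= M m w].
have mB1 : measurable B1.
  rewrite -[X in measurable X]setTI; apply: measurable_fun_le => //.
  exact: (measurable_mean_cos v T0 cgX).
have XMA' : {ae P, forall w, forall j, (j <= m.+1)%N ->
    X (grid m j) w i0 0 = Mt (grid m j) w + A (grid m j) w}.
  apply: ae_foralln => j; have [jm|jm] := boolP (j <= m.+1)%N; last exact: aeW.
  by move: (XMA _ (grid_itv T0 jm)); apply: filterS => w e _.
have aeU : {ae P, forall w, (B1 `|` ~` E2 k0 `|` ~` E3 L `|` B4 m) w}.
  move: XMA'; apply: filterS => w e; apply: contrapT => nU.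
  have b1 : M m w < 3 / 4 by rewrite ltNge; apply/negP => h; apply: nU; left; left; left.
  have b2 : T <= tau k0 w.
    have : E2 k0 w by apply: contrapT => h; apply: nU; left; left; right.
    by apply => /=.
  have b3 : V m w <= L%:R.
    have : E3 L w by apply: contrapT => h; apply: nU; left; right.
    exact.
  have b4 : \sum_(j < m.+1) (N (grid m j.+1) w - N (grid m j) w) ^+ 2 < l ^+ 2.
    by rewrite ltNge; apply/negP => h; apply: nU; right.
  have eN j : (j <= m.+1)%N -> N (grid m j) w = Mt (grid m j) w.
    move=> jm; rewrite /N min_l//; apply: le_trans b2.
    by have /andP[] := grid_itv T0 jm.
  have QX : \sum_(j < m.+1) inc m j w ^+ 2 <=
      2 * \sum_(j < m.+1) (N (grid m j.+1) w - N (grid m j) w) ^+ 2 +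
      2 * \sum_(j < m.+1) (A (grid m j.+1) w - A (grid m j) w) ^+ 2.
    rewrite !mulr_sumr -big_split/=; apply: ler_sum => j _.
    have jm : (j <= m.+1)%N by exact: ltnW.
    rewrite /grid_inc !e// !eN//.
    move: (Mt _ _) (Mt _ _) (A _ _) (A _ _) => x1 x2 y1 y2.
    by have := sqr_ge0 (x1 - x2 - (y1 - y2)); rewrite !expr2; lra.
  have QA := sum_sqr_le b3.
  have := quadratic_variation_ge m w.
  have vm : 0 < m.+1%:R * v (mesh m) by rewrite mulr_gt0// v_gt0.
  move: (m.+1%:R * v _) vm h1 => q vm h1 h3.
  have : q * (4^-1) <= q * (1 - M m w) by apply: ler_wpM2l; [exact: ltW|lra].
  move: (\sum_(j < m.+1) inc m j w ^+ 2) h3 QX => S h3.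
  move: b4 QA; move: (\sum_(j < m.+1) _) (\sum_(j < m.+1) _) => S1 S2 b4 QA.
  by move: (l ^+ 2) (L%:R ^+ 2) b4 QA h1 => l2 L2; lra.
have mC2 : measurable (~` E2 k0) by exact: measurableC.
have mC3 : measurable (~` E3 L) by exact: measurableC.
have PU A1 A2 : measurable A1 -> measurable A2 -> fine (P (A1 `|` A2)) <= fine (P A1) + fine (P A2).
  move=> m1 m2; rewrite -fineD ?fin_num_measure//; apply: fine_le.
  - by apply: fin_num_measure; exact: measurableU.
  - by rewrite fin_numD !fin_num_measure.
  - exact: measureU2.
have mU : measurable (B1 `|` ~` E2 k0 `|` ~` E3 L `|` B4 m).
  by do 3 (apply: measurableU => //).
have P1 : fine (P (B1 `|` ~` E2 k0 `|` ~` E3 L `|` B4 m)) = 1.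
  have : P (~` (B1 `|` ~` E2 k0 `|` ~` E3 L `|` B4 m)) = 0%E.
    apply/measure_negligible; first exact: measurableC.
    exact: aeU.
  rewrite probability_setC// => /(congr1 (@fine R)); rewrite fineB//; last exact: fin_num_measure.
  by move=> /eqP; rewrite subr_eq0 => /eqP <-.
have := PU _ _ (measurableU _ _ (measurableU _ _ mB1 mC2) mC3) (mB4 m).
have := PU _ _ (measurableU _ _ mB1 mC2) mC3.
have := PU _ _ mB1 mC2.
have := hB4 m; rewrite P1; move: h2 hk0 hL; rewrite -/B1.
move: (fine _) (fine _) (fine _) (fine _) (fine _) (fine _) => y1 y2 y3 y4 y5 y6 *; lra.
Qed.

End not_semimartingale.

(** * Monotonicity and behaviour near 0 of the variance function *)

Section mixed_variance_growth.
Context {R : realType}.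
Variables (H lam : nat -> R).
Hypothesis H01 : forall n, 0 < H n < 2^-1.
Hypothesis lam1 : cvgn (series (fun n => `|lam n|)).

Lemma mixed_var_mono t s : 0 <= s <= t -> mixed_var H lam s <= mixed_var H lam t.
Proof.
move=> /andP[s0 st]; have t0 := le_trans s0 st.
have nn k : 0 <= 1 * t `^ (2 * H k) + -1 * s `^ (2 * H k) + 0 * 0 `^ (2 * H k).
  rewrite mul0r addr0 mul1r mulN1r subr_ge0 ge0_ler_powR// mulr_ge0//.
  by have /andP[/ltW] := H01 k.
have := mixed_var3_ge H01 lam1 0 t0 s0 (lexx 0) nn.
rewrite (mixed_var0 lam H01) mulr0 addr0 => h.
have : 0 <= 1 * mixed_var H lam t + -1 * mixed_var H lam s.
  by apply: le_trans h; rewrite mulr_ge0 ?sqr_ge0 ?nn.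
by rewrite mul1r mulN1r subr_ge0.
Qed.

(** Infinitely many coefficients are nonzero and H_n tends to 0, so some n has both lam_n nonzero
    and 2 H_n < b; this single term bounds the series from below. *)
Lemma mixed_var_slow : H n @[n --> \oo] --> 0 -> ([set n | lam n != 0%R] #= [set: nat])%card ->
  forall b, 0 < b -> exists c a, [/\ 0 < c, 0 < a < b &
    forall t, 0 <= t -> c * t `^ a <= mixed_var H lam t].
Proof.
move=> H0 inf b b0.
have b2 : 0 < b / 2 by rewrite divr_gt0.
move/cvgrPdist_lt : H0 => /(_ _ b2)[N _ hN].
have [n Nn ln] : exists2 n, (N <= n)%N & lam n != 0.
  apply: contrapT => h; apply: infinite_nat; rewrite -(eq_finite_set inf).
  apply: (sub_finite_set (B := `I_N)) => [n /= ln|]; last exact: finite_II.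
  by rewrite ltnNge; apply/negP => Nn; apply: h; exists n.
have /andP[Hn0 _] := H01 n.
exists (lam n ^+ 2), (2 * H n); split.
- by rewrite exprn_even_gt0.
- rewrite mulr_gt0//=; have := hN n Nn; rewrite /= sub0r normrN gtr0_norm//.
  by rewrite ltr_pdivlMr// mulrC.
- by move=> t t0; exact: mixed_var_ge.
Qed.

End mixed_variance_growth.

Lemma cvgn_series_norm (R : realType) (u : nat -> R) :
  (\sum_(0 <= n <oo) `|u n|%:E < +oo)%E -> cvgn (series (fun n => `|u n|)).
Proof.
move=> uoo; apply: nondecreasing_is_cvgn; first exact: nondecreasing_series.
have u0 n : (0 <= n)%N -> true -> (0 <= `|u n|%:E)%E by rewrite lee_fin.
exists (fine (\sum_(0 <= n <oo) `|u n|%:E)%E) => _ [N _ <-].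
rewrite -lee_fin fineK; last by rewrite ge0_fin_numE// nneseries_ge0.
rewrite /series/= -sumEFin.
exact: (@nneseries_lim_ge R (fun n => `|u n|%:E)%E xpredT 0 N u0).
Qed.

Unset Implicit Arguments.

Theorem theorem3p1 (R : realType) (dsp : measure_display)
    (Omega : measurableType dsp) (P : probability Omega R)
    (T : R) (d : nat) (H lam : nat -> R)
    (W B : nat -> R -> Omega -> 'cV[R]_d) :
  0 < T -> (1 <= d)%N ->
  (forall n, 0 < H n < 2^-1) -> nonincreasing_seq H -> H n @[n --> \oo] --> 0 ->
  (forall n, brownian_motion P (W n)) ->
  independent P setT (fun n => sigma_process `[0, +oo[ (W n)) ->
  (forall n, fractional_brownian_motion P (H n) (B n)) ->
  independent P setT (fun n => sigma_process `[0, +oo[ (B n)) ->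
  (forall n t, 0 <= t ->
    wiener_integral P (W n) t (fun s => KH (H n) t s) (B n t)) ->
  ([set n | lam n != 0%R] #= [set: nat])%card ->
  (0 < \sum_(0 <= n <oo) `|lam n|%:E < +oo)%E ->
  (\sum_(0 <= n <oo) (`|lam n|%:E *
     \int[P]_w ereal_sup [set (enorm (B n s w))%:E | s in `[0%R, 1%R]])
   < +oo)%E ->
  let BH := series_process lam B in
  (forall t, 0 <= t <= T ->
    {ae P, forall w, cvgn (series (fun n => lam n *: B n t w))} /\
    forall i, (fun w => BH t w i 0) \in Lfun P 2%:E) /\
  (forall t, 0 <= t <= T ->
    normal_vector P (BH t) /\ mx_expectation P (BH t) = 0) /\
  (forall t s, 0 <= t <= T -> 0 <= s <= T ->
    cvgn (series (fun n => lam n ^+ 2 * fbm_cov (H n) t s)) /\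
    mx_expectation P (fun w => BH t w *m (BH s w)^T) =
      limn (series (fun n => lam n ^+ 2 * fbm_cov (H n) t s)) *: 1%:M) /\
  stationary_increments P T BH /\
  (~ exists (alpha : R) (Y : R -> Omega -> 'cV[R]_d),
     [/\ 0 < alpha, is_version P `[0, T] BH Y &
         {ae P, forall w, holder_path alpha T (Y ^~ w)}]) /\
  (forall p : R, 0 < p ->
    {ae P, forall w, p_variation p 0 T (BH ^~ w) = +oo%E}) /\
  ~ semimartingale P T BH /\
  ~ markov_process P T BH /\
  ~ independent_increments P `[0, T] BH /\
  {ae P, forall w, {within `[0, T], continuous (BH ^~ w)}}.
Proof.
move=> T0 d1 H01 _ H0 _ _ fbm indB _ inf /andP[_ lam_fin] supB BH.
have lam1 := cvgn_series_norm lam_fin.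
have cgB n : centered_gaussian P `[0, +oo[ (B n) (fbm_cov (H n)).
  have [gB mB cB _] := fbm n; apply: gaussian_process_centered => //.
    by move=> t; rewrite /= in_itv/= andbT; exact: mB.
  by move=> t s; rewrite /= !in_itv/= !andbT; exact: cB.
have ctB n : {ae P, forall w, {within `[0, +oo[, continuous (B n ^~ w)}}.
  by have [_ _ _] := fbm n.
have cg : centered_gaussian P `[0, T] BH (mixed_cov H lam).
  exact: series_process_centered_gaussian.
have itvT t : 0 <= t <= T -> `[0, T]%classic t by rewrite /= in_itv.
have Ksym t s : mixed_cov H lam t s = mixed_cov H lam s t.
  rewrite /mixed_cov; congr (limn (series _)); apply/funext => n.
  by rewrite /fbm_cov distrC (addrC (s `^ _)).
have K0 (s : seq (R * 'rV[R]_d)) : (forall p, p \in s -> `[0, T]%classic p.1) ->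
    0 <= qform (mixed_cov H lam) s.
  by move=> sT; exact: gaussian_cf_ge0 (cg s sT).
(* Apart from path continuity and convergence of the series, what follows concerns a centered
   Gaussian process whose covariance is expressed through [v]. *)
pose v := mixed_var H lam.
have KE t s : 0 <= t -> 0 <= s -> mixed_cov H lam t s = 2^-1 * (v s + v t - v `|t - s|).
  by move=> t0 s0; rewrite mixed_covE.
have v0 : v 0 = 0 by exact: mixed_var0.
have slow := mixed_var_slow H01 lam1 H0 inf.
have [n ln] : exists n, lam n != 0.
  apply: contrapT => h; apply: infinite_nat; rewrite -(eq_finite_set inf).
  by rewrite (_ : [set n | lam n != 0] = set0)//; apply/seteqP; split=> // n ln; apply: h; exists n.
have v_gt0 t : 0 < t -> 0 < v t by exact: mixed_var_gt0 ln.
have v_mono t s : 0 <= s <= t -> v s <= v t by exact: mixed_var_mono.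
have v_mid t h : 0 <= h <= t -> v (t - h) + v (t + h) <= 2 * v t by exact: mixed_var_midpoint.
have v_sub t s : 0 < t -> 0 < s -> v (t + s) < v t + v s by exact: mixed_var_subadd ln.
have v_lip t s : 0 <= s <= t -> 0 < t -> v t - v (t - s) <= v t * (s / t) by exact: mixed_var_sub_le.
pose i0 : 'I_d := Ordinal d1.
split; [|split; [|split; [|split; [|split; [|split; [|split; [|split; [|split]]]]]]]].
- move=> t tT; split.
    by have := ae_cvgn_series T0 H01 cgB ctB supB; apply: filterS => w; exact.
  by move=> i; apply: centered_gaussian_coord_Lfun2 cg K0 _ _ _; exact: itvT.
- move=> t tT; split.
    by apply: centered_gaussian_normal_vector cg K0 _ _; exact: itvT.
  by apply: centered_gaussian_mx_mean cg K0 _ _; exact: itvT.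
- move=> t s tT sT; have /andP[t0 _] := tT; have /andP[s0 _] := sT; split.
    by apply/cvg_ex; eexists; exact: cvg_series_mixed_cov.
  by rewrite scalemx1; exact: (centered_gaussian_mx_cov cg Ksym K0 (itvT _ tT) (itvT _ sT)).
- exact: gaussian_stationary_increments cg KE.
- exact: gaussian_not_holder cg KE v0 i0 slow.
- by move=> p; exact: ae_p_variation_infinite T0 cg KE v0 v_gt0 v_mono v_mid slow i0 p.
- exact: gaussian_not_semimartingale T0 cg KE v0 v_gt0 v_mono v_mid slow i0.
- exact: gaussian_not_markov T0 cg KE v0 v_gt0 i0 v_sub v_mono v_lip (slow 1 ltr01).
- exact: gaussian_dependent_increments T0 cg KE v0 i0 v_sub.
- exact: series_process_continuous T0 H01 cgB ctB supB.
Qed.
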